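(* Let $\mu$ be a finite positive Borel measure on $[0,1)$ and let $\alpha>1$. Then the following statements are equivalent. (1) The measure $\mu$ is a vanishing $\alpha$-Carleson measure, i.e. $\lim_{t\to1^-}\frac{\mu([t,1))}{(1-t)^\alpha}=0$. (2) The operator $\mathcal{H}_\mu$ is compact from $\mathcal{B}^\alpha$ into $\mathcal{B}$. (3) The operator $\mathcal{H}_\mu$ is compact from $\mathcal{B}^\alpha$ into $BMOA$.
   Context: $\mathbb{D}=\{z\in\mathbb{C}:|z|<1\}$ and $H(\mathbb{D})$ is the space of analytic functions on $\mathbb{D}$. For $0<\alpha<\infty$, the Bloch type space $\mathcal{B}^\alpha$ consists of all $f\in H(\mathbb{D})$ with $\|f\|_{\mathcal{B}^\alpha}=\sup_{z\in\mathbb{D}}|f'(z)|(1-|z|^2)^\alpha<\infty$; it is a Banach space with the norm $|f(0)|+\|f\|_{\mathcal{B}^\alpha}$. The Bloch space is $\mathcal{B}=\mathcal{B}^1$. $BMOA$ is the Banach space of all $f\in H(\mathbb{D})$ with $\|f\|_{BMOA}=|f(0)|+\sup_{a\in\mathbb{D}}\|f\circ\varphi_a-f(a)\|_{H^2}<\infty$, where $\varphi_a(z)=\frac{a-z}{1-\bar a z}$ and $H^2$ is the Hardy space. For a finite positive Borel measure $\mu$ on $[0,1)$ put $\mu_n=\int_{[0,1)}t^n\,d\mu(t)$, $n\ge 0$. The operator $\mathcal{H}_\mu$ acts on $f(z)=\sum_{k=0}^\infty a_kz^k\in H(\mathbb{D})$ by $$\mathcal{H}_\mu(f)(z)=\sum_{n=0}^\infty\Big(\sum_{k=0}^\infty\mu_{n+k}a_k\Big)z^n,$$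 whenever the right-hand side makes sense (the inner series converge) and defines an analytic function in $\mathbb{D}$. Saying that $\mathcal{H}_\mu$ is compact from $X$ into $Y$ means that $\mathcal{H}_\mu(f)$ is well defined and belongs to $Y$ for every $f\in X$, and the resulting linear operator $X\to Y$ is compact. *)

(* Defs.v *)
From HB Require Import structures.
From mathcomp Require Import all_boot all_order all_algebra complex.
From mathcomp Require Import all_classical all_reals all_analysis.

Set Implicit Arguments.
Unset Strict Implicit.
Unset Printing Implicit Defensive.

Import Order.TTheory GRing.Theory Num.Theory.
Import numFieldNormedType.Exports.

Local Open Scope classical_set_scope.
Local Open Scope ring_scope.
Local Open Scope complex_scope.

(* [R[i]^o] rather than [R[i]]: it is the regular type that carries the
   canonical topology and the normed-module structure over [R[i]]. The norm
   [`|z|] is then [R[i]]-valued, whence the use of the real-valued [cabs]. *)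
Notation Cpx R := (R[i]^o).

Section Definitions.
Context (R : realType).
Local Notation C := (Cpx R).
Local Notation measR :=
  {finite_measure set (measurableTypeR R) -> \bar R}.
Implicit Types (f g : C -> C) (z a : C).

Definition cabs z : R := ComplexField.Normc.normc z.

Definition disc : set C := [set z | cabs z < 1].

(* Elements of H(D) are represented by total functions; every notion below
   depends only on their values on [disc]. *)
Definition analytic_on_disc f : Prop :=
  forall z0, disc z0 ->
    exists (c : nat -> C) (r : R), 0 < r /\
      forall z, cabs (z - z0) < r ->
        series (fun n => c n * (z - z0) ^+ n) @ \oo --> f z.

Definition power_series_on_disc (c : nat -> C) f : Prop :=
  forall z, disc z -> series (fun n => c n * z ^+ n) @ \oo --> f z.

(* [derive1] is taken over the field [R[i]]: it is the complex derivative. *)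
Definition bloch_seminorm (alpha : R) f : \bar R :=
  ereal_sup [set (cabs (derive1 f z) * (1 - cabs z ^+ 2) `^ alpha)%:E
            | z in disc].

Definition bloch_norm (alpha : R) f : \bar R :=
  ((cabs (f 0))%:E + bloch_seminorm alpha f)%E.

Definition polar (r theta : R) : C := (r * cos theta) +i* (r * sin theta).

Definition hardy2_norm f : \bar R :=
  poweR (ereal_sup [set ((2 * pi)^-1%:E *
           \int[lebesgue_measure]_(theta in `[0%R, (2 * pi)%R])
             ((cabs (f (polar r theta)) ^+ 2)%:E))%E | r in `[0, 1[])
        2^-1.

Definition mobius a z : C := (a - z) / (1 - conjc a * z).

Definition bmoa_norm f : \bar R :=
  ((cabs (f 0))%:E +
   ereal_sup [set hardy2_norm (fun z => (f (mobius a z) - f a)%R)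
             | a in disc])%E.

(* The Banach space cut out of H(D) by an extended-valued norm. *)
Definition disc_space (N : (C -> C) -> \bar R) : set (C -> C) :=
  [set f | analytic_on_disc f /\ (N f < +oo)%E].

Definition moment (mu : measR) (n : nat) : R :=
  \int[mu]_(t in `[0, 1[) (t ^+ n).

(* Graph of H_mu: [hankel mu f g] says that H_mu(f) is well defined (the inner
   series converge and the outer one converges on the disc) with value g. *)
Definition hankel (mu : measR) f g : Prop :=
  exists a b : nat -> C,
    [/\ power_series_on_disc a f,
        forall n, series (fun k => (moment mu (n + k))%:C * a k) @ \oo --> b n
      & power_series_on_disc b g].

(* T is the graph of an operator: it is everywhere defined from X to Y and maps
   every bounded sequence of X to a sequence with a subsequence converging in Y.
   The values of the operator being determined on the disc only, the latter is
   required of all representatives G n of the image of F n. *)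
Definition compact_operator (T : (C -> C) -> (C -> C) -> Prop)
    (NX NY : (C -> C) -> \bar R) : Prop :=
  (forall f, disc_space NX f -> exists2 g, disc_space NY g & T f g) /\
  (forall F G : nat -> C -> C,
     (forall n, disc_space NX (F n)) ->
     (exists M : R, forall n, (NX (F n) <= M%:E)%E) ->
     (forall n, T (F n) (G n)) ->
     exists phi : nat -> nat, exists g : C -> C,
       [/\ {homo phi : m n / (m < n)%N}, disc_space NY g
         & (fun n => NY (fun z => G (phi n) z - g z)) @ \oo --> 0%E]).

Definition vanishing_carleson (alpha : R) (mu : measR) : Prop :=
  fine (mu [set` `[t, 1[%R]) / (1 - t) `^ alpha @[t --> 1^'-] --> (0 : R).

End Definitions.

(* Main.v *)
(* Under a Carleson condition H_mu(f) is the Cauchy type transform of f mu, the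
   integral of f(t) / (1 - t z). The inner series converge because Bessel's
   inequality on circles gives sum |a_k| t^k = O((1 - t)^(1/2 - alpha)), which is
   mu-integrable.

   For real u with |u(t)| <= L (1 - t)^(1 - alpha), the imaginary part of the
   integral of u(t) / (1 - t z) is at most the integral of |u(t)| |Im z| / |1 - t z|^2,
   which the alpha-Carleson condition bounds uniformly on the disc by a dyadic
   decomposition. A holomorphic function whose imaginary part is bounded by K lies
   in BMOA with seminorm O(K), since the square of h o phi_a - h(a) has mean value
   zero on circles. Applied to the real and imaginary parts of f on [0, 1), this
   bounds H_mu. For compactness, select a subsequence converging locally uniformly
   on [0, 1): near 1 the Carleson constant is small, and away from 1 the
   difference of the functions is small.

   BMOA embeds in the Bloch space by reading the first Taylor coefficient of
   f o phi_a off its H^2 norm. Conversely, take f_b(z) = (1 - b)^(p+2-alpha) /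
   (1 - b z)^(p+1) with p + 1 >= alpha. These are bounded in the Bloch type space,
   and since all coefficients and moments are nonnegative, the Bloch seminorm of
   H_mu(f_b), tested at z = b, is at least a constant times
   mu([b, 1)) / (1 - b)^alpha. Compactness first bounds this ratio; then
   H_mu(f_b)' tends to 0 pointwise as b tends to 1, so compactness forces the
   ratio to tend to 0. *)

Require Import Defs.
From HB Require Import structures.
From mathcomp Require Import all_boot all_order all_algebra complex.
From mathcomp Require Import all_classical all_reals all_analysis.
From mathcomp Require Import measurable_realfun.
From mathcomp Require Import ring lra.

Set Implicit Arguments.
Unset Strict Implicit.
Unset Printing Implicit Defensive.
Import Order.TTheory GRing.Theory Num.Theory.
Import numFieldNormedType.Exports.
Local Open Scope classical_set_scope.
Local Open Scope ring_scope.

(** Absolute values are not enough for the transform: with the growth (1 - t)^(1 - alpha) each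
    dyadic shell may contribute a constant to the integral of |f(t)| / |1 - t z|, which only gives a
    logarithmic bound. The imaginary part gains the factor |Im z| / |1 - t z|, and the shells then
    sum like a two-sided geometric series. This needs a real density, so the real and imaginary
    parts of f on [0, 1) are treated as two unrelated functions.

    The formula for the Hankel coefficients is a separate matter: growth of f says nothing about its
    partial sums on [0, 1), whence the detour through absolute sums; the loss of 1/2 in the exponent
    keeps it below alpha.

    Necessity takes two rounds because the pointwise decay comes from integrating (1 - t)^(1/2 -
    alpha), known to be integrable only once the ratio is bounded. The exponent p + 1 is an integer
    so that the test functions have explicit nonnegative binomial coefficients.

    Analyticity is given by local power series while the operator uses one expansion on the whole
    disc; hence a proof of Cauchy's formula for functions with continuous derivative. *)

Arguments cabs : simpl never.

(** * Modulus, limits and derivatives over the complex numbers *)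

Section ComplexModulus.
Context {R : realType}.
Local Notation C := (Cpx R).
Local Notation rc := (real_complex R).
Implicit Types (z w : C) (x y : R).

Lemma cabsE z : `|z| = rc (cabs z).
Proof. by case: z => a b. Qed.

Lemma cabs_ge0 z : 0 <= cabs z.
Proof. by case: z => a b; exact: sqrtr_ge0. Qed.

Lemma cabsM z w : cabs (z * w) = cabs z * cabs w.
Proof. exact: ComplexField.Normc.normcM. Qed.

Lemma cabs0 : cabs (0 : C) = 0.
Proof. exact: ComplexField.Normc.normc0. Qed.

Lemma cabs1 : cabs (1 : C) = 1.
Proof. exact: ComplexField.Normc.normc1. Qed.

Lemma cabsN z : cabs (- z) = cabs z.
Proof. by apply: complexI; rewrite -!cabsE normrN. Qed.

Lemma cabs_distC z w : cabs (z - w) = cabs (w - z).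
Proof. by rewrite -cabsN opprB. Qed.

Lemma cabsD z w : cabs (z + w) <= cabs z + cabs w.
Proof. by rewrite -lecR rmorphD /= -!cabsE; exact: ler_normD. Qed.

Lemma cabsB z w : cabs (z - w) <= cabs z + cabs w.
Proof. by rewrite -(cabsN w); exact: cabsD. Qed.

Lemma cabs_dist z w : cabs z - cabs w <= cabs (z - w).
Proof. by rewrite lerBlDr; have := cabsD (z - w) w; rewrite subrK. Qed.

Lemma norm_cabsB z w : `|cabs z - cabs w| <= cabs (z - w).
Proof. by rewrite ler_norml cabs_dist andbT lerNl opprB cabs_distC cabs_dist. Qed.

Lemma cabsV z : cabs z^-1 = (cabs z)^-1.
Proof. exact: ComplexField.Normc.normcV. Qed.

Lemma cabsX z n : cabs (z ^+ n) = cabs z ^+ n.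
Proof. by elim: n => [|n IH]; rewrite ?expr0 ?cabs1// !exprS cabsM IH. Qed.

Lemma cabs_rc x : cabs (rc x : C) = `|x|.
Proof. by rewrite /cabs/= expr0n/= addr0 sqrtr_sqr. Qed.

Lemma cabs_eq0 z : (cabs z == 0) = (z == 0).
Proof.
apply/eqP/eqP => [|->]; last exact: cabs0.
exact: ComplexField.Normc.eq0_normc.
Qed.

Lemma cabs_gt0 z : (0 < cabs z) = (z != 0).
Proof. by rewrite lt_def cabs_ge0 andbT cabs_eq0. Qed.

Lemma cabs_sqr z : cabs z ^+ 2 = complex.Re z ^+ 2 + complex.Im z ^+ 2.
Proof. by case: z => a b; rewrite /cabs/= sqr_sqrtr// addr_ge0// sqr_ge0. Qed.

Lemma Re_le_cabs z : `|complex.Re z| <= cabs z.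
Proof.
rewrite -(@ler_pXn2r _ 2)// ?nnegrE ?cabs_ge0// cabs_sqr real_normK ?num_real//.
by rewrite lerDl sqr_ge0.
Qed.

Lemma Im_le_cabs z : `|complex.Im z| <= cabs z.
Proof.
rewrite -(@ler_pXn2r _ 2)// ?nnegrE ?cabs_ge0// cabs_sqr real_normK ?num_real//.
by rewrite lerDr sqr_ge0.
Qed.

Lemma cabs_le_ReIm z : cabs z <= `|complex.Re z| + `|complex.Im z|.
Proof.
rewrite -(@ler_pXn2r _ 2)// ?nnegrE ?cabs_ge0 ?addr_ge0// cabs_sqr sqrrD.
rewrite !real_normK ?num_real// -addrA lerD2l lerDr.
by rewrite pmulrn_lge0// mulr_ge0.
Qed.

Lemma cabs_conjc z : cabs (conjc z : C) = cabs z.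
Proof. by case: z => a b; rewrite /cabs/= sqrrN. Qed.

Lemma cabs_sum (I : Type) (r : seq I) (P : pred I) (F : I -> C) :
  cabs (\sum_(i <- r | P i) F i) <= \sum_(i <- r | P i) cabs (F i).
Proof.
elim/big_ind2 : _ => //; first by rewrite cabs0.
by move=> x1 x2 y1 y2 h1 h2; rewrite (le_trans (cabsD _ _))// lerD.
Qed.

Lemma cReD z w : complex.Re (z + w) = complex.Re z + complex.Re w.
Proof. by case: z; case: w. Qed.

Lemma cImD z w : complex.Im (z + w) = complex.Im z + complex.Im w.
Proof. by case: z; case: w. Qed.

Lemma cReN z : complex.Re (- z) = - complex.Re z.
Proof. by case: z. Qed.

Lemma cImN z : complex.Im (- z) = - complex.Im z.
Proof. by case: z. Qed.

Lemma cReM z w : complex.Re (z * w) =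
  complex.Re z * complex.Re w - complex.Im z * complex.Im w.
Proof. by case: z; case: w. Qed.

Lemma cImM z w : complex.Im (z * w) =
  complex.Re z * complex.Im w + complex.Im z * complex.Re w.
Proof. by case: z; case: w. Qed.

Lemma Re_rcM x z : complex.Re (rc x * z : C) = x * complex.Re z.
Proof. by rewrite cReM /= mul0r subr0. Qed.

Lemma Im_rcM x z : complex.Im (rc x * z : C) = x * complex.Im z.
Proof. by rewrite cImM /= mul0r addr0. Qed.

Lemma Re_sum (I : Type) (r : seq I) (P : pred I) (F : I -> C) :
  complex.Re (\sum_(i <- r | P i) F i) = \sum_(i <- r | P i) complex.Re (F i).
Proof. by elim/big_ind2 : _ => // x1 x2 y1 y2 <- <-; rewrite cReD. Qed.

Lemma Im_sum (I : Type) (r : seq I) (P : pred I) (F : I -> C) :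
  complex.Im (\sum_(i <- r | P i) F i) = \sum_(i <- r | P i) complex.Im (F i).
Proof. by elim/big_ind2 : _ => // x1 x2 y1 y2 <- <-; rewrite cImD. Qed.

Lemma rcB x y : rc (x - y) = rc x - rc y.
Proof. exact: rmorphB. Qed.

Lemma rcM x y : rc (x * y) = rc x * rc y.
Proof. exact: rmorphM. Qed.

Lemma rcX x n : rc (x ^+ n) = rc x ^+ n.
Proof. exact: rmorphXn. Qed.

(** Positive elements of [C] are positive reals, so it suffices to test against real [e]; together
    with [nbhsCP] this replaces the complex-valued norm by [cabs]. *)
Lemma cvgCP (T : Type) (F : set_system T) {FF : Filter F} (f : T -> C) (l : C) :
  f @ F --> l <-> forall e : R, 0 < e -> \forall t \near F, cabs (f t - l) < e.
Proof.
split => [/cvgrPdist_lt fl e e0|fl].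
  have /fl : (0 : C) < rc e by rewrite ltcR.
  by apply: filterS => t; rewrite cabsE ltcR cabs_distC.
apply/cvgrPdist_lt => -[e e'] e0.
have e'0 : e' = 0 by move: e0; rewrite ltcE/= => /andP[/eqP].
move: e0; rewrite e'0 (ltcR 0 e) => e0.
by apply: filterS (fl _ e0) => t; rewrite cabsE ltcR cabs_distC.
Qed.

Lemma cvgCP_le (T : Type) (F : set_system T) {FF : Filter F} (f : T -> C) (l : C) :
  f @ F --> l <-> forall e : R, 0 < e -> \forall t \near F, cabs (f t - l) <= e.
Proof.
split => [/cvgCP fl e /fl|fl]; first by apply: filterS => t /ltW.
apply/cvgCP => e e0; have /fl : 0 < e / 2 by rewrite divr_gt0.
apply: filterS => t /le_lt_trans; apply; rewrite ltr_pdivrMr//.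
by rewrite ltr_pMr// ltr1n.
Qed.

Lemma cvgC_ReIm (T : Type) (F : set_system T) {FF : Filter F} (f : T -> C) (l : C) :
  f @ F --> l <-> ((fun t => complex.Re (f t)) @ F --> complex.Re l /\
                  (fun t => complex.Im (f t)) @ F --> complex.Im l).
Proof.
split => [/cvgCP fl|[/cvgrPdist_lt hr /cvgrPdist_lt hi]].
  split; apply/cvgrPdist_lt => e /fl; apply: filterS => t.
    apply: le_lt_trans; rewrite -cReN -cReD cabs_distC; exact: Re_le_cabs.
  apply: le_lt_trans; rewrite -cImN -cImD cabs_distC; exact: Im_le_cabs.
apply/cvgCP => e e0; have e20 : 0 < e / 2 by rewrite divr_gt0.
near=> t; rewrite cabs_distC (le_lt_trans (cabs_le_ReIm _))// cReD cImD cReN cImN.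
rewrite [ltRHS]splitr ltrD//; near: t; [exact: hr|exact: hi].
Unshelve. all: by end_near. Qed.

Lemma nbhsCP (z : C) (P : set C) :
  nbhs z P <-> exists2 e : R, 0 < e & forall w, cabs (w - z) < e -> P w.
Proof.
split => [/nbhs_ballP[[e e'] /= e0 h]|[e e0 h]].
  have e'0 : e' = 0 by move: e0; rewrite ltcE/= => /andP[/eqP].
  move: e0 h; rewrite e'0 (ltcR 0 e) => e0 h; exists e => // w we; apply: h.
  by rewrite -ball_normE/= cabsE (ltcR _ e) cabs_distC.
apply/nbhs_ballP; exists (rc e); first by rewrite /= ltcR.
by move=> w; rewrite -ball_normE/= cabsE ltcR cabs_distC; exact: h.
Qed.

Lemma continuousCP (f : C -> C) (z : C) : {for z, continuous f} <->
  forall e : R, 0 < e -> exists2 del : R, 0 < del &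
    forall w, cabs (w - z) < del -> cabs (f w - f z) <= e.
Proof.
split=> [/(@cvgCP_le _ _ (nbhs_filter z)) fc e /fc/nbhsCP//|fc].
by apply/(@cvgCP_le _ _ (nbhs_filter z)) => e /fc ?; apply/nbhsCP.
Qed.

Lemma nbhs_disc z : disc z -> nbhs z (@disc R).
Proof.
move=> zD; apply/nbhsCP; exists (1 - cabs z); first by rewrite subr_gt0.
move=> w; rewrite /disc/= => h.
by rewrite -(subrK z w) (le_lt_trans (cabsD _ _))// -ltrBrDr.
Qed.

End ComplexModulus.

Section ComplexLimits.
Context {R : realType}.
Local Notation C := (Cpx R).
Local Notation rc := (real_complex R).

Section Filter.
Variables (T : Type) (F : set_system T).
Context {FF : Filter F}.
Implicit Types (f g : T -> C) (l m : C).

Lemma cvgCD f g l m : f @ F --> l -> g @ F --> m ->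
  (fun t => f t + g t) @ F --> l + m.
Proof.
move=> /cvgC_ReIm[fr fi] /cvgC_ReIm[gr gi]; apply/cvgC_ReIm; split.
  by rewrite cReD; under eq_fun do rewrite cReD; exact: cvgD.
by rewrite cImD; under eq_fun do rewrite cImD; exact: cvgD.
Qed.

Lemma cvgCN f l : f @ F --> l -> (fun t => - f t) @ F --> - l.
Proof.
move=> /cvgC_ReIm[fr fi]; apply/cvgC_ReIm; split.
  by rewrite cReN; under eq_fun do rewrite cReN; exact: cvgN.
by rewrite cImN; under eq_fun do rewrite cImN; exact: cvgN.
Qed.

Lemma cvgCB f g l m : f @ F --> l -> g @ F --> m ->
  (fun t => f t - g t) @ F --> l - m.
Proof. by move=> fl /cvgCN; exact: cvgCD. Qed.

Lemma cvgCM f g l m : f @ F --> l -> g @ F --> m ->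
  (fun t => f t * g t) @ F --> l * m.
Proof.
move=> /cvgC_ReIm[fr fi] /cvgC_ReIm[gr gi]; apply/cvgC_ReIm; split.
  by rewrite cReM; under eq_fun do rewrite cReM; apply: cvgB; exact: cvgM.
by rewrite cImM; under eq_fun do rewrite cImM; apply: cvgD; exact: cvgM.
Qed.

Lemma cvgCV f l : l != 0 -> f @ F --> l -> (fun t => (f t)^-1) @ F --> l^-1.
Proof.
move=> l0 /cvgC_ReIm[fr fi].
have ReV (z : C) : complex.Re z^-1 = complex.Re z / (complex.Re z ^+ 2 + complex.Im z ^+ 2).
  by case: z.
have ImV (z : C) : complex.Im z^-1 = - (complex.Im z / (complex.Re z ^+ 2 + complex.Im z ^+ 2)).
  by case: z => a b /=.
have l20 : complex.Re l ^+ 2 + complex.Im l ^+ 2 != 0.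
  by rewrite -cabs_sqr sqrf_eq0 cabs_eq0.
have f2 : (fun t => (complex.Re (f t) ^+ 2 + complex.Im (f t) ^+ 2)^-1) @ F -->
    (complex.Re l ^+ 2 + complex.Im l ^+ 2)^-1.
  by apply: cvgV => //; apply: cvgD; rewrite expr2; under eq_fun do rewrite expr2;
    exact: cvgM.
apply/cvgC_ReIm; split.
  by rewrite ReV; under eq_fun do rewrite ReV; exact: cvgM.
by rewrite ImV; under eq_fun do rewrite ImV; apply: cvgN; exact: cvgM.
Qed.

Lemma cvgC_cst l : (fun=> l) @ F --> l.
Proof. exact: cvg_cst. Qed.

Lemma cvgC_unique {PF : ProperFilter F} f l m : f @ F --> l -> f @ F --> m -> l = m.
Proof.
move=> fl fm; have := cvgCB fl fm.
under eq_fun do rewrite subrr.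
move=> /cvgCP h; apply/eqP; rewrite -subr_eq0 -cabs_eq0 eq_le cabs_ge0 andbT.
apply/ler_addgt0Pr => e e0; have /filter_ex[_] := h _ e0.
by rewrite sub0r cabsN add0r => /ltW.
Qed.

End Filter.

Implicit Types (f g : C -> C) (z : C).

Lemma continuousCD f g z : {for z, continuous f} -> {for z, continuous g} ->
  {for z, continuous (fun w => f w + g w)}.
Proof. exact: (@cvgCD _ _ (nbhs_filter z)). Qed.

Lemma continuousCM f g z : {for z, continuous f} -> {for z, continuous g} ->
  {for z, continuous (fun w => f w * g w)}.
Proof. exact: (@cvgCM _ _ (nbhs_filter z)). Qed.

Lemma continuousCN f z : {for z, continuous f} ->
  {for z, continuous (fun w => - f w)}.
Proof. exact: (@cvgCN _ _ (nbhs_filter z)). Qed.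

Lemma continuousCV f z : f z != 0 -> {for z, continuous f} ->
  {for z, continuous (fun w => (f w)^-1)}.
Proof. exact: (@cvgCV _ _ (nbhs_filter z)). Qed.

Lemma continuousC_cst l z : {for z, continuous (fun=> l : C)}.
Proof. exact: (@cvgC_cst _ _ (nbhs_filter z)). Qed.

Lemma continuousC_id z : {for z, continuous (id : C -> C)}.
Proof. by apply/continuousCP => e e0; exists e => // w /ltW. Qed.

Lemma continuousC_comp f g z : {for z, continuous f} -> {for f z, continuous g} ->
  {for z, continuous (fun w => g (f w))}.
Proof.
move=> /continuousCP fc /continuousCP gc; apply/continuousCP => e e0.
have [d d0 gd] := gc e e0; have [|d' d'0 fd] := fc (d / 2); first exact: divr_gt0.
exists d' => // w /fd fw; apply: gd; rewrite (le_lt_trans fw)//.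
by rewrite ltr_pdivrMr// ltr_pMr// ltr1n.
Qed.

Lemma continuousCX f n z : {for z, continuous f} ->
  {for z, continuous (fun w => f w ^+ n)}.
Proof.
move=> fc; elim: n => [|n IH]; first exact: continuousC_cst.
have -> : (fun w => f w ^+ n.+1) = (fun w => f w * f w ^+ n).
  by apply/funext => w; rewrite exprS.
exact: continuousCM.
Qed.

Lemma continuousC_sum (I : Type) (r : seq I) (P : pred I) (f : I -> C -> C) z :
  (forall i, P i -> {for z, continuous (f i)}) ->
  {for z, continuous (fun w => \sum_(i <- r | P i) f i w)}.
Proof.
move=> fc; elim: r => [|i r IH].
  have -> : (fun w => \sum_(i <- [::] | P i) f i w) = (fun=> 0).
    by apply/funext => w; rewrite big_nil.
  exact: continuousC_cst.
have -> : (fun w => \sum_(j <- i :: r | P j) f j w) =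
    (fun w => if P i then f i w + \sum_(j <- r | P j) f j w
              else \sum_(j <- r | P j) f j w).
  by apply/funext => w; rewrite big_cons.
by have [/fc fi|_] := boolP (P i); [exact: continuousCD fi IH|exact: IH].
Qed.

Lemma continuousC_near f g z : {near z, f =1 g} ->
  {for z, continuous f} -> {for z, continuous g}.
Proof.
move=> /nbhsCP[d d0 fg] /continuousCP fc; apply/continuousCP => e /fc[d' d'0 fd].
exists (Num.min d d'); first by rewrite lt_min d0.
move=> w; rewrite lt_min => /andP[wd wd'].
by rewrite -fg// -fg ?fd// subrr cabs0.
Qed.

End ComplexLimits.

Section ComplexDerivative.
Context {R : realType}.
Local Notation C := (Cpx R).
Local Notation rc := (real_complex R).
Implicit Types (z w d : C) (f g : C -> C).

Lemma cderivP f z d : is_derive z (1 : C) f d <->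
  forall e : R, 0 < e -> exists2 del : R, 0 < del &
    forall h : C, cabs h < del -> cabs (f (z + h) - f z - h * d) <= e * cabs h.
Proof.
have quotE (h : C) : h != 0 ->
    cabs (h^-1 *: (f (h *: (1 : C) + z) - f z) - d) * cabs h =
    cabs (f (z + h) - f z - h * d).
  move=> h0; rewrite -cabsM mulrBl.
  have -> : h *: (1 : C) = h by rewrite /GRing.scale/= mulr1.
  rewrite /GRing.scale/= (addrC h z) mulrAC mulVf// mul1r; congr (cabs (_ - _)).
  exact: mulrC.
split=> [fd e e0|fd].
  have dl : h^-1 *: (f (h *: (1 : C) + z) - f z) @[h --> (0 : C)^'] --> d.
    by have := @ex_derive _ _ _ _ _ _ _ fd; rewrite -(@derive_val _ _ _ _ _ _ _ fd).
  move/cvgCP_le : dl => /(_ e e0) /nbhsCP[del del0 H]; exists del => // h hdel.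
  have [->|h0] := eqVneq h 0.
    by rewrite addr0 subrr mul0r subr0 cabs0 mulr0.
  rewrite -quotE// ler_wpM2r ?cabs_ge0//.
  by have := H h; rewrite subr0 => /(_ hdel h0).
have dl : h^-1 *: (f (h *: (1 : C) + z) - f z) @[h --> (0 : C)^'] --> d.
  apply/cvgCP_le => e e0; have [del del0 H] := fd _ e0.
  apply/nbhsCP; exists del => // h; rewrite subr0 => hdel h0.
  by rewrite -(@ler_pM2r _ (cabs h)) ?cabs_gt0// quotE//; exact: H.
apply: DeriveDef; first by apply/cvg_ex; exists d.
exact: (@cvg_lim _ (@norm_hausdorff _ C)).
Qed.

Lemma is_cderive1 f z d : is_derive z (1 : C) f d -> derive1 f z = d.
Proof. by move=> fd; rewrite derive1E (@derive_val _ _ _ _ _ _ _ fd). Qed.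

Lemma cderiv_continuous f z d : is_derive z (1 : C) f d -> {for z, continuous f}.
Proof.
by move=> fd; apply: differentiable_continuous; apply/derivable1_diffP.
Qed.

Lemma cderiv_unique f z d d' : is_derive z (1 : C) f d ->
  is_derive z (1 : C) f d' -> d = d'.
Proof. by move=> /is_cderive1 <- /is_cderive1 <-. Qed.

(** Caratheodory's form of differentiability: a factor [H] continuous at [z] replaces the difference
    quotient. The product, chain and inverse rules become algebra on such factors, with no division
    by [w - z]. *)
Lemma Caratheodory_cderiv_near f (H : C -> C) z : {for z, continuous H} ->
  (\forall w \near z, f w - f z = (w - z) * H w) ->
  is_derive z (1 : C) f (H z).
Proof.
move=> Hc fH; apply/cderivP => e e0.
move/cvgCP_le : Hc => /(_ e e0) Hc.
have /nbhsCP[del del0 {}fH] := @filterI _ _ (nbhs_filter z) _ _ Hc fH.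
exists del => // h hdel; have [] := fH (z + h); first by rewrite addrAC subrr add0r.
move=> He ->; rewrite (addrAC z) subrr add0r -mulrBr cabsM mulrC.
by rewrite ler_wpM2r// cabs_ge0.
Qed.

Lemma Caratheodory_cderiv f (H : C -> C) z : {for z, continuous H} ->
  (forall w, f w - f z = (w - z) * H w) -> is_derive z (1 : C) f (H z).
Proof.
move=> Hc fH; apply: Caratheodory_cderiv_near Hc _.
by apply/nbhsCP; exists 1 => // w _; exact: fH.
Qed.

Lemma cderiv_Caratheodory f z d : is_derive z (1 : C) f d ->
  exists H : C -> C, [/\ {for z, continuous H}, H z = d &
    forall w, f w - f z = (w - z) * H w].
Proof.
move=> /cderivP fd.
exists (fun w => if w == z then d else (f w - f z) / (w - z)).
rewrite eqxx; split => // [|w]; last first.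
  have [->|wz] := eqVneq w z; first by rewrite !subrr mul0r.
  by rewrite mulrCA divff ?mulr1// subr_eq0.
apply/continuousCP => e e0; have [del del0 H] := fd e e0; exists del => // w wdel.
rewrite eqxx; have [_|wz] := eqVneq w z; first by rewrite subrr cabs0 ltW.
have wz0 : w - z != 0 by rewrite subr_eq0.
rewrite -(@ler_pM2r _ (cabs (w - z))) ?cabs_gt0// -cabsM mulrBl mulfVK//.
by have := H _ wdel; rewrite (addrC z) subrK (mulrC d).
Qed.

Lemma cderiv_comp f g z d d' : is_derive z (1 : C) f d ->
  is_derive (f z) (1 : C) g d' -> is_derive z (1 : C) (g \o f) (d' * d).
Proof.
move=> fd /cderiv_Caratheodory[G [Gc Gd gG]].
have /cderiv_Caratheodory[F [Fc Fd fF]] := fd.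
rewrite -Gd -Fd.
apply: (@Caratheodory_cderiv (g \o f) (fun w => G (f w) * F w)).
  exact: (continuousCM (continuousC_comp (cderiv_continuous fd) Gc) Fc).
by move=> w /=; rewrite gG fF -mulrA (mulrC (G _)).
Qed.

Lemma cderiv_cst (c : C) z : is_derive z (1 : C) (fun=> c) 0.
Proof.
apply: (@Caratheodory_cderiv (fun=> c) (fun=> 0)); first exact: continuousC_cst.
by move=> w; rewrite subrr mulr0.
Qed.

Lemma cderiv_id z : is_derive z (1 : C) id 1.
Proof.
apply: (@Caratheodory_cderiv id (fun=> 1)); first exact: continuousC_cst.
by move=> w; rewrite mulr1.
Qed.

Lemma cderivD f g z d d' : is_derive z (1 : C) f d -> is_derive z (1 : C) g d' ->
  is_derive z (1 : C) (fun w => f w + g w) (d + d').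
Proof.
move=> /cderiv_Caratheodory[F [Fc <- fF]] /cderiv_Caratheodory[G [Gc <- gG]].
apply: (@Caratheodory_cderiv _ (fun w => F w + G w)); first exact: (continuousCD Fc Gc).
by move=> w; rewrite opprD addrACA fF gG mulrDr.
Qed.

Lemma cderivM f g z d d' : is_derive z (1 : C) f d -> is_derive z (1 : C) g d' ->
  is_derive z (1 : C) (fun w => f w * g w) (d * g z + f z * d').
Proof.
move=> fd /cderiv_Caratheodory[G [Gc <- gG]].
have /cderiv_Caratheodory[F [Fc <- fF]] := fd.
apply: (@Caratheodory_cderiv _ (fun w => F w * g z + f w * G w)).
  apply: continuousCD; first exact: (continuousCM Fc (@continuousC_cst R (g z) z)).
  exact: (continuousCM (cderiv_continuous fd) Gc).
move=> w; rewrite mulrDr mulrA -fF mulrCA -gG mulrBl mulrBr.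
by rewrite [RHS]addrC addrA subrK.
Qed.

Lemma cderivZ (c : C) f z d : is_derive z (1 : C) f d ->
  is_derive z (1 : C) (fun w => c * f w) (c * d).
Proof.
by move=> fd; have := cderivM (cderiv_cst c z) fd; rewrite mul0r add0r.
Qed.

Lemma cderivN f z d : is_derive z (1 : C) f d ->
  is_derive z (1 : C) (fun w => - f w) (- d).
Proof.
move=> /(cderivZ (-1)); rewrite mulN1r.
by have -> : (fun w => -1 * f w) = (fun w => - f w) by apply/funext => w; rewrite mulN1r.
Qed.

Lemma cderivB f g z d d' : is_derive z (1 : C) f d -> is_derive z (1 : C) g d' ->
  is_derive z (1 : C) (fun w => f w - g w) (d - d').
Proof. by move=> fd /cderivN; exact: cderivD. Qed.

Lemma cderivV f z d : f z != 0 -> is_derive z (1 : C) f d ->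
  is_derive z (1 : C) (fun w => (f w)^-1) (- d / f z ^+ 2).
Proof.
move=> fz0 fd; have fc := cderiv_continuous fd.
have /cderiv_Caratheodory[F [Fc <- fF]] := fd.
have -> : - F z / f z ^+ 2 = - (F z * ((f z)^-1 * (f z)^-1)).
  by rewrite mulNr expr2 invfM.
apply: (@Caratheodory_cderiv_near _ (fun w => - (F w * ((f w)^-1 * (f z)^-1)))).
  exact: (continuousCN (continuousCM Fc
    (continuousCM (continuousCV fz0 fc) (@continuousC_cst R (f z)^-1 z)))).
have /continuousCP/(_ (cabs (f z) / 2)) := fc.
rewrite divr_gt0 ?cabs_gt0// => -[]// e e0 h; apply/nbhsCP; exists e => // w /h fw.
have fw0 : f w != 0.
  apply/eqP => fw0; move: fw; rewrite fw0 sub0r cabsN leNgt => /negP; apply.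
  by rewrite ltr_pdivrMr// ltr_pMr ?ltr1n ?cabs_gt0.
by rewrite mulrN mulrA -fF; field; rewrite fw0 fz0.
Qed.

End ComplexDerivative.

(** * Power series *)

Section PowerSeries.
Context {R : realType}.
Local Notation C := (Cpx R).
Local Notation rc := (real_complex R).
Implicit Types (z w d : C) (f g : C -> C) (a : nat -> C).

(** The explicit tail makes the limit uniform whenever [K] and [q] are: a geometric rate takes the
    place of uniform convergence throughout. *)
Lemma cvg_geometric_bound (u : nat -> C) (K q : R) : 0 <= q < 1 ->
  (forall n, cabs (u n) <= K * q ^+ n) ->
  exists2 l, series u @ \oo --> l &
    forall N, cabs (l - series u N) <= K / (1 - q) * q ^+ N.
Proof.
move=> /andP[q0 q1] uK.
have cgeo : cvgn (series (fun n => K * q ^+ n)).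
  by apply: is_cvg_geometric_series; rewrite ger0_norm.
have sR : cvgn (series (fun n => complex.Re (u n))).
  apply: normed_cvg; apply: series_le_cvg cgeo => n //=.
    by rewrite (le_trans _ (uK n))// cabs_ge0.
  by rewrite (le_trans (Re_le_cabs _)).
have sI : cvgn (series (fun n => complex.Im (u n))).
  apply: normed_cvg; apply: series_le_cvg cgeo => n //=.
    by rewrite (le_trans _ (uK n))// cabs_ge0.
  by rewrite (le_trans (Im_le_cabs _)).
pose l : C := Complex (limn (series (fun n => complex.Re (u n))))
                      (limn (series (fun n => complex.Im (u n)))).
have ul : series u @ \oo --> l.
  apply/cvgC_ReIm; split => /=.
    have -> : (fun t => complex.Re (series u t)) = series (fun n => complex.Re (u n)).
      by apply/funext => n; rewrite /series/= Re_sum.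
    exact: sR.
  have -> : (fun t => complex.Im (series u t)) = series (fun n => complex.Im (u n)).
    by apply/funext => n; rewrite /series/= Im_sum.
  exact: sI.
exists l => // N; apply/ler_addgt0Pr => e e0.
move/cvgCP : ul => /(_ e e0) [M _ HM].
have NM : (N <= maxn N M)%N by rewrite leq_maxl.
have -> : l - series u N = (l - series u (maxn N M)) + (series u (maxn N M) - series u N).
  by rewrite addrA subrK.
rewrite (le_trans (cabsD _ _))// addrC lerD//; last first.
  by rewrite cabs_distC ltW//; apply: HM => /=; rewrite leq_maxr.
rewrite sub_series NM (le_trans (cabs_sum _ _ _))//.
apply: (@le_trans _ _ (\sum_(N <= i < maxn N M) K * q ^+ i)).
  by apply: ler_sum => i _.
rewrite -mulr_sumr -mulrA ler_wpM2l//.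
  by rewrite (le_trans (cabs_ge0 (u 0%N)))// -(mulr1 K) -(expr0 q).
(* The bound on geometric sums is used for a positive ratio; at [q = 0] only the term [0 ^+ 0 = 1]
   can survive, and only when [N = 0]. *)
have [->|q0'] := eqVneq q 0.
  case: N {NM} => [|N]; last first.
    rewrite big_nat_cond big1 ?mulr_ge0 ?exprn_ge0 ?subr0 ?invr_ge0//.
    by move=> i /andP[/andP[Ni _] _]; rewrite expr0n; case: i Ni.
  rewrite subr0 invr1 mul1r expr0 max0n; case: M {HM} => [|M]; first by rewrite big_nil.
  by rewrite big_nat_recl//= expr0 big1 ?addr0// => i _; rewrite exprS mul0r.
rewrite -(subnKC NM) geometric_partial_tail [leRHS]mulrC.
by rewrite geometric_le_lim ?exprn_ge0 ?ger0_norm// lt_def q0'.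
Qed.


Lemma cvg_series_bounded (u : nat -> C) (l : C) : series u @ \oo --> l ->
  exists2 K : R, 0 <= K & forall n, cabs (u n) <= K.
Proof.
move=> /cvgC_ReIm[ur ui].
have ReE : (fun t => complex.Re (series u t)) = series (fun n => complex.Re (u n)).
  by apply/funext => n; rewrite /series/= Re_sum.
have ImE : (fun t => complex.Im (series u t)) = series (fun n => complex.Im (u n)).
  by apply/funext => n; rewrite /series/= Im_sum.
have /cvgP/cvg_series_cvg_0/cvgP/cvg_seq_bounded : series (fun n => complex.Re (u n)) @ \oo -->
  complex.Re l by rewrite -ReE.
have /cvgP/cvg_series_cvg_0/cvgP/cvg_seq_bounded : series (fun n => complex.Im (u n)) @ \oo -->
  complex.Im l by rewrite -ImE.
move=> [M1 [_ /(_ (M1 + 1))]]; rewrite ltrDl => /(_ ltr01) h1.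
move=> [M2 [_ /(_ (M2 + 1))]]; rewrite ltrDl => /(_ ltr01) h2.
have bd n : cabs (u n) <= M2 + 1 + (M1 + 1).
  by rewrite (le_trans (cabs_le_ReIm _))// lerD//; [exact: h2|exact: h1].
by exists (M2 + 1 + (M1 + 1)) => //; rewrite (le_trans (cabs_ge0 (u 0%N))).
Qed.

(* [geo a]: the power series with coefficients [a] has radius of convergence at
   least 1, in a form that yields explicit tail bounds. *)
Definition geo a := forall r : R, 0 < r < 1 ->
  exists K q : R, [/\ 0 <= K, 0 < q < 1 & forall n, cabs (a n) * r ^+ n <= K * q ^+ n].

Lemma bounded_geo a (K : R) : (forall n, cabs (a n) <= K) -> geo a.
Proof.
move=> aK r r01; exists K, r; have /andP[r0 r1] := r01; split => // [|n].
  by rewrite (le_trans _ (aK 0%N))// cabs_ge0.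
by rewrite ler_wpM2r// exprn_ge0// ltW.
Qed.

(** Abel's argument: the terms at a radius [s] between [r] and 1 are bounded, so those at [r] decay
    like [(r / s) ^+ n]. *)
Lemma cvg_geo a : (forall z, disc z -> exists l : C, series (fun n => a n * z ^+ n) @ \oo --> l) ->
  geo a.
Proof.
move=> acv r /andP[r0 r1]; pose s := (r + 1) / 2.
have s0 : 0 < s by rewrite divr_gt0// addr_gt0.
have s1 : s < 1 by rewrite ltr_pdivrMr// mul1r -[2]/(1 + 1) ltrD2r.
have rs : r < s by rewrite ltr_pdivlMr// -[2]/(1 + 1) mulrDr mulr1 ltrD2l.
clearbody s.
have [|l /cvg_series_bounded[K K0 aK]] := acv (rc s).
  by rewrite /disc/= cabs_rc gtr0_norm.
exists K, (r / s); split => // [|n].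
  by rewrite divr_gt0//= ltr_pdivrMr// mul1r.
have -> : r ^+ n = s ^+ n * (r / s) ^+ n by rewrite -exprMn mulrCA divff ?mulr1// gt_eqF.
rewrite mulrA ler_wpM2r//; first by rewrite exprn_ge0// ltW// divr_gt0.
by have := aK n; rewrite cabsM cabsX cabs_rc gtr0_norm.
Qed.

(** [t / (1 - t)] is the fixed point of [x -> t * x + t], which dominates the passage from [n] to
    [n.+1]. *)
Lemma natr_mul_expr_le (t : R) n : 0 < t < 1 -> n%:R * t ^+ n <= t / (1 - t).
Proof.
move=> /andP[t0 t1]; elim: n => [|n IH].
  by rewrite mul0r divr_ge0 ?subr_ge0// ltW.
have t10 : 0 < 1 - t by rewrite subr_gt0.
have [n1 n2] : 0 <= t ^+ n /\ t ^+ n <= 1.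
  by rewrite exprn_ge0 ?exprn_ile1// ltW.
move: IH; rewrite !ler_pdivlMr// exprS -natr1 => IH.
have {}IH := ler_wpM2l (ltW t0) IH.
have h := ler_wpM2l (ltW (mulr_gt0 t0 t10)) n2.
have -> : (n%:R + 1) * (t * t ^+ n) * (1 - t) =
  t * (n%:R * t ^+ n * (1 - t)) + t * (1 - t) * t ^+ n by ring.
by apply: (le_trans (lerD IH h)); rewrite le_eqVlt; apply/orP; left; apply/eqP; ring.
Qed.

Lemma geo_deriv a : geo a -> geo (fun n => n.+1%:R * a n.+1).
Proof.
move=> ga r r01; have [K [q [K0 q01 aK]]] := ga r r01.
have /andP[r0 r1] := r01; have /andP[q0 q1] := q01.
(* Part of the decay pays for the factor [n.+1]: it is absorbed by [(q / s) ^+ n.+1], and [s ^+ n]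
   remains. *)
pose s := (q + 1) / 2.
have s0 : 0 < s by rewrite divr_gt0// addr_gt0.
have s1 : s < 1 by rewrite ltr_pdivrMr// mul1r -[2]/(1 + 1) ltrD2r.
have qs : q < s by rewrite ltr_pdivlMr// -[2]/(1 + 1) mulrDr mulr1 ltrD2l.
clearbody s.
have t01 : 0 < q / s < 1 by rewrite divr_gt0//= ltr_pdivrMr// mul1r.
exists (K / r * (q / s / (1 - q / s)) * s), s; split => [||n].
- have t1 : 0 < 1 - q / s by rewrite subr_gt0; case/andP: t01.
  by rewrite !mulr_ge0// ?invr_ge0 ltW.
- by rewrite s0.
have cn : cabs (n.+1%:R : C) = n.+1%:R.
  by rewrite -[n.+1%:R](rmorph_nat rc) cabs_rc normr_nat.
rewrite cabsM cn -mulrA.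
have -> : cabs (a n.+1) * r ^+ n = (cabs (a n.+1) * r ^+ n.+1) / r.
  by rewrite exprSr mulrA mulfK// gt_eqF.
apply: (@le_trans _ _ (n.+1%:R * (K * q ^+ n.+1 / r))).
  by rewrite ler_wpM2l// ler_wpM2r ?invr_ge0 ?aK// ltW.
have -> : q ^+ n.+1 = (q / s) ^+ n.+1 * (s ^+ n * s).
  by rewrite -exprSr -exprMn mulfVK// gt_eqF.
have := natr_mul_expr_le n.+1 t01.
have : 0 <= K / r * (s ^+ n * s) by rewrite !mulr_ge0 ?invr_ge0 ?exprn_ge0// ltW.
set A := K / r * _; move=> A0 /(ler_wpM2l A0); rewrite /A => h.
apply: (le_trans _ (le_trans h _)); rewrite le_eqVlt; apply/orP; left; apply/eqP; ring.
Qed.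

End PowerSeries.

Section PowerSeriesSum.
Context {R : realType}.
Local Notation C := (Cpx R).
Local Notation rc := (real_complex R).
Implicit Types (z w d : C) (f g : C -> C) (a : nat -> C).

Lemma disc_between z : disc z -> exists r : R, [/\ cabs z < r, 0 < r & r < 1].
Proof.
rewrite /disc/= => z1; exists ((cabs z + 1) / 2); split.
- by rewrite ltr_pdivlMr// -[2]/(1 + 1) mulrDr mulr1 ltrD2l.
- by rewrite divr_gt0// ltr_wpDl// cabs_ge0.
- by rewrite ltr_pdivrMr// mul1r -[2]/(1 + 1) ltrD2r.
Qed.

Lemma cabs_natr n : cabs (n%:R : C) = n%:R.
Proof. by rewrite -[n%:R](rmorph_nat rc) cabs_rc normr_nat. Qed.

Lemma geo_unif a (r : R) : geo a -> 0 < r < 1 ->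
  exists K q : R, [/\ 0 <= K, 0 < q < 1 &
    forall z, cabs z <= r -> forall n, cabs (a n * z ^+ n) <= K * q ^+ n].
Proof.
move=> ga r01; have [K [q [K0 q01 aK]]] := ga r r01.
exists K, q; split=> // z zr n; apply: le_trans (aK n).
by rewrite cabsM cabsX ler_wpM2l ?cabs_ge0// lerXn2r ?nnegrE ?cabs_ge0// ltW; case/andP: r01.
Qed.

Definition psum a z : C := limn (series (fun n => a n * z ^+ n)).

Lemma limnC (u : nat -> C) (l : C) : u @ \oo --> l -> limn u = l.
Proof. exact: (@cvg_lim _ (@norm_hausdorff _ C)). Qed.

Lemma psum_eq a z (l : C) : series (fun n => a n * z ^+ n) @ \oo --> l -> psum a z = l.
Proof. exact: limnC. Qed.

Lemma psum_tail a (r : R) : geo a -> 0 < r < 1 -> exists K q : R, [/\ 0 <= K, 0 < q < 1 &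
  forall z, cabs z <= r ->
   forall N, cabs (psum a z - series (fun n => a n * z ^+ n) N) <= K * q ^+ N].
Proof.
move=> ga r01; have [K [q [K0 q01 aK]]] := geo_unif ga r01.
exists (K / (1 - q)), q; split => // [|z zr N].
  by rewrite divr_ge0// subr_ge0 ltW; case/andP: q01.
have q01' : 0 <= q < 1 by case/andP: q01 => /ltW -> ->.
have [l ul tl] := cvg_geometric_bound q01' (aK z zr).
by rewrite (psum_eq ul).
Qed.

Lemma psum_cvg a z : geo a -> disc z -> series (fun n => a n * z ^+ n) @ \oo --> psum a z.
Proof.
move=> ga /disc_between[r [zr r0 r1]].
have [|K [q [K0 q01 aK]]] := @geo_unif a r ga; first by rewrite r0.
have q01' : 0 <= q < 1 by case/andP: q01 => /ltW -> ->.
have [l ul _] := cvg_geometric_bound q01' (aK z (ltW zr)).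
by rewrite (psum_eq ul).
Qed.

(** Weierstrass test by three thirds of [e]: two tails that are small uniformly near [z], and one
    finite sum. *)
Lemma continuous_series (u : nat -> C -> C) (U : C -> C) z (rho K q : R) :
  0 < rho -> 0 < q < 1 -> 0 <= K ->
  (forall w, cabs (w - z) < rho -> forall n, cabs (u n w) <= K * q ^+ n) ->
  (forall w, cabs (w - z) < rho -> series (fun n => u n w) @ \oo --> U w) ->
  (forall n, {for z, continuous (u n)}) -> {for z, continuous U}.
Proof.
move=> rho0 q01 K0 uK uU uc; apply/continuousCP => e e0.
have q01' : 0 <= q < 1 by case/andP: q01 => /ltW -> ->.
have tl w : cabs (w - z) < rho ->
    forall N, cabs (U w - series (fun n => u n w) N) <= K / (1 - q) * q ^+ N.
  move=> wr; have [l ul tl] := cvg_geometric_bound q01' (uK w wr).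
  by rewrite (cvgC_unique (uU w wr) ul).
have [N KN] : exists N, K / (1 - q) * q ^+ N <= e / 3.
  have q1 : `|q| < 1 by rewrite ger0_norm; case/andP: q01'.
  have /cvgrPdist_le/(_ (e / 3)) := @cvg_geometric R (K / (1 - q)) q q1.
  rewrite divr_gt0// => /(_ isT)[N _ /(_ N (leqnn N))] /=.
  by rewrite sub0r normrN => /(le_trans (ler_norm _)) h; exists N.
have /continuousCP/(_ (e / 3)) : {for z, continuous (fun w => series (fun n => u n w) N)}.
  by apply: continuousC_sum => n _; exact: uc.
rewrite divr_gt0// => -[]// d d0 H.
exists (Num.min rho d) => [|w]; first by rewrite lt_min rho0.
rewrite lt_min => /andP[wr wd].
have -> : U w - U z = (U w - series (fun n => u n w) N) -
   (U z - series (fun n => u n z) N) +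
   (series (fun n => u n w) N - series (fun n => u n z) N) by ring.
have zr : cabs (z - z) < rho by rewrite subrr cabs0.
have -> : e = e / 3 + e / 3 + e / 3 by field.
rewrite (le_trans (cabsD _ _))// lerD ?H// (le_trans (cabsB _ _))// lerD//.
  exact: le_trans (tl _ wr _) KN.
exact: le_trans (tl _ zr _) KN.
Qed.

Definition dcoef a n : C := n.+1%:R * a n.+1.

Lemma psum_deriv a z : geo a -> disc z -> is_derive z (1 : C) (psum a) (psum (dcoef a) z).
Proof.
move=> ga zD; have [r [zr r0 r1]] := disc_between zD.
have [|K [q [K0 q01 aK]]] := @geo_deriv _ a ga r; first by rewrite r0.
have q01' : 0 <= q < 1 by case/andP: q01 => /ltW -> ->.
(* The divided difference of [a n.+1 * w ^+ n.+1] between [w] and [z]. The bound for the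
   differentiated series majorizes it, so the sum [H] is continuous at [z] and is a Caratheodory
   factor; its value at [z] is the termwise derivative. *)
pose u n w : C := a n.+1 * \sum_(i < n.+1) w ^+ (n - i) * z ^+ i.
have rho0 : 0 < r - cabs z by rewrite subr_gt0.
have near_r w : cabs (w - z) < r - cabs z -> cabs w < r.
  by rewrite ltrBrDr; apply: le_lt_trans; rewrite -{1}(subrK z w) cabsD.
have uK w : cabs (w - z) < r - cabs z -> forall n, cabs (u n w) <= K * q ^+ n.
  move=> /near_r wr n; apply: le_trans (aK n).
  rewrite !cabsM cabs_natr (mulrC n.+1%:R) -mulrA ler_wpM2l ?cabs_ge0//.
  rewrite (le_trans (cabs_sum _ _ _))//.
  apply: (@le_trans _ _ (\sum_(i < n.+1) r ^+ n)).
    apply: ler_sum => i _; rewrite cabsM !cabsX.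
    have -> : r ^+ n = r ^+ (n - i) * r ^+ i by rewrite -exprD subnK// -ltnS.
    rewrite ler_pM ?exprn_ge0 ?cabs_ge0// lerXn2r ?nnegrE ?cabs_ge0 ?(ltW r0)//.
      exact: ltW.
    exact: ltW.
  by rewrite sumr_const card_ord mulr_natl.
pose H w : C := limn (series (fun n => u n w)).
have uH w : cabs (w - z) < r - cabs z -> series (fun n => u n w) @ \oo --> H w.
  move=> wr; have [l ul _] := cvg_geometric_bound q01' (uK w wr).
  by rewrite /H (limnC ul).
have uc n : {for z, continuous (u n)}.
  apply: continuousCM; first exact: continuousC_cst.
  apply: continuousC_sum => i _; apply: continuousCM; last exact: continuousC_cst.
  by apply: continuousCX; exact: continuousC_id.
have Hc := continuous_series rho0 q01 K0 uK uH uc.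
have -> : psum (dcoef a) z = H z.
  congr (limn (series _)); apply/funext => n; rewrite /u /dcoef.
  rewrite (eq_bigr (fun=> z ^+ n)).
    by rewrite sumr_const card_ord -[in RHS]mulr_natl mulrCA mulrA.
  by move=> i _; rewrite -exprD subnK// -ltnS.
apply: Caratheodory_cderiv_near Hc _; apply/nbhsCP.
exists (r - cabs z) => // w wr.
have wD : disc w by rewrite /disc/= (lt_trans _ r1)// near_r.
have h1 : (fun n => series (fun n => a n * w ^+ n) n.+1 - series (fun n => a n * z ^+ n) n.+1) @ \oo
    --> psum a w - psum a z.
  apply: cvgCB.
    by have := @psum_cvg a w ga wD; rewrite -cvg_shiftS.
  by have := @psum_cvg a z ga zD; rewrite -cvg_shiftS.
have h2 : (fun n => (w - z) * series (fun n => u n w) n) @ \oo --> (w - z) * H w.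
  by apply: cvgCM; [exact: cvgC_cst|exact: uH].
apply: (cvgC_unique h1).
set A := (fun n => _ - _); suff -> : A = (fun n => (w - z) * series (fun n => u n w) n) by [].
apply/funext => n; rewrite /A /series/= !big_nat_recl// !expr0 opprD addrACA subrr add0r.
rewrite -sumrB mulr_sumr; apply: eq_bigr => i _.
by rewrite -mulrBr subrXX /u mulrCA.
Qed.

Lemma psum_continuous a z : geo a -> disc z -> {for z, continuous (psum a)}.
Proof. by move=> ga zD; exact: cderiv_continuous (psum_deriv ga zD). Qed.

(** Continuity of the derivative is part of the notion: the Cauchy formula is obtained by
    differentiating under the integral sign, which uses that [F'] is bounded on compact sets.
    [analytic_hol] and [hol_analytic] link this to [analytic_on_disc]. *)
Definition hol (F F' : C -> C) := forall z, disc z ->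
  is_derive z (1 : C) F (F' z) /\ {for z, continuous F'}.

Lemma psum_hol a : geo a -> hol (psum a) (psum (dcoef a)).
Proof.
by move=> ga z zD; split; [exact: psum_deriv|apply: psum_continuous => //; exact: geo_deriv].
Qed.

End PowerSeriesSum.

(** * Cauchy formula and Taylor expansion on the disc *)

Section Curves.
Context {R : realType}.
Local Notation C := (Cpx R).
Local Notation rc := (real_complex R).
Implicit Types (z w v : C) (F : C -> C) (c : R -> C) (x y s : R).

(** The quotient is spelled out because the parameter is real while the scalars of [C] are complex;
    [cderivR_ReIm] reduces it to two real derivatives. *)
Definition cderivR c x v := (fun h : R => rc h^-1 * (c (h + x) - c x)) @ (0 : R)^' --> v.

Lemma cderivR_ReIm c x v : cderivR c x v <->
  is_derive x (1 : R) (fun y => complex.Re (c y)) (complex.Re v) /\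
  is_derive x (1 : R) (fun y => complex.Im (c y)) (complex.Im v).
Proof.
have derivE (f : R -> R) (d : R) : (fun h : R => h^-1 * (f (h + x) - f x)) @ (0 : R)^' --> d <->
    is_derive x (1 : R) f d.
  have E : (fun h : R => h^-1 * (f (h + x) - f x)) =
      (fun h => h^-1 *: (f (h *: (1 : R) + x) - f x)).
    by apply/funext => h; rewrite /GRing.scale/= mulr1.
  split; rewrite E => fd.
    apply: DeriveDef; first by apply/cvg_ex; exists d.
    exact: (cvg_lim (@Rhausdorff R)).
  by have := @ex_derive _ _ _ _ _ _ _ fd; rewrite -(@derive_val _ _ _ _ _ _ _ fd).
rewrite -!derivE /cderivR cvgC_ReIm.
by under eq_fun do rewrite Re_rcM cReD cReN;
   under [X in _ /\ X @ _ --> _]eq_fun do rewrite Im_rcM cImD cImN.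
Qed.

Lemma cderivR_continuous c x v : cderivR c x v -> c @ x --> c x.
Proof.
move=> /cderivR_ReIm[dr di]; apply/cvgC_ReIm; split; apply: differentiable_continuous;
  exact/derivable1_diffP.
Qed.

Lemma cderivR_comp F c x v (d : C) : cderivR c x v -> is_derive (c x) (1 : C) F d ->
  cderivR (fun y => F (c y)) x (d * v).
Proof.
move=> cv /cderiv_Caratheodory[H [Hc <- FH]].
rewrite /cderivR; under eq_fun do rewrite FH mulrA mulrC.
apply: cvgCM; last exact: cv.
have /continuousCP Hc' := Hc.
have cc : c (h + x) @[h --> (0 : R)^'] --> c x.
  apply: (cvg_comp (fun h : R => h + x) c); last exact: cderivR_continuous cv.
  have : h + x @[h --> (0 : R)] --> 0 + x by apply: cvgD; [exact: cvg_id|exact: cvg_cst].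
  by rewrite add0r; apply: cvg_trans; apply: cvg_app; exact: nbhs_dnbhs.
apply/cvgCP_le => e /Hc'[del del0 {}Hc']; move/cvgCP : cc => /(_ _ del0).
by apply: filterS => h /Hc'.
Qed.

Lemma cderivR_affine (a b : C) x : cderivR (fun y => a + rc y * b) x b.
Proof.
apply/cderivR_ReIm; split.
  under eq_fun do rewrite cReD Re_rcM.
  by apply: is_derive_eq; rewrite /GRing.scale/=; ring.
under eq_fun do rewrite cImD Im_rcM.
by apply: is_derive_eq; rewrite /GRing.scale/=; ring.
Qed.

Definition iC : C := Complex 0 1.

Lemma cderivR_polar (r theta : R) : cderivR (polar r) theta (iC * polar r theta).
Proof.
apply/cderivR_ReIm; split => /=.
  by apply: is_derive_eq; rewrite /GRing.scale/=; ring.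
by apply: is_derive_eq; rewrite /GRing.scale/=; ring.
Qed.

Lemma cderivRZ (a b : C) c x v : cderivR c x v -> cderivR (fun y => a + b * c y) x (b * v).
Proof.
move=> cv; have := cderivD (cderiv_cst a (c x)) (cderivZ b (cderiv_id (c x))).
rewrite add0r mulr1; exact: (cderivR_comp cv).
Qed.

Lemma cabs_polar (r theta : R) : cabs (polar r theta) = `|r|.
Proof.
rewrite /cabs/= !exprMn -mulrDr cos2Dsin2 mulr1; exact: sqrtr_sqr.
Qed.

Lemma polar2pi (r : R) : polar r (2 * pi) = polar r 0.
Proof. by rewrite /polar mulr_natl cos2pi sin2pi cos0 sin0. Qed.

End Curves.

Section CircleIntegral.
Context {R : realType}.
Local Notation C := (Cpx R).
Local Notation rc := (real_complex R).
Local Notation leb := (@lebesgue_measure R).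
Local Notation J := (`[0%R, (2 * pi)%R]%classic : set (measurableTypeR R)).
Implicit Types (z w v : C) (F : C -> C) (h k : R -> C) (x y s : R).

Let pi2_gt0 : 0 < 2 * pi :> R.
Proof. by rewrite mulr_gt0// pi_gt0. Qed.

Lemma continuousR_integrable (f : R -> R) : continuous f -> leb.-integrable J (EFin \o f).
Proof.
move=> fc; apply: continuous_compact_integrable; first exact: segment_compact.
exact: continuous_subspaceT.
Qed.

Lemma measure_J : fine (leb J) = 2 * pi.
Proof. by rewrite lebesgue_measure_itv/= lte_fin pi2_gt0 oppr0 adde0. Qed.

(** Integral against the angle, with no factor [dw]: since [dw = i w dt] on the circle, the Cauchy
    kernel appears below as [w / (w - z)]. *)
Definition cint h : C :=
  Complex (\int[leb]_(t in J) complex.Re (h t)) (\int[leb]_(t in J) complex.Im (h t)).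

Definition ccont h := forall x, h @ x --> h x.

Lemma ccont_ReIm h : ccont h <->
  continuous (fun x => complex.Re (h x)) /\ continuous (fun x => complex.Im (h x)).
Proof.
split=> [hc|[hr hi] x]; last by apply/cvgC_ReIm; split; [exact: hr|exact: hi].
by split=> x; have /cvgC_ReIm[] := hc x.
Qed.

Lemma ccont_cst (c : C) : ccont (fun=> c).
Proof. by move=> x; exact: cvgC_cst. Qed.

Lemma ccontD h k : ccont h -> ccont k -> ccont (fun t => h t + k t).
Proof. by move=> hc kc x; exact: (cvgCD (hc x) (kc x)). Qed.

Lemma ccontM h k : ccont h -> ccont k -> ccont (fun t => h t * k t).
Proof. by move=> hc kc x; exact: (cvgCM (hc x) (kc x)). Qed.

Lemma ccontX h n : ccont h -> ccont (fun t => h t ^+ n).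
Proof.
move=> hc; elim: n => [|n IH]; first exact: ccont_cst.
have -> : (fun t => h t ^+ n.+1) = (fun t => h t * h t ^+ n).
  by apply/funext => w; rewrite exprS.
exact: (ccontM hc IH).
Qed.

Lemma ccontV h : (forall t, h t != 0) -> ccont h -> ccont (fun t => (h t)^-1).
Proof. by move=> h0 hc x; exact: (cvgCV (h0 x) (hc x)). Qed.

Lemma ccont_conj h : ccont h -> ccont (fun t => conjc (h t) : C).
Proof.
move=> /ccont_ReIm[hr hi]; apply/ccont_ReIm; split.
  by have -> : (fun x => complex.Re (conjc (h x))) = (fun x => complex.Re (h x));
    [apply/funext => x; case: (h x)|].
have -> : (fun x => complex.Im (conjc (h x))) = (fun x => - complex.Im (h x)).
  by apply/funext => x; case: (h x).
by move=> x; apply: cvgN; exact: hi.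
Qed.

Lemma ccont_sum (n : nat) (h : nat -> R -> C) : (forall i, ccont (h i)) ->
  ccont (fun t => \sum_(0 <= i < n) h i t).
Proof.
move=> hc; elim: n => [|n IH].
  have -> : (fun t => \sum_(0 <= i < 0) h i t) = (fun=> 0) by apply/funext => t; rewrite big_nil.
  exact: ccont_cst.
have -> : (fun t => \sum_(0 <= i < n.+1) h i t) = (fun t => \sum_(0 <= i < n) h i t + h n t).
  by apply/funext => t; rewrite big_nat_recr.
exact: (ccontD IH (hc n)).
Qed.

Lemma ccont_comp F h : (forall t, {for h t, continuous F}) -> ccont h ->
  ccont (fun t => F (h t)).
Proof.
move=> Fc hc x; apply/cvgCP_le => e e0.
have /continuousCP/(_ e e0)[d d0 Fd] := Fc x.
move/cvgCP : (hc x) => /(_ _ d0); apply: filterS => t; exact: Fd.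
Qed.

Lemma cderivR_ccont h k : (forall t, cderivR h t (k t)) -> ccont h.
Proof. by move=> hk t; exact: cderivR_continuous (hk t). Qed.

Lemma cintD h k : ccont h -> ccont k -> cint (fun t => h t + k t) = cint h + cint k.
Proof.
move=> /ccont_ReIm[hr hi] /ccont_ReIm[kr ki].
apply/eqP; rewrite eq_complex; apply/andP; split; apply/eqP => /=.
  under eq_Rintegral do rewrite cReD.
  by rewrite RintegralD//; exact: continuousR_integrable.
under eq_Rintegral do rewrite cImD.
by rewrite RintegralD//; exact: continuousR_integrable.
Qed.

Lemma cintZ (c : C) h : ccont h -> cint (fun t => c * h t) = c * cint h.
Proof.
move=> /ccont_ReIm[hr hi].
have iZ (a : R) (f : R -> R) : continuous f -> leb.-integrable J (EFin \o (fun t => a * f t)).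
  by move=> fc; apply: continuousR_integrable => t; apply: cvgM; [exact: cvg_cst|exact: fc].
have iE (f : R -> R) : continuous f -> leb.-integrable J (EFin \o f).
  exact: continuousR_integrable.
apply/eqP; rewrite eq_complex; apply/andP; split; apply/eqP => /=.
  under eq_Rintegral do rewrite cReM.
  rewrite RintegralB ?RintegralZl ?cReM//; [exact: iE|exact: iE|exact: iZ|exact: iZ].
under eq_Rintegral do rewrite cImM.
rewrite RintegralD ?RintegralZl ?cImM//; [exact: iE|exact: iE|exact: iZ|exact: iZ].
Qed.

Lemma cint_cst (c : C) : cint (fun=> c) = rc (2 * pi) * c.
Proof.
rewrite /cint !Rintegral_cst// measure_J; apply/eqP; rewrite eq_complex.
by rewrite Re_rcM Im_rcM/= !(mulrC _ (2 * pi)) !eqxx.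
Qed.

Lemma cint_sum (n : nat) (h : nat -> R -> C) : (forall i, ccont (h i)) ->
  cint (fun t => \sum_(0 <= i < n) h i t) = \sum_(0 <= i < n) cint (h i).
Proof.
move=> hc; elim: n => [|n IH].
  rewrite big_nil; have -> : (fun t => \sum_(0 <= i < 0) h i t) = (fun=> 0).
    by apply/funext => t; rewrite big_nil.
  by rewrite cint_cst mulr0.
rewrite big_nat_recr//= -IH -cintD//; last exact: ccont_sum.
by congr cint; apply/funext => t; rewrite big_nat_recr.
Qed.

Lemma Rint_bound (f : R -> R) (M : R) : continuous f -> (forall t, J t -> `|f t| <= M) ->
  `|\int[leb]_(t in J) f t| <= 2 * pi * M.
Proof.
move=> fc fM; have fi := continuousR_integrable fc.
rewrite (le_trans (le_normr_Rintegral _ fi))//.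
have -> : 2 * pi * M = \int[leb]_(t in J) M by rewrite Rintegral_cst// measure_J mulrC.
apply: le_Rintegral => //.
  by apply: continuousR_integrable => t; apply: cvg_norm; exact: fc.
by apply: continuousR_integrable => t; exact: cvg_cst.
Qed.

(** The factor 4 instead of 2 comes from bounding real and imaginary parts separately. *)
Lemma cint_bound h (M : R) : ccont h -> (forall t, J t -> cabs (h t) <= M) ->
  cabs (cint h) <= 4 * pi * M.
Proof.
move=> /ccont_ReIm[hr hi] hM; rewrite (le_trans (cabs_le_ReIm _))//.
have -> : 4 * pi * M = 2 * pi * M + 2 * pi * M by ring.
rewrite lerD//= Rint_bound// => t /hM; apply: le_trans.
  exact: Re_le_cabs.
exact: Im_le_cabs.
Qed.

Lemma cint_closed_curve h k : (forall t, cderivR h t (k t)) -> ccont k ->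
  h (2 * pi) = h 0 -> cint k = 0.
Proof.
move=> hk /ccont_ReIm[kr ki] h2.
have FTC (f g : R -> R) : (forall t, is_derive t (1 : R) f (g t)) -> continuous g ->
    f (2 * pi) = f 0 -> \int[leb]_(t in J) g t = 0.
  move=> fg gc f2; rewrite /Rintegral (@continuous_FTC2 _ g f)//.
  - by rewrite -EFinB f2 subrr.
  - exact: continuous_subspaceT.
  - have fc : continuous f by move=> t; apply: differentiable_continuous; exact/derivable1_diffP.
    split => //; first exact/cvg_at_right_filter/fc.
    exact/cvg_at_left_filter/fc.
  - by move=> t _; rewrite derive1E (@derive_val _ _ _ _ _ _ _ (fg t)).
have r0 : \int[leb]_(t in J) complex.Re (k t) = 0.
  apply: (FTC (fun t => complex.Re (h t))); [|exact: kr|by rewrite h2].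
  by move=> t; have /cderivR_ReIm[] := hk t.
have i0 : \int[leb]_(t in J) complex.Im (k t) = 0.
  apply: (FTC (fun t => complex.Im (h t))); [|exact: ki|by rewrite h2].
  by move=> t; have /cderivR_ReIm[] := hk t.
by rewrite /cint r0 i0.
Qed.

End CircleIntegral.

Section CauchyFormula.
Context {R : realType}.
Local Notation C := (Cpx R).
Local Notation rc := (real_complex R).
Local Notation leb := (@lebesgue_measure R).
Local Notation J := (`[0%R, (2 * pi)%R]%classic : set (measurableTypeR R)).
Implicit Types (z w v : C) (F : C -> C) (r s t : R).

(** The parameter ranges over an open interval around [[a, b]], so that two-sided derivatives exist
    at the end points as well. *)
Lemma constant_param_integral (f g : R -> R -> R) (a b u v M : R) :
  (forall s t, u < s < v -> is_derive s (1 : R) (f^~ t) (g s t)) ->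
  (forall s, u < s < v -> continuous (f s)) ->
  (forall s t, u < s < v -> J t -> `|g s t| <= M) ->
  (forall s, u < s < v -> \int[leb]_(t in J) g s t = 0) ->
  u < a -> a <= b -> b < v ->
  \int[leb]_(t in J) f a t = \int[leb]_(t in J) f b t.
Proof.
move=> fg fc gM g0 ua ab bv.
have inI s : s \in `[a, b] -> u < s < v.
  by rewrite in_itv/= => /andP[h1 h2]; rewrite (lt_le_trans ua h1) (le_lt_trans h2 bv).
have J0 : J 0 by rewrite /= in_itv/= lexx mulr_ge0// pi_ge0.
have M0 : 0 <= M by rewrite (le_trans _ (gM a 0 _ J0)) ?inI ?in_itv/= ?lexx.
have d1 s t : u < s < v -> partial1of2 f s t = g s t.
  by move=> /fg sfg; rewrite partial1of2E (@derive_val _ _ _ _ _ _ _ (sfg t)).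
pose Phi s := \int[leb]_(t in J) f s t.
have Phid s : u < s < v -> is_derive s (1 : R) Phi 0.
  move=> suv.
  have mJ : measurable J by exact: measurable_itv.
  have intf x : `]u, v[%classic x -> leb.-integrable J (EFin \o f x).
    by rewrite /= in_itv/= => /fc; exact: continuousR_integrable.
  have Is : `]u, v[%classic s by rewrite /= in_itv.
  have df x y : `]u, v[%classic x -> J y -> derivable (f ^~ y) x 1.
    by rewrite /= in_itv/= => /fg xfg _; have := xfg y.
  have intM : leb.-integrable J (EFin \o (cst M : measurableTypeR R -> R)).
    by apply: continuousR_integrable => t; exact: cvg_cst.
  have dM x y : `]u, v[%classic x -> J y -> `|partial1of2 f x y| <= (cst M) y.
    by rewrite /= in_itv/= => xuv Jy; rewrite d1// gM.
  have M0' y : 0 <= (cst M : measurableTypeR R -> R) y by [].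
  have h1 := derivable_under_integral mJ Is intf df M0' intM dM.
  have h2 := differentiation_under_integral mJ Is intf df M0' intM dM.
  apply: DeriveDef => //; rewrite -derive1E h2; apply: etrans (g0 s suv).
  by apply: eq_Rintegral => t _; rewrite d1.
have [s sab||c _ ] := @MVT_segment R Phi (fun=> 0) a b ab.
- by apply: Phid; apply: inI; exact: subset_itv_oo_cc sab.
- apply: continuous_in_subspaceT => s; rewrite inE/= => /inI /Phid ds.
  exact/differentiable_continuous/derivable1_diffP.
by rewrite mul0r => /eqP; rewrite subr_eq0 => /eqP.
Qed.

Lemma cderivR_continuousF F (F' : C -> C) (c : R -> C) : hol F F' ->
  (forall t, disc (c t)) -> ccont c -> ccont (fun t => F (c t)).
Proof.
move=> hF cD cc; apply: ccont_comp cc => t.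
exact: (cderiv_continuous (hF _ (cD t)).1).
Qed.

Lemma polar_ccont r : ccont (polar r).
Proof. by apply: cderivR_ccont => t; exact: cderivR_polar. Qed.

Lemma polar_disc r t : 0 <= r < 1 -> disc (polar r t).
Proof. by case/andP => r0 r1; rewrite /disc/= cabs_polar ger0_norm. Qed.

Lemma polar_neq0 r t : 0 < r -> polar r t != 0.
Proof. by move=> r0; rewrite -cabs_gt0 cabs_polar gtr0_norm. Qed.

Lemma homotopy_bound F' z r : (forall w, disc w -> {for w, continuous F'}) ->
  cabs z < r -> r < 1 -> exists2 d : R, 0 < d & exists M : R,
    forall s t, - d < s < 1 + d ->
      disc (z + rc s * (polar r t - z)) /\
      (J t -> cabs (F' (z + rc s * (polar r t - z))) <= M).
Proof.
move=> F'c zr r1; have r0 : 0 < r by rewrite (le_lt_trans (cabs_ge0 z)).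
(* For [s] in [[- d, 1 + d]] one has [|1 - s| + |s| <= 1 + 2 d], and this [d] makes
   [(1 + 2 d) r < 1]: the homotopy may overshoot both ends and stay in the disc. *)
pose d := (1 - r) / 4; have d0 : 0 < d by rewrite divr_gt0// subr_gt0.
have D s t : - d <= s <= 1 + d -> disc (z + rc s * (polar r t - z)).
  move=> /andP[s1 s2]; rewrite /disc/=.
  have -> : z + rc s * (polar r t - z) = rc (1 - s) * z + rc s * polar r t.
    by rewrite rcB rmorph1; ring.
  rewrite (le_lt_trans (cabsD _ _))// !cabsM !cabs_rc cabs_polar (gtr0_norm r0).
  apply: (@le_lt_trans _ _ ((`|1 - s| + `|s|) * r)).
    by rewrite mulrDl lerD2r ler_wpM2l// ltW.
  have h : `|1 - s| + `|s| <= 1 + 2 * d.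
    by case: (ler0P s) => s0; case: (ler0P (1 - s)) => s3; lra.
  apply: (@le_lt_trans _ _ ((1 + 2 * d) * r)); first by rewrite ler_wpM2r// ltW.
  by rewrite /d; nra.
exists d => //.
pose A : set (R * R) := `[- d, 1 + d]%classic `*` `[0, 2 * pi]%classic.
have cA : compact A by apply: compact_setX; exact: segment_compact.
have A0 : A !=set0.
  exists (0, 0); split; rewrite /= in_itv/= ?lexx ?mulr_ge0 ?pi_ge0//.
  by rewrite oppr_le0 (ltW d0) addr_ge0// ltW.
pose G (p : R * R) := cabs (F' (z + rc p.1 * (polar r p.2 - z))).
have Gc : {within A, continuous G}.
  apply: continuous_in_subspaceT => -[s t]; rewrite inE => -[/= + _].
  rewrite in_itv/= => sd.
  have zc : (fun p : R * R => z + rc p.1 * (polar r p.2 - z)) @ (s, t) -->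
      z + rc s * (polar r t - z).
    apply: cvgCD; first exact: cvgC_cst.
    apply: cvgCM.
      apply/cvgC_ReIm; split => /=; last exact: cvg_cst.
      exact: cvg_fst.
    apply: cvgCB; last exact: cvgC_cst.
    apply: (cvg_comp snd (polar r)); last exact: polar_ccont.
    exact: cvg_snd.
  have /continuousCP F'cz := F'c _ (D s t sd).
  apply/cvgrPdist_le => e /F'cz[del del0 H].
  move/cvgCP : zc => /(_ _ del0); apply: filterS => p /H.
  by apply: le_trans; rewrite cabs_distC norm_cabsB.
have [[s0 t0] _ H] := compact_EVT_max A0 cA Gc.
exists (G (s0, t0)) => s t /andP[sd1 sd2]; split; first by apply: D; rewrite !ltW.
move=> Jt; apply: (H (s, t)); rewrite inE; split => //=.
by rewrite in_itv/= !ltW.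
Qed.

(* The integral of [F (z + s (w - z)) w / (w - z)] over the circle is constant in
   [s]: its derivative is the integral of the derivative along a closed curve. *)
Lemma Cauchy_homotopy F F' z r : hol F F' -> cabs z < r -> r < 1 ->
  cint (fun t => F (polar r t) * (polar r t / (polar r t - z))) =
  F z * cint (fun t => polar r t / (polar r t - z)).
Proof.
move=> hF zr r1; have r0 : 0 < r by rewrite (le_lt_trans (cabs_ge0 z)).
have [|d d0 [M HM]] := @homotopy_bound F' z r _ zr r1.
  by move=> w /hF[].
pose k t : C := polar r t / (polar r t - z).
pose zeta s t : C := z + rc s * (polar r t - z).
pose Phi s t : C := F (zeta s t) * k t.
pose Psi s t : C := F' (zeta s t) * polar r t.
have wz t : polar r t - z != 0.
  apply/eqP => /eqP; rewrite subr_eq0 => /eqP e; move: zr.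
  by rewrite -e cabs_polar gtr0_norm// ltxx.
have zD s t : - d < s < 1 + d -> disc (zeta s t) by move=> /(HM s t)[].
have kc : ccont k.
  apply: ccontM; first exact: polar_ccont.
  apply: (ccontV wz); apply: ccontD; [exact: polar_ccont|exact: ccont_cst].
have zc s : ccont (zeta s).
  apply: ccontD; first exact: ccont_cst.
  apply: ccontM; first exact: ccont_cst.
  apply: ccontD; [exact: polar_ccont|exact: ccont_cst].
have Fzc s : - d < s < 1 + d -> ccont (Phi s).
  by move=> sd; exact: (ccontM (cderivR_continuousF hF (fun t => zD s t sd) (zc s)) kc).
have Psic s : - d < s < 1 + d -> ccont (Psi s).
  move=> sd; apply: ccontM; last exact: polar_ccont.
  by apply: ccont_comp (zc s) => t; exact: (hF _ (zD s t sd)).2.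
have dPhi s t : - d < s < 1 + d -> cderivR (Phi^~ t) s (Psi s t).
  move=> sd; have dz : cderivR (zeta^~ t) s (polar r t - z) by exact: cderivR_affine.
  have [dF _] := hF _ (zD s t sd).
  have := @cderivRZ R 0 (k t) _ _ _ (cderivR_comp dz dF).
  have -> : (fun y => 0 + k t * F (zeta y t)) = Phi^~ t.
    by apply/funext => y; rewrite add0r mulrC.
  congr (cderivR _ _ _); rewrite /Psi /k mulrCA; congr (_ * _).
  by rewrite mulfVK.
have Psi0 s : - d < s < 1 + d -> cint (Psi s) = 0.
  (* A primitive in [t] is [F (zeta s t) / (i s)], which degenerates at [s = 0]. There the integrand
     is [F' z * w], with primitive [F' z * w / i]. *)
  move=> sd; have [s0|s0] := eqVneq s 0.
    apply: (@cint_closed_curve _ (fun t => 0 + (F' z / iC) * polar r t)) => [t||].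
    - have -> : Psi s t = F' z / iC * (iC * polar r t).
        rewrite /Psi /zeta s0 mul0r addr0 mulrA mulfVK//.
        by rewrite eq_complex/= oner_eq0 andbF.
      exact/cderivRZ/cderivR_polar.
    - exact: Psic.
    - by rewrite polar2pi.
  apply: (@cint_closed_curve _ (fun t => 0 + (rc s * iC)^-1 * F (zeta s t))) => [t||].
  - have dz : cderivR (zeta s) t (rc s * (iC * polar r t)).
      have -> : zeta s = (fun t => (z - rc s * z) + rc s * polar r t).
        by apply/funext => u; rewrite /zeta mulrBr addrAC addrA.
      exact/cderivRZ/cderivR_polar.
    have [dF _] := hF _ (zD s t sd).
    have := @cderivRZ R 0 (rc s * iC)^-1 _ _ _ (cderivR_comp dz dF).
    congr (cderivR _ _ _); rewrite /Psi; field.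
    have s0' : rc s != 0 :> C by rewrite -cabs_eq0 cabs_rc normr_eq0.
    by rewrite s0' eq_complex/= oner_eq0 andbF.
  - exact: Psic.
  - by rewrite /zeta polar2pi.
have PsiM s t : - d < s < 1 + d -> J t -> cabs (Psi s t) <= M * r.
  move=> sd Jt; rewrite cabsM cabs_polar (gtr0_norm r0) ler_wpM2r ?(ltW r0)//.
  by have [_] := HM s t sd; exact.
have d1 : 1 < 1 + d by rewrite ltrDl.
have d00 : - d < 0 by rewrite oppr_lt0.
have PhiE : cint (Phi 0) = cint (Phi 1).
  apply/eqP; rewrite eq_complex; apply/andP; split; apply/eqP => /=.
    apply: (@constant_param_integral (fun s t => complex.Re (Phi s t))
      (fun s t => complex.Re (Psi s t)) 0 1 (- d) (1 + d) (M * r)) => //.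
    - by move=> s t /(dPhi s t)/cderivR_ReIm[].
    - by move=> s /Fzc/ccont_ReIm[].
    - by move=> s t sd Jt; rewrite (le_trans (Re_le_cabs _))// PsiM.
    - by move=> s /Psi0 /(congr1 (@complex.Re _)).
  apply: (@constant_param_integral (fun s t => complex.Im (Phi s t))
    (fun s t => complex.Im (Psi s t)) 0 1 (- d) (1 + d) (M * r)) => //.
  - by move=> s t /(dPhi s t)/cderivR_ReIm[].
  - by move=> s /Fzc/ccont_ReIm[].
  - by move=> s t sd Jt; rewrite (le_trans (Im_le_cabs _))// PsiM.
  - by move=> s /Psi0 /(congr1 (@complex.Im _)).
transitivity (cint (Phi 1)).
  congr cint; apply/funext => t; rewrite /Phi /zeta mul1r; congr (F _ * _).
  by rewrite addrC subrK.
rewrite -PhiE -cintZ//; congr cint; apply/funext => t.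
by rewrite /Phi /zeta mul0r addr0.
Qed.

End CauchyFormula.

Section Holomorphic.
Context {R : realType}.
Local Notation C := (Cpx R).
Local Notation rc := (real_complex R).
Local Notation leb := (@lebesgue_measure R).
Local Notation J := (`[0%R, (2 * pi)%R]%classic : set (measurableTypeR R)).
Implicit Types (z w v : C) (F G : C -> C) (r s t : R) (a : nat -> C).

Lemma hol_continuous F F' z : hol F F' -> disc z -> {for z, continuous F}.
Proof. by move=> hF zD; exact: (cderiv_continuous (hF _ zD).1). Qed.

Lemma hol_cst (c : C) : hol (fun=> c) (fun=> 0).
Proof. by move=> z _; split; [exact: cderiv_cst|exact: continuousC_cst]. Qed.

Lemma hol_id : hol (id : C -> C) (fun=> 1).
Proof. by move=> z _; split; [exact: cderiv_id|exact: continuousC_cst]. Qed.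

Lemma holD F F' G G' : hol F F' -> hol G G' ->
  hol (fun z => F z + G z) (fun z => F' z + G' z).
Proof.
move=> hF hG z zD; have [dF cF] := hF z zD; have [dG cG] := hG z zD.
by split; [exact: (cderivD dF dG)|exact: (continuousCD cF cG)].
Qed.

Lemma holM F F' G G' : hol F F' -> hol G G' ->
  hol (fun z => F z * G z) (fun z => F' z * G z + F z * G' z).
Proof.
move=> hF hG z zD; have [dF cF] := hF z zD; have [dG cG] := hG z zD.
split; first exact: (cderivM dF dG).
exact: (continuousCD (continuousCM cF (hol_continuous hG zD))
  (continuousCM (hol_continuous hF zD) cG)).
Qed.

Lemma holN F F' : hol F F' -> hol (fun z => - F z) (fun z => - F' z).
Proof.
move=> hF z zD; have [dF cF] := hF z zD.
by split; [exact: (cderivN dF)|exact: (continuousCN cF)].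
Qed.

Lemma holB F F' G G' : hol F F' -> hol G G' ->
  hol (fun z => F z - G z) (fun z => F' z - G' z).
Proof. by move=> hF /holN; exact: holD. Qed.

Lemma holV F F' : (forall z, disc z -> F z != 0) -> hol F F' ->
  hol (fun z => (F z)^-1) (fun z => - F' z * ((F z)^-1 * (F z)^-1)).
Proof.
move=> F0 hF z zD; have [dF cF] := hF z zD; have Fz0 := F0 z zD.
have cV := continuousCV Fz0 (hol_continuous hF zD).
split; first by have := cderivV Fz0 dF; rewrite expr2 invfM.
exact: (continuousCM (continuousCN cF) (continuousCM cV cV)).
Qed.

Lemma hol_comp F F' G G' : (forall z, disc z -> disc (G z)) -> hol G G' -> hol F F' ->
  hol (fun z => F (G z)) (fun z => F' (G z) * G' z).
Proof.
move=> GD hG hF z zD; have [dG cG] := hG z zD; have [dF cF] := hF _ (GD z zD).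
split; first exact: (cderiv_comp dG dF).
exact: (continuousCM (continuousC_comp (hol_continuous hG zD) cF) cG).
Qed.

Lemma hol_affine (c d : C) : hol (fun z => c + d * z) (fun=> d).
Proof.
move=> z _; split; last exact: continuousC_cst.
by have := cderivD (cderiv_cst c z) (cderivZ d (cderiv_id z)); rewrite add0r mulr1.
Qed.

Lemma hol_X n : exists F', hol (fun z => z ^+ n) F'.
Proof.
elim: n => [|n [F' hF]]; first by exists (fun=> 0); exact: hol_cst.
exists (fun z => 1 * z ^+ n + z * F' z).
have -> : (fun z => z ^+ n.+1) = (fun z => z * z ^+ n) by apply/funext => z; rewrite exprS.
exact: (holM hol_id hF).
Qed.

Lemma hol_ext F G F' : (forall z, disc z -> F z = G z) -> hol F F' -> hol G F'.
Proof.
move=> FG hF z zD; have [dF cF] := hF z zD; split; last exact: cF.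
apply: near_eq_is_derive dF; apply/nbhsCP.
have /nbhsCP[e e0 H] := nbhs_disc zD; exists e => // w /H; exact: FG.
Qed.

Lemma hol_polar F F' r : hol F F' -> 0 <= r < 1 -> ccont (fun t => F (polar r t)).
Proof.
move=> hF r01; apply: ccont_comp (@polar_ccont _ r) => t.
exact: (hol_continuous hF (polar_disc t r01)).
Qed.

Lemma hol_bounded_circle F F' r : hol F F' -> 0 < r < 1 -> exists2 M : R, 0 <= M &
  forall t, J t -> cabs (F (polar r t)) <= M.
Proof.
move=> hF /andP[r0 r1]; have [||d d0 [M HM]] := @homotopy_bound _ F 0 r _ _ r1.
- by move=> w wD; exact: (hol_continuous hF wD).
- by rewrite cabs0.
have FM t : J t -> cabs (F (polar r t)) <= M.
  have [|_] := HM 1 t; first by rewrite ltrDl d0 andbT (lt_trans _ ltr01)// oppr_lt0.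
  by rewrite add0r subr0 mul1r.
exists M => //; rewrite (le_trans (cabs_ge0 _) (FM 0 _))//=.
by rewrite in_itv/= lexx mulr_ge0// pi_ge0.
Qed.

Lemma mean_value F F' r : hol F F' -> 0 < r < 1 ->
  cint (fun t => F (polar r t)) = rc (2 * pi) * F 0.
Proof.
move=> hF /andP[r0 r1].
have := @Cauchy_homotopy _ F F' 0 r hF _ r1; rewrite cabs0 => /(_ r0).
have e t : polar r t / (polar r t - 0) = 1 by rewrite subr0 divff// polar_neq0.
have -> : (fun t => F (polar r t) * (polar r t / (polar r t - 0))) = (fun t => F (polar r t)).
  by apply/funext => t; rewrite e mulr1.
move=> ->; have -> : (fun t => polar r t / (polar r t - 0)) = (fun=> 1).
  by apply/funext => t; rewrite e.
by rewrite cint_cst mulr1 mulrC.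
Qed.

Lemma cint_conj (h : R -> C) : ccont h -> cint (fun t => conjc (h t) : C) = conjc (cint h).
Proof.
move=> /ccont_ReIm[hr hi]; apply/eqP; rewrite eq_complex; apply/andP; split; apply/eqP => /=.
  by apply: eq_Rintegral => t _; case: (h t).
rewrite -mulN1r -RintegralZl//; last exact: continuousR_integrable.
by apply: eq_Rintegral => t _; rewrite mulN1r; case: (h t).
Qed.

Lemma conj_polar r t : conjc (polar r t) = rc (r ^+ 2) * (polar r t)^-1 :> C.
Proof.
have [->|r0] := eqVneq r 0.
  by rewrite expr0n/= mul0r /polar !mul0r; apply/eqP; rewrite eq_complex/= oppr0 eqxx.
have w0 : polar r t != 0 by rewrite -cabs_gt0 cabs_polar normr_gt0.
apply: (mulIf w0); rewrite mulfVK// /polar; apply/eqP; rewrite eq_complex/=.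
have e := cos2Dsin2 t; rewrite !mulNr opprK; apply/andP; split; apply/eqP; last by ring.
have -> : r ^+ 2 = r ^+ 2 * (cos t ^+ 2 + sin t ^+ 2) by rewrite e mulr1.
by ring.
Qed.

Lemma cint_polarX r n : 0 < r < 1 -> cint (fun t => polar r t ^+ n.+1) = 0.
Proof.
move=> r01; have [F' hF] := hol_X n.+1.
by rewrite (mean_value hF r01) expr0n/= mulr0.
Qed.

(** Negative powers are not holomorphic at 0, so [mean_value] does not apply; on the circle they are
    multiples of conjugates of positive powers. *)
Lemma cint_polarXV r n : 0 < r < 1 -> cint (fun t => (polar r t ^+ n.+1)^-1) = 0.
Proof.
move=> r01; have r0 : 0 < r by case/andP: r01.
have -> : (fun t => (polar r t ^+ n.+1)^-1) =
  (fun t => rc ((r ^+ 2)^-1 ^+ n.+1) * (conjc (polar r t ^+ n.+1) : C)).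
  apply/funext => t.
  have -> : conjc (polar r t ^+ n.+1) = (conjc (polar r t)) ^+ n.+1 :> C by exact: rmorphXn.
  rewrite conj_polar exprMn -rcX mulrA -rcM -exprMn.
  by rewrite mulVf ?expr1n ?rmorph1 ?mul1r ?exprVn// expf_neq0// gt_eqF.
have c1 := @ccontX _ _ n.+1 (@polar_ccont _ r).
by rewrite (@cintZ _ _ _ (ccont_conj c1)) (cint_conj c1) cint_polarX// rmorph0 mulr0.
Qed.

Lemma cint_polar_quot r (k n : nat) : 0 < r < 1 ->
  cint (fun t => polar r t ^+ k / polar r t ^+ n) = if k == n then rc (2 * pi) else 0.
Proof.
move=> r01; have w0 t : polar r t != 0 by apply: polar_neq0; case/andP: r01.
have [->|kn] := eqVneq k n.
  rewrite -[RHS]mulr1 -cint_cst; congr cint; apply/funext => t.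
  by rewrite divff// expf_neq0.
have [kn'|kn'] := ltnP k n.
  rewrite -(cint_polarXV (n - k.+1) r01); congr cint; apply/funext => t.
  by rewrite subnSK// expfB// invf_div.
have {}kn : (n < k)%N by rewrite ltn_neqAle eq_sym kn.
rewrite -(cint_polarX (k - n.+1) r01); congr cint; apply/funext => t.
by rewrite subnSK// expfB.
Qed.

Lemma cint_cvg (h : nat -> R -> C) (k : R -> C) (K q : R) :
  (forall n, ccont (h n)) -> ccont k -> 0 < q < 1 ->
  (forall n t, J t -> cabs (k t - h n t) <= K * q ^+ n) ->
  (fun n => cint (h n)) @ \oo --> cint k.
Proof.
move=> hc kc /andP[q0 q1] kh; apply/cvgCP_le => e e0.
have qn1 : `|q| < 1 by rewrite gtr0_norm.
have /cvgrPdist_le/(_ e e0) := @cvg_geometric R (4 * pi * K) q qn1.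
apply: filterS => n; rewrite /= sub0r normrN => /(le_trans (ler_norm _)).
apply: le_trans; rewrite cabs_distC.
have nc : ccont (fun t => -1 * h n t) := ccontM (@ccont_cst _ (-1)) (hc n).
have nE : (fun t => k t - h n t) = (fun t => k t + (-1) * h n t).
  by apply/funext => t; rewrite mulN1r.
have -> : cint k - cint (h n) = cint (fun t => k t - h n t).
  by rewrite nE (cintD kc nc) (@cintZ _ (-1) _ (hc n)) mulN1r.
have -> : 4 * pi * K * q ^+ n = 4 * pi * (K * q ^+ n) by rewrite mulrA.
apply: cint_bound; last exact: kh.
by rewrite nE; exact: (ccontD kc nc).
Qed.

(** Cauchy's integral for the Taylor coefficient of index [n]; its independence of [r] is
    [ccoef_indep]. *)
Definition ccoef F r n : C :=
  rc (2 * pi)^-1 * cint (fun t => F (polar r t) / polar r t ^+ n).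

Let rc2pi : rc (2 * pi) != 0 :> C.
Proof. by rewrite -cabs_eq0 cabs_rc normr_eq0 mulf_neq0// gt_eqF// pi_gt0. Qed.

Lemma ccoefE F r a (K q : R) n : ccont (fun t => F (polar r t)) -> 0 < r < 1 -> 0 < q < 1 ->
  (forall N t, J t ->
    cabs (F (polar r t) - series (fun n => a n * polar r t ^+ n) N) <= K * q ^+ N) ->
  cint (fun t => F (polar r t) / polar r t ^+ n) = rc (2 * pi) * a n.
Proof.
move=> Fc r01 q01 tl; have r0 : 0 < r by case/andP: r01.
have w0 t : polar r t != 0 by exact: polar_neq0.
have Vc : ccont (fun t => (polar r t ^+ n)^-1).
  by apply: ccontV (@ccontX _ _ n (@polar_ccont _ r)) => t; rewrite expf_neq0.
have Xc k : ccont (fun t => a k * polar r t ^+ k).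
  exact: (ccontM (@ccont_cst _ (a k)) (@ccontX _ _ k (@polar_ccont _ r))).
pose h N t : C := \sum_(0 <= k < N) (a k * polar r t ^+ k) / polar r t ^+ n.
have qc k : ccont (fun t => a k * polar r t ^+ k / polar r t ^+ n).
  exact: (ccontM (Xc k) Vc).
have hc N : ccont (h N) := @ccont_sum _ N _ qc.
have h1 : (fun N => cint (h N)) @ \oo --> cint (fun t => F (polar r t) / polar r t ^+ n).
  apply: (@cint_cvg h _ (K / r ^+ n) q hc _ q01); first exact: (ccontM Fc Vc).
  move=> N t Jt; rewrite /h -mulr_suml -mulrBl cabsM cabsV cabsX cabs_polar gtr0_norm//.
  by rewrite [leRHS]mulrAC ler_wpM2r ?invr_ge0 ?exprn_ge0 ?(ltW r0)// tl.
(* By orthogonality the integrals of the partial sums are constant as soon as [N > n]. *)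
apply: (cvgC_unique h1); apply/cvgCP => e e0; exists n.+1 => // N /= nN.
suff -> : cint (h N) = rc (2 * pi) * a n by rewrite subrr cabs0.
rewrite /h cint_sum// (eq_bigr (fun k => if k == n then rc (2 * pi) * a n else 0)).
  by rewrite -big_mkcond big_nat1_eq nN.
move=> k _; have -> : (fun t => a k * polar r t ^+ k / polar r t ^+ n) =
    (fun t => a k * (polar r t ^+ k / polar r t ^+ n)) by apply/funext => t; rewrite mulrA.
rewrite (@cintZ _ _ _ (ccontM (@ccontX _ _ k (@polar_ccont _ r)) Vc)) cint_polar_quot//.
by case: eqP => [->|_]; rewrite ?mulr0// mulrC.
Qed.

End Holomorphic.

Section Taylor.
Context {R : realType}.
Local Notation C := (Cpx R).
Local Notation rc := (real_complex R).
Local Notation leb := (@lebesgue_measure R).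
Local Notation J := (`[0%R, (2 * pi)%R]%classic : set (measurableTypeR R)).
Implicit Types (z w v : C) (F G : C -> C) (r s t : R) (a : nat -> C).

Let rc2pi : rc (2 * pi) != 0 :> C.
Proof. by rewrite -cabs_eq0 cabs_rc normr_eq0 mulf_neq0// gt_eqF// pi_gt0. Qed.

Lemma Taylor_circle F F' z r : hol F F' -> cabs z < r -> r < 1 ->
  series (fun n => ccoef F r n * z ^+ n) @ \oo --> F z.
Proof.
move=> hF zr r1; have r0 : 0 < r by rewrite (le_lt_trans (cabs_ge0 z)).
have r01 : 0 < r < 1 by rewrite r0.
have w0 t : polar r t != 0 by exact: polar_neq0.
have wz t : polar r t - z != 0.
  apply/eqP => /eqP; rewrite subr_eq0 => /eqP e; move: zr.
  by rewrite -e cabs_polar gtr0_norm// ltxx.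
have dwz t : r - cabs z <= cabs (polar r t - z).
  by rewrite -{1}(gtr0_norm r0) -(cabs_polar r t) cabs_dist.
have drz : 0 < r - cabs z by rewrite subr_gt0.
have wc := @polar_ccont _ r.
have wVc : ccont (fun t => (polar r t)^-1) := ccontV w0 wc.
have kc : ccont (fun t => polar r t / (polar r t - z)).
  exact: (ccontM wc (ccontV wz (ccontD wc (@ccont_cst _ (- z))))).
have Xc n : ccont (fun t => (z / polar r t) ^+ n).
  exact: (@ccontX _ _ n (ccontM (@ccont_cst _ z) wVc)).
have Sc N : ccont (fun t => \sum_(0 <= n < N) (z / polar r t) ^+ n).
  exact: (@ccont_sum _ N _ Xc).
(* The natural ratio [cabs z / r] vanishes at [z = 0], while [cint_cvg] wants a positive one; 1/2
   serves there. *)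
have [q [q01 zq]] : exists q : R, 0 < q < 1 /\ cabs z / r <= q.
  have [z0|z0] := eqVneq (cabs z) 0.
    by exists 2^-1; rewrite z0 mul0r invr_gt0 invf_lt1 ?ltr1n// ltr0n invr_ge0 ler0n.
  exists (cabs z / r); split => //.
  have zp : 0 < cabs z by rewrite lt_def z0 cabs_ge0.
  by rewrite divr_gt0//= ltr_pdivrMr// mul1r.
have geoS t N : polar r t / (polar r t - z) - \sum_(0 <= n < N) (z / polar r t) ^+ n
    = (z / polar r t) ^+ N * (polar r t / (polar r t - z)).
  elim: N => [|N IH]; first by rewrite big_nil subr0 expr0 mul1r.
  rewrite big_nat_recr//= opprD addrA IH exprS.
  set x := _ ^+ N; field.
  by rewrite w0 wz.
have tailS t N : cabs (polar r t / (polar r t - z) - \sum_(0 <= n < N) (z / polar r t) ^+ n)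
    <= r / (r - cabs z) * q ^+ N.
  rewrite geoS !cabsM cabsX cabsM !cabsV !cabs_polar (gtr0_norm r0) mulrC.
  apply: ler_pM.
  - by rewrite mulr_ge0 ?invr_ge0 ?cabs_ge0// ltW.
  - by rewrite exprn_ge0// divr_ge0 ?cabs_ge0// ltW.
  - by rewrite ler_wpM2l ?(ltW r0)// lef_pV2 ?posrE// (lt_le_trans drz).
  - by rewrite lerXn2r ?nnegrE ?divr_ge0 ?cabs_ge0 ?(ltW r0)//; case/andP: q01 => /ltW.
have Fc : ccont (fun t => F (polar r t)).
  by apply: (hol_polar hF); rewrite (ltW r0).
have [M M0 FM] := hol_bounded_circle hF r01.
have lim1 : (fun N => cint (fun t => \sum_(0 <= n < N) (z / polar r t) ^+ n)) @ \oo -->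
    cint (fun t => polar r t / (polar r t - z)).
  apply: (cint_cvg Sc kc q01) => N t _; exact: tailS.
(* [Cauchy_homotopy] leaves the integral of the kernel itself; in its expansion only the constant
   term contributes. *)
have K2pi : cint (fun t => polar r t / (polar r t - z)) = rc (2 * pi).
  apply: (cvgC_unique lim1); apply/cvgCP => e e0; exists 1%N => // -[//|N] _ /=.
  suff -> : cint (fun t => \sum_(0 <= n < N.+1) (z / polar r t) ^+ n) = rc (2 * pi).
    by rewrite subrr cabs0.
  rewrite (cint_sum _ Xc) big_nat_recl//= big1_seq ?addr0 => [|n _].
    by rewrite -[RHS]mulr1 -cint_cst; congr cint; apply/funext => t; rewrite expr0.
  have -> : (fun t => (z / polar r t) ^+ n.+1) =
      (fun t => z ^+ n.+1 * (polar r t ^+ n.+1)^-1).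
    by apply/funext => t; rewrite exprMn exprVn.
  have Vc : ccont (fun t => (polar r t ^+ n.+1)^-1).
    by apply: ccontV (@ccontX _ _ n.+1 wc) => t; rewrite expf_neq0.
  by rewrite (@cintZ _ _ _ Vc) cint_polarXV// mulr0.
have FSc N : ccont (fun t => F (polar r t) * \sum_(0 <= n < N) (z / polar r t) ^+ n).
  exact: (ccontM Fc (Sc N)).
have lim2 : (fun N => cint (fun t => F (polar r t) * \sum_(0 <= n < N) (z / polar r t) ^+ n))
    @ \oo --> cint (fun t => F (polar r t) * (polar r t / (polar r t - z))).
  apply: (@cint_cvg _ _ _ (M * (r / (r - cabs z))) q FSc (ccontM Fc kc) q01) => N t Jt.
  by rewrite -mulrBr cabsM -mulrA ler_pM ?cabs_ge0 ?FM.
move: lim2; rewrite (Cauchy_homotopy hF zr r1) K2pi => lim2.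
have := cvgCM (@cvgC_cst _ _ \oo _ (rc (2 * pi))^-1) lim2.
have -> : (rc (2 * pi))^-1 * (F z * rc (2 * pi)) = F z by rewrite mulrCA mulVf// mulr1.
set A := (fun N => _ * _) => lim3.
suff <- : A = series (fun n => ccoef F r n * z ^+ n) by exact: lim3.
apply/funext => N; rewrite /A /series/=.
have -> : (fun t => F (polar r t) * \sum_(0 <= n < N) (z / polar r t) ^+ n) =
    (fun t => \sum_(0 <= n < N) z ^+ n * (F (polar r t) / polar r t ^+ n)).
  apply/funext => t; rewrite mulr_sumr; apply: eq_bigr => n _.
  by rewrite exprMn exprVn mulrCA.
have Dc n : ccont (fun t => F (polar r t) / polar r t ^+ n).
  by apply: (ccontM Fc (ccontV _ (@ccontX _ _ n wc))) => t; rewrite expf_neq0.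
rewrite cint_sum => [|n]; last exact: (ccontM (@ccont_cst _ (z ^+ n)) (Dc n)).
rewrite mulr_sumr; apply: eq_bigr => n _; rewrite (@cintZ _ _ _ (Dc n)) /ccoef.
by rewrite fmorphV mulrCA mulrC.
Qed.

Lemma ccoef_bound F F' r : hol F F' -> 0 < r < 1 -> exists2 M : R, 0 <= M &
  forall n, cabs (ccoef F r n) <= M / r ^+ n.
Proof.
move=> hF r01; have /andP[r0 r1] := r01.
have [M M0 FM] := hol_bounded_circle hF r01.
exists (2 * M) => [|n]; first by rewrite mulr_ge0.
have c0 : 0 < 2 * pi :> R by rewrite mulr_gt0// pi_gt0.
rewrite cabsM cabs_rc gtr0_norm ?invr_gt0//.
have wc := @polar_ccont _ r.
have Fc : ccont (fun t => F (polar r t)) by apply: (hol_polar hF); rewrite (ltW r0).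
have Dc : ccont (fun t => F (polar r t) / polar r t ^+ n).
  by apply: (ccontM Fc (ccontV _ (@ccontX _ _ n wc))) => t; rewrite expf_neq0// polar_neq0.
rewrite ler_pdivrMl//.
have -> : 2 * pi * (2 * M / r ^+ n) = 4 * pi * (M / r ^+ n) by ring.
apply: cint_bound Dc _ => t Jt.
rewrite cabsM cabsV cabsX cabs_polar (gtr0_norm r0) ler_wpM2r ?FM//.
by rewrite invr_ge0 exprn_ge0// ltW.
Qed.

(** The expansion found at radius [r] converges geometrically on the smaller circle, where [ccoefE]
    reads its coefficients off again. *)
Lemma ccoef_indep F F' r s n : hol F F' -> 0 < s -> s < r -> r < 1 ->
  ccoef F s n = ccoef F r n.
Proof.
move=> hF s0 sr r1; have r0 := lt_trans s0 sr; have s1 := lt_trans sr r1.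
have [|M M0 cM] := @ccoef_bound F F' r hF; first by rewrite r0.
have q01 : 0 < s / r < 1 by rewrite divr_gt0//= ltr_pdivrMr// mul1r.
have q01' : 0 <= s / r < 1 by case/andP: q01 => /ltW -> ->.
rewrite {1}/ccoef (@ccoefE _ F s (ccoef F r) (M / (1 - s / r)) (s / r) n)//.
- by rewrite fmorphV mulrA mulVf ?mul1r.
- by apply: (hol_polar hF); rewrite (ltW s0).
- by rewrite s0.
move=> N t Jt; have aM k : cabs (ccoef F r k * polar s t ^+ k) <= M * (s / r) ^+ k.
  rewrite cabsM cabsX cabs_polar (gtr0_norm s0).
  have -> : M * (s / r) ^+ k = M / r ^+ k * s ^+ k.
    by rewrite exprMn exprVn mulrAC mulrA.
  by rewrite ler_wpM2r// exprn_ge0// ltW.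
have [l ul tl] := cvg_geometric_bound q01' aM.
have pr : cabs (polar s t) < r by rewrite cabs_polar gtr0_norm.
by rewrite (cvgC_unique (Taylor_circle hF pr r1) ul).
Qed.

Lemma hol_power_series F F' : hol F F' ->
  exists2 a : nat -> C, geo a & forall z, disc z -> series (fun n => a n * z ^+ n) @ \oo --> F z.
Proof.
move=> hF; have H z : disc z -> series (fun n => ccoef F 2^-1 n * z ^+ n) @ \oo --> F z.
  move=> /disc_between[r' [zr' r'0 r'1]].
  (* The coefficients are those at radius 1/2; the floor 3/4 keeps [r] above it, as [ccoef_indep]
     requires. *)
  pose r := Num.max r' (3 / 4).
  have r1 : r < 1 by rewrite gt_max r'1/=; lra.
  have hr : 2^-1 < r by rewrite lt_max; apply/orP; right; lra.
  have zr : cabs z < r by rewrite lt_max zr'.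
  have := Taylor_circle hF zr r1.
  have -> : ccoef F r = ccoef F 2^-1; last by apply.
  by apply/funext => n; rewrite (ccoef_indep n hF _ hr r1)// invr_gt0.
by exists (ccoef F 2^-1) => //; apply: cvg_geo => z zD; exists (F z); exact: H.
Qed.

Lemma hol_psum F F' : hol F F' ->
  exists2 a : nat -> C, geo a & forall z, disc z -> F z = psum a z.
Proof.
move=> /hol_power_series[a ga aF]; exists a => // z zD.
by rewrite (psum_eq (aF z zD)).
Qed.

(** Expansion at [z0] is reduced to expansion at 0 by the affine map of the unit disc onto the disc
    of radius [1 - cabs z0] around [z0], which stays inside the unit disc. *)
Lemma hol_analytic F F' : hol F F' -> analytic_on_disc F.
Proof.
move=> hF z0 z0D; pose r := 1 - cabs z0; have r0 : 0 < r by rewrite subr_gt0.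
have rc0 : rc r != 0 :> C by rewrite -cabs_eq0 cabs_rc normr_eq0 gt_eqF.
have GD z : disc z -> disc (z0 + rc r * z).
  rewrite /disc/= => zD; rewrite (le_lt_trans (cabsD _ _))//.
  by rewrite cabsM cabs_rc (gtr0_norm r0) -ltrBrDl -/r gtr_pMr.
have [a ga aF] := hol_power_series (hol_comp GD (hol_affine z0 (rc r)) hF).
exists (fun n => a n / rc r ^+ n), r; split => // z zr.
have uD : disc ((z - z0) / rc r).
  by rewrite /disc/= cabsM cabsV cabs_rc gtr0_norm// ltr_pdivrMr// mul1r.
have := aF _ uD.
have -> : z0 + rc r * ((z - z0) / rc r) = z by rewrite mulrCA divff// mulr1 addrC subrK.
have -> : (fun n => a n * ((z - z0) / rc r) ^+ n) =
    (fun n => a n / rc r ^+ n * (z - z0) ^+ n).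
  by apply/funext => n; rewrite exprMn exprVn mulrAC mulrA.
by apply.
Qed.

Lemma analytic_hol F : analytic_on_disc F -> hol F (derive1 F).
Proof.
move=> aF z0 z0D; have [c [r [r0 cF]]] := aF z0 z0D.
have rc0 : rc r != 0 :> C by rewrite -cabs_eq0 cabs_rc normr_eq0 gt_eqF.
pose a n : C := c n * rc r ^+ n.
have uE z n : a n * ((z - z0) / rc r) ^+ n = c n * (z - z0) ^+ n.
  rewrite /a exprMn exprVn -mulrA; congr (_ * _).
  by rewrite mulrC mulfVK// expf_neq0.
have Fz z : cabs (z - z0) < r ->
    series (fun n => a n * ((z - z0) / rc r) ^+ n) @ \oo --> F z.
  have -> : (fun n => a n * ((z - z0) / rc r) ^+ n) = (fun n => c n * (z - z0) ^+ n).
    by apply/funext => n; rewrite uE.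
  exact: cF.
have ga : geo a.
  apply: cvg_geo => u uD; exists (F (z0 + rc r * u)).
  have := Fz (z0 + rc r * u); rewrite addrAC subrr add0r cabsM cabs_rc (gtr0_norm r0).
  by rewrite gtr_pMr// (mulrC (rc r)) mulfK// => /(_ uD).
have uD z : cabs (z - z0) < r -> disc ((z - z0) / rc r).
  by move=> zr; rewrite /disc/= cabsM cabsV cabs_rc gtr0_norm// ltr_pdivrMr// mul1r.
have FE z : cabs (z - z0) < r -> psum a ((z - z0) / rc r) = F z.
  by move=> zr; rewrite (psum_eq (Fz z zr)).
have dF z : cabs (z - z0) < r ->
    is_derive z (1 : C) F (psum (dcoef a) ((z - z0) / rc r) * (rc r)^-1).
  move=> zr; have du : is_derive z (1 : C) (fun w => (w - z0) / rc r) (rc r)^-1.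
    have := cderivZ (rc r)^-1 (cderivB (cderiv_id z) (cderiv_cst z0 z)).
    rewrite subr0 mulr1.
    have -> : (fun w => (rc r)^-1 * (w - z0)) = (fun w => (w - z0) / rc r).
      by apply/funext => w; rewrite mulrC.
    by apply.
  have := cderiv_comp du (psum_deriv ga (uD z zr)).
  apply: near_eq_is_derive; apply/nbhsCP; exists (r - cabs (z - z0)).
    by rewrite subr_gt0.
  move=> w wz /=; apply: FE.
  have -> : w - z0 = (w - z) + (z - z0) by rewrite addrA subrK.
  by rewrite (le_lt_trans (cabsD _ _))// -ltrBrDr.
have z0r : cabs (z0 - z0) < r by rewrite subrr cabs0.
have dE z : cabs (z - z0) < r -> derive1 F z = psum (dcoef a) ((z - z0) / rc r) * (rc r)^-1.
  by move=> /dF /is_cderive1.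
split; first by rewrite (dE _ z0r); exact: dF.
have pc : {for z0, continuous (fun z => psum (dcoef a) ((z - z0) / rc r) * (rc r)^-1)}.
  have uc : {for z0, continuous (fun z => (z - z0) / rc r)}.
    exact: (continuousCM (continuousCD (@continuousC_id _ z0) (@continuousC_cst _ (- z0) z0))
      (@continuousC_cst _ (rc r)^-1 z0)).
  exact: (continuousCM (continuousC_comp uc (psum_continuous (geo_deriv ga) (uD _ z0r)))
    (@continuousC_cst _ (rc r)^-1 z0)).
apply: continuousC_near pc; apply/nbhsCP; exists r => // z zr.
by rewrite dE.
Qed.

Lemma psum_coef_unique a b : geo a -> geo b ->
  (forall z, disc z -> psum a z = psum b z) -> a = b.
Proof.
move=> ga gb ab; apply/funext => n.
have h01 : 0 < (2^-1 : R) < 1 by apply/andP; split; lra.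
have coef c : geo c -> cint (fun t => psum c (polar 2^-1 t) / polar 2^-1 t ^+ n) = rc (2 * pi) * c n.
  move=> gc; have [K [q [K0 q01 tl]]] := psum_tail gc h01.
  have Fc : ccont (fun t => psum c (polar 2^-1 t)).
    by apply: (hol_polar (psum_hol gc)); apply/andP; split; lra.
  apply: (@ccoefE _ (psum c) 2^-1 c K q n Fc h01 q01) => N t _.
  by apply: tl; rewrite cabs_polar gtr0_norm ?invr_gt0.
apply: (mulfI rc2pi); rewrite -(coef a ga) -(coef b gb).
congr cint; apply/funext => t; congr (_ / _).
by apply: ab; apply: polar_disc; apply/andP; split; lra.
Qed.

(** Expand the integral of [|F - P|^2 >= 0] for the partial sum [P]. Pairing either [F] or [P] with
    [P] gives the same value [S], since on the circle [conjc (P t)] is a combination of nonpositive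
    powers and only sees the coefficients of index below [N]. *)
Lemma Bessel a r N : geo a -> 0 < r < 1 ->
  2 * pi * (\sum_(0 <= k < N) cabs (a k) ^+ 2 * r ^+ (2 * k)) <=
  \int[leb]_(t in J) (cabs (psum a (polar r t)) ^+ 2).
Proof.
move=> ga r01; have /andP[r0 r1] := r01.
pose F t : C := psum a (polar r t).
pose P t : C := \sum_(0 <= k < N) a k * polar r t ^+ k.
pose Q t : C := conjc (P t).
have wc := @polar_ccont _ r.
have Fc : ccont F by apply: (hol_polar (psum_hol ga)); rewrite (ltW r0).
have mc k : ccont (fun t => a k * polar r t ^+ k).
  exact: (ccontM (@ccont_cst _ (a k)) (@ccontX _ _ k wc)).
have Pc : ccont P := @ccont_sum _ N _ mc.
have Qc : ccont Q := ccont_conj Pc.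
pose S : C := rc (2 * pi * (\sum_(0 <= k < N) cabs (a k) ^+ 2 * r ^+ (2 * k))).
have QE t : Q t = \sum_(0 <= k < N) (conjc (a k) * rc (r ^+ 2) ^+ k) * (polar r t ^+ k)^-1.
  rewrite /Q /P rmorph_sum; apply: eq_bigr => k _ /=.
  rewrite -mulrA -exprVn -exprMn -conj_polar.
  rewrite [LHS](rmorphM (@conjc R)); congr (_ * _); exact: (rmorphXn (@conjc R)).
have coefQ (h : R -> C) : ccont h ->
    (forall k, (k < N)%N -> cint (fun t => h t / polar r t ^+ k) = rc (2 * pi) * a k) ->
    cint (fun t => h t * Q t) = S.
  move=> hc hk.
  have -> : (fun t => h t * Q t) = (fun t => \sum_(0 <= k < N)
      (conjc (a k) * rc (r ^+ 2) ^+ k) * (h t / polar r t ^+ k)).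
    by apply/funext => t; rewrite QE mulr_sumr; apply: eq_bigr => k _; rewrite mulrCA.
  have Dc k : ccont (fun t => h t / polar r t ^+ k).
    by apply: (ccontM hc (ccontV _ (@ccontX _ _ k wc))) => t; rewrite expf_neq0// polar_neq0.
  rewrite cint_sum => [|k]; last exact: (ccontM (@ccont_cst _ _) (Dc k)).
  rewrite /S rcM rmorph_sum mulr_sumr big_nat [RHS]big_nat; apply: eq_bigr => k /andP[_ kN].
  rewrite (@cintZ _ _ _ (Dc k)) hk//= mulrCA; congr (_ * _).
  have -> : rc (cabs (a k) ^+ 2 * r ^+ (2 * k)) = (a k * conjc (a k)) * rc (r ^+ 2) ^+ k.
    by rewrite rcM -sqr_normc cabsE -!rcX -exprM.
  by rewrite mulrC mulrA.
have FQ : cint (fun t => F t * Q t) = S.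
  apply: (coefQ F Fc) => k _; have [K [q [K0 q01 tl]]] := psum_tail ga r01.
  apply: (@ccoefE _ (psum a) r a K q k Fc r01 q01) => n t _.
  by apply: tl; rewrite cabs_polar gtr0_norm.
have PQ : cint (fun t => P t * Q t) = S.
  apply: (coefQ P Pc) => k kN.
  have -> : (fun t => P t / polar r t ^+ k) =
      (fun t => \sum_(0 <= j < N) a j * (polar r t ^+ j / polar r t ^+ k)).
    by apply/funext => t; rewrite /P mulr_suml; apply: eq_bigr => j _; rewrite mulrA.
  have Dc j : ccont (fun t => polar r t ^+ j / polar r t ^+ k).
    apply: (ccontM (@ccontX _ _ j wc) (ccontV _ (@ccontX _ _ k wc))) => t.
    by rewrite expf_neq0// polar_neq0.
  rewrite cint_sum => [|j]; last exact: (ccontM (@ccont_cst _ _) (Dc j)).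
  rewrite (eq_bigr (fun j => if j == k then rc (2 * pi) * a k else 0)).
    by rewrite -big_mkcond big_nat1_eq kN.
  move=> j _; rewrite (@cintZ _ _ _ (Dc j)) cint_polar_quot//.
  by case: eqP => [->|_]; rewrite ?mulr0// mulrC.
have sqrE (h : C) : cabs h ^+ 2 = complex.Re (h * conjc h).
  by case: h => x y; rewrite cabs_sqr/= mulrN opprK !expr2.
have Fint : leb.-integrable J (EFin \o (fun t => cabs (F t) ^+ 2)).
  apply: continuousR_integrable.
  have /ccont_ReIm[+ _] := ccontM Fc (ccont_conj Fc).
  by have -> : (fun t => cabs (F t) ^+ 2) = (fun t => complex.Re (F t * conjc (F t)));
    [apply/funext => t; exact: sqrE|].
have reint (h : R -> C) : ccont h -> leb.-integrable J (EFin \o (fun t => complex.Re (h t))).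
  by move=> /ccont_ReIm[hr _]; exact: continuousR_integrable.
have FQc := ccontM Fc Qc; have PQc := ccontM Pc Qc.
have twoc : ccont (fun t => P t * Q t + - 2 * (F t * Q t)).
  exact: (ccontD PQc (ccontM (@ccont_cst _ (- 2)) FQc)).
have : 0 <= \int[leb]_(t in J) (cabs (F t) ^+ 2 + complex.Re (P t * Q t + - 2 * (F t * Q t))).
  apply: Rintegral_ge0 => t _.
  have -> : cabs (F t) ^+ 2 + complex.Re (P t * Q t + - 2 * (F t * Q t)) =
      cabs (F t - P t) ^+ 2; last exact: sqr_ge0.
  rewrite /Q !cabs_sqr; case: (F t) => x y; case: (P t) => u v /=; ring.
have I2 : \int[leb]_(t in J) complex.Re (P t * Q t + - 2 * (F t * Q t)) = - complex.Re S.
  rewrite -[LHS]/(complex.Re (cint (fun t => P t * Q t + - 2 * (F t * Q t)))).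
  rewrite (cintD PQc (ccontM (@ccont_cst _ (- 2)) FQc)) (@cintZ _ _ _ FQc) PQ FQ.
  by rewrite mulNr mulr_natl mulr2n opprD addrA subrr add0r cReN.
rewrite RintegralD//; last exact: reint twoc.
by rewrite I2 subr_ge0.
Qed.

End Taylor.

(** * Bloch type spaces *)

Section BlochGrowth.
Context {R : realType}.
Local Notation C := (Cpx R).
Local Notation rc := (real_complex R).
Local Notation leb := (@lebesgue_measure R).
Local Notation J := (`[0%R, (2 * pi)%R]%classic : set (measurableTypeR R)).
Implicit Types (z w v : C) (F G : C -> C) (r s t : R) (a : nat -> C).

(* The factor 2 comes from estimating the real and imaginary parts separately. *)
Lemma increment_le (c : R -> C) (v : R -> C) (k dk : R -> R) (x y : R) : x <= y ->
  (forall s, x <= s <= y -> cderivR c s (v s)) ->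
  (forall s, x <= s <= y -> is_derive s (1 : R) k (dk s)) ->
  (forall s, x <= s <= y -> cabs (v s) <= dk s) ->
  cabs (c y - c x) <= 2 * (k y - k x).
Proof.
move=> xy dc dkk vk.
have real_case (f g : R -> R) : (forall s, x <= s <= y -> is_derive s (1 : R) f (g s)) ->
    (forall s, x <= s <= y -> `|g s| <= dk s) -> `|f y - f x| <= k y - k x.
  move=> fg gdk.
  have step (h dh : R -> R) : (forall s, x <= s <= y -> is_derive s (1 : R) h (dh s)) ->
      (forall s, x <= s <= y -> 0 <= dh s) -> 0 <= h y - h x.
    move=> hd dh0; have [s sxy||c0 c0xy ->] := @MVT_segment R h dh x y xy.
    - by apply: hd; have := subset_itv_oo_cc sxy; rewrite in_itv.
    - apply: continuous_in_subspaceT => s; rewrite inE/= in_itv/= => /hd ds.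
      exact/differentiable_continuous/derivable1_diffP.
    - by rewrite mulr_ge0 ?subr_ge0// dh0.
  have h1 : 0 <= (k y - f y) - (k x - f x).
    apply: (step (fun s => k s - f s) (fun s => dk s - g s)) => s sxy.
      by have ? := dkk s sxy; have ? := fg s sxy; exact: is_deriveB.
    by rewrite subr_ge0 (le_trans (ler_norm _)) ?gdk.
  have h2 : 0 <= (k y + f y) - (k x + f x).
    apply: (step (fun s => k s + f s) (fun s => dk s + g s)) => s sxy.
      by have ? := dkk s sxy; have ? := fg s sxy; exact: is_deriveD.
    by rewrite -lerBlDr sub0r (le_trans _ (gdk s sxy))// -normrN ler_norm.
  by rewrite ler_norml; apply/andP; split; lra.
have dr := real_case (fun s => complex.Re (c s)) (fun s => complex.Re (v s)).
have di := real_case (fun s => complex.Im (c s)) (fun s => complex.Im (v s)).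
rewrite (le_trans (cabs_le_ReIm _))// cReD cImD cReN cImN mulr_natl mulr2n lerD//.
  apply: dr => s sxy; first by have /cderivR_ReIm[] := dc s sxy.
  exact: le_trans (Re_le_cabs _) (vk s sxy).
apply: di => s sxy; first by have /cderivR_ReIm[] := dc s sxy.
exact: le_trans (Im_le_cabs _) (vk s sxy).
Qed.

Variable (alpha : R).
Hypothesis alpha1 : 1 < alpha.

Lemma bloch_normP (beta M : R) F : (bloch_norm beta F <= M%:E)%E <->
  exists M1 : R, cabs (F 0) + M1 <= M /\
  forall z, disc z -> cabs (derive1 F z) * (1 - cabs z ^+ 2) `^ beta <= M1.
Proof.
have D0 : disc (0 : C) by rewrite /disc/= cabs0.
split=> [FM|[M1 [M1M H]]].
  have lb z : disc z ->
      ((cabs (derive1 F z) * (1 - cabs z ^+ 2) `^ beta)%:E <= bloch_seminorm beta F)%E.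
    by move=> zD; apply: ereal_sup_ubound; exists z.
  have f0 : (0 <= bloch_seminorm beta F)%E.
    by apply: le_trans (lb 0 D0); rewrite lee_fin mulr_ge0 ?cabs_ge0// powR_ge0.
  have fs : bloch_seminorm beta F \is a fin_num.
    rewrite ge0_fin_numE//; move: FM; rewrite /bloch_norm.
    by case: bloch_seminorm => [x _||] //; rewrite ?ltry.
  exists (fine (bloch_seminorm beta F)); split.
    by rewrite -lee_fin EFinD fineK.
  by move=> z /lb; rewrite -{1}(fineK fs) lee_fin.
apply: (@le_trans _ _ ((cabs (F 0))%:E + M1%:E)%E); last by rewrite -EFinD lee_fin.
rewrite leeD2l//; apply: ge_ereal_sup => _ [z zD <-].
by rewrite lee_fin H.
Qed.

Lemma powRN_le (x y p : R) : 0 < x -> x <= y -> 0 <= p -> y `^ (- p) <= x `^ (- p).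
Proof.
move=> x0 xy p0; have y0 := lt_le_trans x0 xy.
by rewrite !powRN lef_pV2 ?posrE ?powR_gt0// ge0_ler_powR ?nnegrE// ltW.
Qed.

Lemma powR_half (x p : R) : 0 <= x -> (x / 2) `^ (- p) = 2 `^ p * x `^ (- p).
Proof.
move=> x0; rewrite powRM ?invr_ge0// mulrC; congr (_ * _).
by rewrite -powR_inv1// -powRrM mulN1r opprK.
Qed.

Lemma one_sub_sqr_ge (x : R) : 0 <= x < 1 -> 1 - x <= 1 - x ^+ 2.
Proof. by move=> /andP[x0 x1]; rewrite lerD2l lerN2 expr2 ler_piMl// ltW. Qed.

Lemma bloch_deriv F (M : R) z : (bloch_norm alpha F <= M%:E)%E -> disc z ->
  cabs (derive1 F z) <= M * (1 - cabs z) `^ (- alpha).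
Proof.
move=> /bloch_normP[M1 [M1M H]] zD.
have z1 : 0 < 1 - cabs z by rewrite subr_gt0.
have h := H z zD; have F0 := cabs_ge0 (F 0).
rewrite powRN ler_pdivlMr ?powR_gt0//.
apply: (@le_trans _ _ M1); last by rewrite (le_trans _ M1M)// lerDr.
have sq : 1 - cabs z <= 1 - cabs z ^+ 2 by rewrite one_sub_sqr_ge// cabs_ge0.
apply: le_trans h; rewrite ler_wpM2l ?cabs_ge0// ge0_ler_powR ?nnegrE//.
- by rewrite ltW// (lt_trans ltr01).
- exact: ltW.
- exact: le_trans (ltW z1) sq.
Qed.

Lemma bloch_norm_ge0 F (M : R) : (bloch_norm alpha F <= M%:E)%E -> 0 <= M /\ cabs (F 0) <= M.
Proof.
move=> /bloch_normP[M1 [M1M H]].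
have D0 : disc (0 : C) by rewrite /disc/= cabs0.
have M10 : 0 <= M1 by rewrite (le_trans _ (H 0 D0))// mulr_ge0 ?cabs_ge0// powR_ge0.
have F0 := cabs_ge0 (F 0).
by split; lra.
Qed.

(** Integrate [bloch_deriv] along the segment from 0 to [z]: the primitive carries the factor
    [(alpha - 1)^-1], and 2 is the loss in [increment_le]. The summand 1 absorbs [F 0], because the
    power of [1 - cabs z] is at least 1. *)
Lemma bloch_growth F (M : R) z : analytic_on_disc F -> (bloch_norm alpha F <= M%:E)%E ->
  disc z -> cabs (F z) <= M * (1 + 2 / (alpha - 1)) * (1 - cabs z) `^ (1 - alpha).
Proof.
move=> aF FM zD; have [M0 F0M] := bloch_norm_ge0 FM.
have z1 : 0 < 1 - cabs z by rewrite subr_gt0.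
have a1 : 0 < alpha - 1 by rewrite subr_gt0.
have sz s : 0 <= s <= 1 -> cabs (rc s * z) <= cabs z /\ s * cabs z < 1.
  move=> /andP[s0 s1]; rewrite cabsM cabs_rc ger0_norm//.
  have h : s * cabs z <= cabs z by rewrite ler_piMl// cabs_ge0.
  by split => //; rewrite (le_lt_trans h).
have key : cabs (F z - F 0) <= 2 * (M / (alpha - 1) * (1 - 1 * cabs z) `^ (1 - alpha) -
    M / (alpha - 1) * (1 - 0 * cabs z) `^ (1 - alpha)).
  have := @increment_le (fun s => F (rc s * z)) (fun s => derive1 F (rc s * z) * z)
    (fun s => M / (alpha - 1) * (1 - s * cabs z) `^ (1 - alpha))
    (fun s => M * (1 - s * cabs z) `^ (- alpha) * cabs z) 0 1 ler01.
  rewrite !mul1r !mul0r; apply=> s s01; have [sz1 sz2] := sz s s01.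
  - have szD : disc (rc s * z) by rewrite /disc/= (le_lt_trans sz1).
    have dz : cderivR (fun y => rc y * z) s z.
      have := @cderivR_affine R 0 z s.
      have -> : (fun y => 0 + rc y * z) = (fun y => rc y * z) by apply/funext => y; rewrite add0r.
      by apply.
    exact: (cderivR_comp dz (analytic_hol aF szD).1).
  - have sz3 : 0 < 1 - s * cabs z by rewrite subr_gt0.
    have d1 : is_derive s (1 : R) (fun s => 1 - s * cabs z) (- cabs z).
      by apply: is_derive_eq; rewrite /GRing.scale/=; ring.
    have d2 := is_derive1_powR (1 - alpha) sz3.
    have d3 := @is_derive1_comp R (fun x => x `^ (1 - alpha)) (fun s => 1 - s * cabs z) s _ _ d2 d1.
    have d4 := is_deriveZ (M / (alpha - 1)) d3.
    apply: is_derive_eq d4 _; rewrite /GRing.scale/=.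
    have -> : 1 - alpha - 1 = - alpha by ring.
    by field; rewrite gt_eqF.
  - rewrite cabsM ler_wpM2r ?cabs_ge0//.
    have szD : disc (rc s * z) by rewrite /disc/= (le_lt_trans sz1).
    have := bloch_deriv FM szD; rewrite cabsM cabs_rc ger0_norm//.
    by case/andP: s01.
move: key; rewrite mul1r mul0r subr0 powR1 => key.
set p := (1 - cabs z) `^ (1 - alpha) in key *.
have p1 : 1 <= p.
  rewrite /p -(opprB alpha 1).
  apply: (@le_trans _ _ (1 `^ (- (alpha - 1)))); first by rewrite powR1.
  apply: powRN_le => //.
    by rewrite gerBl cabs_ge0.
  exact: ltW.
have -> : F z = F z - F 0 + F 0 by rewrite subrK.
rewrite (le_trans (cabsD _ _))//.
apply: (@le_trans _ _ (2 * (M / (alpha - 1) * p) + M * p)).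
  apply: lerD.
    apply: le_trans key _; rewrite ler_wpM2l// lerBlDr lerDl mulr1 divr_ge0//.
    exact: ltW.
  by rewrite (le_trans F0M)// ler_peMr.
by rewrite le_eqVlt; apply/orP; left; apply/eqP; ring.
Qed.

Lemma sum_sqr_coef_le a r (B : R) N : geo a -> 0 < r < 1 ->
  (forall z, cabs z = r -> cabs (psum a z) <= B) ->
  \sum_(0 <= k < N) cabs (a k) ^+ 2 * r ^+ (2 * k) <= B ^+ 2.
Proof.
move=> ga r01 aB; have /andP[r0 r1] := r01.
have c0 : 0 < 2 * pi :> R by rewrite mulr_gt0// pi_gt0.
rewrite -(ler_pM2l c0) (le_trans (Bessel N ga r01))//.
rewrite (le_trans (ler_norm _))// Rint_bound//.
  have Fc : ccont (fun t => psum a (polar r t)).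
    by apply: (hol_polar (psum_hol ga)); rewrite (ltW r0).
  have /ccont_ReIm[+ _] := ccontM Fc (ccont_conj Fc).
  have -> // : (fun t => cabs (psum a (polar r t)) ^+ 2) =
    (fun t => complex.Re (psum a (polar r t) * conjc (psum a (polar r t)))).
  apply/funext => t; case: (psum a _) => x y; by rewrite cabs_sqr/= mulrN opprK !expr2.
move=> t _; rewrite ger0_norm ?sqr_ge0// lerXn2r ?nnegrE ?cabs_ge0//.
  by rewrite (le_trans (cabs_ge0 _) (aB (polar r 0) _))// cabs_polar gtr0_norm.
by apply: aB; rewrite cabs_polar gtr0_norm.
Qed.

Lemma bloch_abs_sum F (M : R) a : (bloch_norm alpha F <= M%:E)%E ->
  geo a -> (forall z, disc z -> F z = psum a z) ->
  exists K : R, forall t N, 0 < t < 1 ->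
    \sum_(0 <= k < N) cabs (a k) * t ^+ k <= K * (1 - t) `^ (- (alpha - 2^-1)).
Proof.
move=> FM ga Fa.
have aF : analytic_on_disc F.
  by apply: (@hol_analytic _ F); apply: hol_ext (psum_hol ga) => z /Fa.
have [M0 _] := bloch_norm_ge0 FM.
have a1 : 0 < alpha - 1 by rewrite subr_gt0.
(* On the circle of radius [Num.sqrt t] the Bessel weights [r ^+ (2 * k)] become [t ^+ k]; the power
   of 2 is the price of [1 - Num.sqrt t >= (1 - t) / 2]. *)
pose B0 := M * (1 + 2 / (alpha - 1)) * 2 `^ (alpha - 1).
exists ((B0 ^+ 2 + 1) / 2) => t N t01; have /andP[t0 t1] := t01.
have x0 : 0 < 1 - t by rewrite subr_gt0.
have r0 : 0 < Num.sqrt t by rewrite sqrtr_gt0.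
have rr : Num.sqrt t ^+ 2 = t by rewrite sqr_sqrtr// ltW.
have r1 : Num.sqrt t < 1 by rewrite -(@ltr_pXn2r _ 2)// ?nnegrE ?ltW// rr expr1n.
have r01 : 0 < Num.sqrt t < 1 by rewrite r0.
have half : (1 - t) / 2 <= 1 - Num.sqrt t by rewrite -{1}rr; nra.
have B z : cabs z = Num.sqrt t -> cabs (psum a z) <= B0 * (1 - t) `^ (1 - alpha).
  move=> zr; have zD : disc z by rewrite /disc/= zr.
  rewrite -Fa// (le_trans (bloch_growth aF FM zD))// zr /B0 -[leRHS]mulrA.
  rewrite ler_wpM2l ?mulr_ge0 ?addr_ge0 ?divr_ge0 ?(ltW a1)//.
  rewrite -(opprB alpha 1) -powR_half ?(ltW x0)//.
  by apply: powRN_le => //; [rewrite divr_gt0|exact: ltW].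
set p := (1 - t) `^ (1 - alpha) in B.
have S1 := sum_sqr_coef_le N ga r01 B.
(* Weight for Cauchy-Schwarz in the form [2 x <= l x^2 + l^-1]. It is chosen so that the two sums,
   of order [(1 - t)^(2 - 2 alpha)] and [(1 - t)^-1], both end at the exponent [1/2 - alpha]. *)
pose l := (1 - t) `^ (alpha - 3 / 2).
have l0 : 0 < l by rewrite powR_gt0.
have amgm k : cabs (a k) * t ^+ k <= (l * (cabs (a k) ^+ 2 * t ^+ k) + l^-1 * t ^+ k) / 2.
  have tk : 0 <= t ^+ k by rewrite exprn_ge0// ltW.
  have -> : (l * (cabs (a k) ^+ 2 * t ^+ k) + l^-1 * t ^+ k) / 2 =
    (l * cabs (a k) ^+ 2 + l^-1) / 2 * t ^+ k by ring.
  apply: ler_wpM2r => //; rewrite ler_pdivlMr//.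
  have -> : l * cabs (a k) ^+ 2 + l^-1 = l^-1 * ((l * cabs (a k)) ^+ 2 + 1).
    by field; rewrite gt_eqF.
  rewrite ler_pdivlMl// -subr_ge0.
  have -> : (l * cabs (a k)) ^+ 2 + 1 - l * (cabs (a k) * 2) = (l * cabs (a k) - 1) ^+ 2 by ring.
  exact: sqr_ge0.
rewrite (le_trans (ler_sum _ (fun k _ => amgm k)))//.
rewrite -mulr_suml big_split/= -!mulr_sumr mulrAC; apply: ler_wpM2r; first by rewrite invr_ge0.
have S2 : \sum_(0 <= k < N) t ^+ k <= (1 - t)^-1.
  have := @geometric_le_lim R N 1 t ler01 t0; rewrite ger0_norm ?(ltW t0)// => /(_ t1).
  rewrite mul1r /series/=; apply: le_trans; rewrite le_eqVlt; apply/orP; left; apply/eqP.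
  by apply: eq_bigr => k _; rewrite mul1r.
have S1' : \sum_(0 <= k < N) cabs (a k) ^+ 2 * t ^+ k <= (B0 * p) ^+ 2.
  apply: le_trans S1; rewrite le_eqVlt; apply/orP; left; apply/eqP.
  by apply: eq_bigr => k _; rewrite exprM rr.
apply: (@le_trans _ _ (l * (B0 * p) ^+ 2 + l^-1 * (1 - t)^-1)).
  by apply: lerD; rewrite ler_wpM2l// ltW// invr_gt0.
have x0' : 1 - t != 0 by rewrite gt_eqF.
have e1 : l * p ^+ 2 = (1 - t) `^ (- (alpha - 2^-1)).
  rewrite /l /p expr2 -!powRD ?x0' ?implybT//; congr (_ `^ _); lra.
have e2 : l^-1 * (1 - t)^-1 = (1 - t) `^ (- (alpha - 2^-1)).
  rewrite /l -powRN -(powR_inv1 (ltW x0)) -!powRD ?x0' ?implybT//; congr (_ `^ _); lra.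
by rewrite exprMn mulrCA e1 e2 mulrDl mul1r.
Qed.

End BlochGrowth.

(** * Integrals against Carleson measures *)

Section CarlesonIntegrals.
Context {R : realType}.
Variable mu : {finite_measure set (measurableTypeR R) -> \bar R}.
Local Notation C := (Cpx R).
Local Notation rc := (real_complex R).
Local Notation seg s := ([set` `[s%R, 1%R[%R] : set (measurableTypeR R)).
Implicit Types (s t x y : R).

Let dy (i : nat) : R := 2^-1 ^+ i.

Let dy_gt0 i : 0 < dy i.
Proof. by rewrite exprn_gt0// invr_gt0. Qed.

Let dyS i : dy i.+1 = dy i / 2.
Proof. by rewrite /dy exprSr. Qed.

Definition mass x : R := fine (mu (seg x)).

Lemma massE x : mu (seg x) = (mass x)%:E.
Proof. by rewrite /mass fineK// fin_num_measure. Qed.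

Lemma mass_ge0 x : 0 <= mass x.
Proof. by rewrite -lee_fin -massE. Qed.

Lemma dyadic_piece x : 0 < x <= 1 -> exists i, dy i.+1 < x <= dy i.
Proof.
move=> /andP[x0 x1]; have ex : exists n, dy n < x.
  have h1 : `|2^-1 : R| < 1 by rewrite ger0_norm ?invr_ge0// invf_lt1// ltr1n.
  have /cvgrPdist_lt/(_ x x0)[N _ /(_ N (leqnn N))] := cvg_expr h1.
  rewrite sub0r normrN ger0_norm; last by rewrite exprn_ge0// invr_ge0.
  by exists N.
case: (ex_minnP ex) => -[|n] nx nmin.
  by move: nx; rewrite /dy expr0 ltNge x1.
exists n; rewrite nx leNgt; apply/negP => /nmin; by rewrite ltnn.
Qed.

(** [Phi] is dominated by the sum of [c i] times the indicator of [[1 - dy i, 1)], cut at [s]. Whole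
    tails are used instead of disjoint shells because the hypothesis measures tails, and the overlap
    is harmless for an upper bound. *)
Lemma integral_dyadic_le (al s A B : R) (Phi : R -> R) (c : nat -> R) :
  0 <= s < 1 -> 0 <= al -> 0 <= A ->
  (forall x, s <= x < 1 -> mass x <= A * (1 - x) `^ al) ->
  measurable_fun (seg s) (Phi : measurableTypeR R -> R) ->
  (forall t, s <= t < 1 -> 0 <= Phi t) -> (forall i, 0 <= c i) ->
  (forall t i, s <= t < 1 -> dy i.+1 < 1 - t <= dy i -> Phi t <= c i) ->
  (forall N, \sum_(0 <= i < N) c i * dy i `^ al <= B) ->
  (\int[mu]_(t in seg s) (Phi t)%:E <= (A * B)%:E)%E.
Proof.
move=> /andP[s0 s1] al0 A0 mA mPhi Phi0 c0 Phic cB.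
have mD x : measurable (seg x) by exact: measurable_itv.
pose x i : R := Num.max s (1 - dy i).
have xs i : s <= x i < 1 by rewrite le_max lexx/= gt_max s1 ltrBlDr ltrDl dy_gt0.
pose g i (t : measurableTypeR R) : \bar R := ((c i)%:E * (\1_(seg (x i)) t)%:E)%E.
have mg i : measurable_fun (seg s) (g i).
  by apply: measurable_funeM; apply/measurable_EFinP; exact: measurable_indic.
have g0 i t : seg s t -> (0 <= g i t)%E by move=> _; rewrite mule_ge0// lee_fin.
apply: (@le_trans _ _ (\int[mu]_(t in seg s) \sum_(i <oo) g i t)%E).
  apply: ge0_le_integral => //.
  - exact/measurable_EFinP.
  - by apply: ge0_emeasurable_sum => // i t st _; exact: g0.
  - move=> t st; have := st; rewrite /= in_itv/= => st'; have /andP[st1 t1] := st'.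
    have [|i it] := @dyadic_piece (1 - t).
      by rewrite subr_gt0 t1 gerBl (le_trans s0).
    apply: (@le_trans _ _ (g i t)).
      rewrite /g indicE mem_set ?mule1 ?lee_fin ?(Phic t i)//=.
      by rewrite in_itv/= t1 andbT ge_max st1 lerBlDr -lerBlDl; case/andP: it.
    have : (\sum_(0 <= j < i.+1) g j t <= \sum_(j <oo) g j t)%E.
      by apply: nneseries_lim_ge => j _ _; exact: g0.
    apply: le_trans; rewrite big_nat_recr//=; rewrite leeDr// sume_ge0// => j _; exact: g0.
rewrite integral_nneseries//.
apply: lime_le.
  by apply: is_cvg_nneseries => i _ _; apply: integral_ge0 => t; exact: g0.
apply: nearW => N.
apply: (@le_trans _ _ (\sum_(0 <= i < N) (A * (c i * dy i `^ al))%:E)%E).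
  apply: lee_sum => i _; rewrite ge0_integralZl//; [|by apply/measurable_EFinP; exact: measurable_indic|].
  all: try by rewrite lee_fin.
  rewrite integral_indic//.
  have -> : seg (x i) `&` seg s = seg (x i).
    apply/setIidPl => t; rewrite /= !in_itv/= => /andP[+ ->]; rewrite andbT.
    by apply: le_trans; case/andP: (xs i).
  rewrite [X in ((c i)%:E * X)%E](massE (x i)) -EFinM lee_fin mulrCA ler_wpM2l// (le_trans (mA _ (xs i)))// ler_wpM2l//.
  rewrite ge0_ler_powR ?nnegrE ?(ltW (dy_gt0 i))//.
    by rewrite subr_ge0 ltW//; case/andP: (xs i).
  by rewrite lerBlDr -lerBlDl le_max lexx orbT.
by rewrite sumEFin lee_fin -mulr_sumr ler_wpM2l.
Qed.

Lemma dyadic_pow (p : R) i : dy i `^ p = (2^-1 `^ p) ^+ i.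
Proof.
elim: i => [|i IH]; first by rewrite /dy !expr0 powR1.
rewrite /dy [in LHS]exprSr powRM ?exprn_ge0 ?invr_ge0//.
by rewrite [in RHS]exprSr -IH.
Qed.

Lemma measurable_powR_one_sub (p : R) (D : set (measurableTypeR R)) :
  measurable D -> measurable_fun D (fun t : measurableTypeR R => (1 - t) `^ p).
Proof.
move=> mD; apply: (@measurableT_comp _ _ _ _ _ _ (@powR R ^~ p)).
  exact: measurable_powR.
by apply: measurable_funB.
Qed.

Lemma integral_powR_le (al sg : R) : 0 <= sg -> sg < al -> exists K : R, forall s A,
  0 <= s < 1 -> 0 <= A -> (forall x, s <= x < 1 -> mass x <= A * (1 - x) `^ al) ->
  (\int[mu]_(t in seg s) ((1 - t) `^ (- sg))%:E <= (A * K)%:E)%E.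
Proof.
move=> sg0 sal; have al0 : 0 <= al by rewrite ltW// (le_lt_trans sg0).
pose q : R := 2^-1 `^ (al - sg).
have q0 : 0 < q by rewrite powR_gt0// invr_gt0.
have q1 : q < 1.
  rewrite /q -powR_inv1// -powRrM mulN1r powRN invf_lt1 ?powR_gt0//.
  have : 1 `^ (al - sg) < 2 `^ (al - sg) :> R.
    by rewrite gt0_ltr_powR ?nnegrE ?subr_gt0// ltr1n.
  by rewrite powR1.
exists (2 `^ sg * (1 - q)^-1) => s A s01 A0 mA.
apply: (@integral_dyadic_le al s A _ _ (fun i => dy i.+1 `^ (- sg))) => //.
- by apply: measurable_powR_one_sub; exact: measurable_itv.
- by move=> t _; exact: powR_ge0.
- by move=> i; exact: powR_ge0.
- by move=> t i _ /andP[ti _]; apply: powRN_le => //; exact: ltW.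
move=> N; apply: (@le_trans _ _ (2 `^ sg * \sum_(0 <= i < N) q ^+ i)).
  rewrite mulr_sumr; apply: ler_sum => i _.
  rewrite dyS powR_half ?(ltW (dy_gt0 i))// -mulrA -powRD ?(gt_eqF (dy_gt0 i)) ?implybT//.
  by rewrite dyadic_pow addrC.
rewrite ler_wpM2l ?powR_ge0//.
have := @geometric_le_lim R N 1 q ler01 q0; rewrite ger0_norm ?(ltW q0)// => /(_ q1).
rewrite mul1r /series/=; apply: le_trans; rewrite le_eqVlt; apply/orP; left; apply/eqP.
by apply: eq_bigr => k _; rewrite mul1r.
Qed.

Lemma sum_min_inv_le N y : 0 < y ->
  \sum_(0 <= i < N) Num.min (y * 2 ^+ i) (y * 2 ^+ i)^-1 <= 3.
Proof.
(* [g y] dominates [Num.min y y^-1 + g (2 * y)]. *)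
move=> y0; pose g (y : R) : R := if y < 1 then 3 - y else 2 / y.
suff : \sum_(0 <= i < N) Num.min (y * 2 ^+ i) (y * 2 ^+ i)^-1 <= g y.
  move=> /le_trans; apply; rewrite /g; case: ltP => y1; first by rewrite gerBl ltW.
  by rewrite ler_pdivrMr//; lra.
elim: N y y0 => [|N IH] y y0.
  rewrite big_nil /g; case: ltP => y1; first by lra.
  by rewrite divr_ge0// ltW.
rewrite big_nat_recl//= expr0 mulr1.
have y20 : 0 < y * 2 by rewrite mulr_gt0.
have := IH (y * 2) y20; set S1 := \sum_(0 <= i < N) _; set S2 := \sum_(0 <= i < N) _.
have -> : S1 = S2 by apply: eq_bigr => i _; rewrite exprS mulrA.
move=> {IH} h; apply: (le_trans (lerD (lexx _) h)).
have yV : y * y^-1 = 1 by rewrite divff// gt_eqF.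
have V0 : 0 < y^-1 by rewrite invr_gt0.
rewrite /g invfM; case: (ltP (y * 2) 1) => y1; case: (ltP y 1) => y2; try lra.
- have h1 : Num.min y y^-1 <= y by rewrite ge_min lexx.
  lra.
- have h1 : Num.min y y^-1 <= y by rewrite ge_min lexx.
  have h2 : y^-1 * ((2 * y - 1) * (y - 1)) <= 0.
    by rewrite pmulr_rle0// mulr_ge0_le0//; lra.
  have h3 : y^-1 * ((2 * y - 1) * (y - 1)) = 2 * y - 3 + y^-1 by field; rewrite gt_eqF.
  lra.
- have h1 : Num.min y y^-1 <= y^-1 by rewrite ge_min lexx orbT.
  lra.
Qed.


(** Dominates the absolute imaginary part of [1 / (1 - t z)], from which it differs by the factor
    [t <= 1]. *)
Definition imker (z : C) t : R := `|complex.Im z| / cabs (1 - rc t * z) ^+ 2.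

Lemma cabs_one_sub_ge t (z : C) : 0 <= t < 1 -> disc z -> 1 - t <= cabs (1 - rc t * z).
Proof.
move=> /andP[t0 t1] zD; apply: le_trans (cabs_dist _ _).
rewrite cabs1 cabsM cabs_rc ger0_norm// lerD2l lerN2.
by rewrite ler_piMr// ltW.
Qed.

(** For [t <= 1/2] the modulus is at least 1/2 and [|Im z| < 1]; for [t > 1/2] the imaginary part
    alone has size [t |Im z|]. *)
Lemma cabs_one_sub_ge_Im t (z : C) : 0 <= t < 1 -> disc z ->
  `|complex.Im z| / 2 <= cabs (1 - rc t * z).
Proof.
move=> t01 zD; have /andP[t0 t1] := t01.
have [t2|t2] := leP t 2^-1.
  apply: le_trans (cabs_one_sub_ge t01 zD).
  have : `|complex.Im z| < 1 by exact: le_lt_trans (Im_le_cabs z) zD.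
  lra.
apply: le_trans (Im_le_cabs _); rewrite cImD cImN Im_rcM sub0r normrN normrM (ger0_norm t0).
by rewrite mulrC ler_wpM2r// ltW.
Qed.

Lemma cabs_one_sub_gt0 t (z : C) : 0 <= t < 1 -> disc z -> 0 < cabs (1 - rc t * z).
Proof.
move=> t01 zD; apply: lt_le_trans (cabs_one_sub_ge t01 zD).
by rewrite subr_gt0; case/andP: t01.
Qed.

Lemma imker_ge0 z t : 0 <= imker z t.
Proof. by rewrite divr_ge0// sqr_ge0. Qed.

(** [Im z != 0] makes the denominator nonzero for every real [t], so the kernel is continuous on the
    whole line. *)
Lemma measurable_imker z (D : set (measurableTypeR R)) : disc z -> complex.Im z != 0 ->
  measurable D -> measurable_fun D (imker z : measurableTypeR R -> R).
Proof.
move=> zD z0 mD; apply: measurable_funS (measurableT) _ _ => //.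
apply: continuous_measurable_fun => t; rewrite /imker.
apply: cvgM; first exact: cvg_cst.
have e u : cabs (1 - rc u * z) ^+ 2 = (1 - u * complex.Re z) ^+ 2 + (u * complex.Im z) ^+ 2.
  by rewrite cabs_sqr cReD cImD cReN cImN Re_rcM Im_rcM/= sub0r sqrrN.
apply: cvgV.
  rewrite e paddr_eq0 ?sqr_ge0// !sqrf_eq0; apply/negP => /andP[+ /eqP].
  move=> /[swap] /eqP; rewrite mulf_eq0 (negbTE z0) orbF => /eqP ->.
  by rewrite mul0r subr0 oner_eq0.
under eq_fun do rewrite e; rewrite e.
have uc (k : R) : (fun u : R => u * k) @ t --> t * k by apply: cvgM; [exact: cvg_id|exact: cvg_cst].
rewrite !expr2; under eq_fun do rewrite !expr2.
apply: cvgD; apply: cvgM; try exact: uc; apply: cvgB; try exact: cvg_cst; exact: uc.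
Qed.

(** Up to constants, on the shell where [1 - t] is about [d] the weight times the mass is
    [d^(1 - al) d^al = d], and the kernel is at most [y min (d^-2, y^-2)] with [y = |Im z|]. The
    products are of order [min (y / d, d / y)]: a two-sided geometric series, bounded uniformly in
    [z] by [sum_min_inv_le]. *)
Lemma integral_imker_le (al : R) : 1 < al -> exists K : R, 0 <= K /\ forall s A (z : C),
  0 <= s < 1 -> 0 <= A -> (forall x, s <= x < 1 -> mass x <= A * (1 - x) `^ al) -> disc z ->
  (\int[mu]_(t in seg s) ((1 - t) `^ (1 - al) * imker z t)%:E <= (A * K)%:E)%E.
Proof.
move=> al1; have a1 : 0 < al - 1 by rewrite subr_gt0.
exists (3 * (2 `^ (al - 1) * 4)); split; first by rewrite !mulr_ge0// powR_ge0.
move=> s A z s01 A0 mA zD; have /andP[s0 s1] := s01.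
have [z0|z0] := eqVneq (complex.Im z) 0.
  rewrite integral0_eq ?lee_fin ?mulr_ge0// ?powR_ge0// => t _.
  by rewrite /imker z0 normr0 mul0r mulr0.
have y0 : 0 < `|complex.Im z| by rewrite normr_gt0.
set y := `|complex.Im z| in y0.
have mD : measurable (seg s) by exact: measurable_itv.
apply: (@integral_dyadic_le al s A _ _
    (fun i => dy i.+1 `^ (- (al - 1)) * (y * Num.min (dy i.+1 ^- 2) (4 * y ^- 2)))) => //.
- exact: (le_trans ler01 (ltW al1)).
- by apply: measurable_funM; [exact: measurable_powR_one_sub|exact: measurable_imker].
- by move=> t _; rewrite mulr_ge0 ?powR_ge0 ?imker_ge0.
- move=> i; rewrite mulr_ge0 ?powR_ge0// mulr_ge0 ?(ltW y0)// le_min invr_ge0 sqr_ge0/=.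
  by rewrite mulr_ge0// invr_ge0 sqr_ge0.
- move=> t i /andP[st t1] /andP[ti _].
  have t01 : 0 <= t < 1 by rewrite (le_trans s0 st).
  have c0 := cabs_one_sub_gt0 t01 zD.
  apply: ler_pM; rewrite ?powR_ge0 ?imker_ge0//.
    by rewrite -(opprB al 1); apply: powRN_le => //; [exact: ltW|exact: ltW].
  rewrite /imker -/y ler_wpM2l ?(ltW y0)// le_min; apply/andP; split.
    rewrite lef_pV2 ?posrE ?exprn_gt0// lerXn2r ?nnegrE ?(ltW c0) ?(ltW (dy_gt0 _))//.
    by rewrite (le_trans (ltW ti)) ?cabs_one_sub_ge.
  have -> : 4 * y ^- 2 = ((y / 2) ^+ 2)^-1 by field; rewrite gt_eqF.
  rewrite lef_pV2 ?posrE ?exprn_gt0 ?divr_gt0// lerXn2r ?nnegrE ?(ltW c0) ?divr_ge0 ?(ltW y0)//.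
  exact: cabs_one_sub_ge_Im.
move=> N; apply: (@le_trans _ _ (2 `^ (al - 1) * 4 *
    \sum_(0 <= i < N) Num.min (y * 2 ^+ i) (y * 2 ^+ i)^-1)); last first.
  by rewrite mulrC ler_wpM2r ?sum_min_inv_le// mulr_ge0// powR_ge0.
rewrite mulr_sumr; apply: ler_sum => i _.
have di := dy_gt0 i; have d0 : dy i != 0 by rewrite gt_eqF.
have e1 : dy i.+1 `^ (- (al - 1)) * dy i `^ al = 2 `^ (al - 1) * dy i.
  rewrite dyS powR_half ?(ltW di)// -mulrA -powRD ?d0 ?implybT//.
  by rewrite (_ : - (al - 1) + al = 1) ?powRr1 ?(ltW di)//; ring.
have key : dy i * (y * Num.min (dy i.+1 ^- 2) (4 * y ^- 2)) =
    4 * Num.min (y * 2 ^+ i) (y * 2 ^+ i)^-1.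
  have -> : 2 ^+ i = (dy i)^-1 :> R by rewrite /dy exprVn invrK.
  rewrite dyS mulrA !minr_pMr ?mulr_ge0 ?(ltW di) ?(ltW y0)//.
  by congr Num.min; field; rewrite d0 ?gt_eqF.
by rewrite mulrAC e1 -(mulrA _ (dy i)) key mulrA.
Qed.

End CarlesonIntegrals.

(** * BMOA *)

Section Bmoa.
Context {R : realType}.
Local Notation C := (Cpx R).
Local Notation rc := (real_complex R).
Local Notation leb := (@lebesgue_measure R).
Local Notation J := (`[0%R, (2 * pi)%R]%classic : set (measurableTypeR R)).
Implicit Types (z w a : C) (F G : C -> C) (r s t : R).

Lemma cabs_sqr_Re z : cabs z ^+ 2 = complex.Re (z * conjc z).
Proof. by case: z => x y; rewrite cabs_sqr/= mulrN opprK !expr2. Qed.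

Lemma continuous_cabs_sqr (h : R -> C) : ccont h -> continuous (fun t => cabs (h t) ^+ 2).
Proof.
move=> hc; have /ccont_ReIm[+ _] := ccontM hc (ccont_conj hc).
have -> : (fun t => cabs (h t) ^+ 2) = (fun t => complex.Re (h t * conjc (h t))).
  by apply/funext => t; exact: cabs_sqr_Re.
by apply.
Qed.

Definition msq F r : R := \int[leb]_(t in J) (cabs (F (polar r t)) ^+ 2).

Lemma integral_msq F F' r : hol F F' -> 0 <= r < 1 ->
  (\int[leb]_(t in J) (cabs (F (polar r t)) ^+ 2)%:E = (msq F r)%:E)%E.
Proof.
move=> hF r01; rewrite /msq /Rintegral fineK//.
apply: integrable_fin_num => //.
exact: (continuousR_integrable (continuous_cabs_sqr (hol_polar hF r01))).
Qed.

Lemma hardy2_normP F F' (B : R) : hol F F' -> 0 <= B ->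
  (hardy2_norm F <= B%:E)%E <-> forall r, 0 <= r < 1 -> msq F r <= 2 * pi * B ^+ 2.
Proof.
move=> hF B0; have c0 : 0 < 2 * pi :> R by rewrite mulr_gt0// pi_gt0.
rewrite /hardy2_norm; set E := ereal_sup _.
have EB : (E <= (B ^+ 2)%:E)%E <-> forall r, 0 <= r < 1 -> msq F r <= 2 * pi * B ^+ 2.
  split=> [EB r r01|H].
    have : ((2 * pi)^-1%:E * (msq F r)%:E <= E)%E.
      by apply: ereal_sup_ubound; exists r; rewrite /= ?in_itv//= (integral_msq hF r01).
    by move=> /le_trans/(_ EB); rewrite -EFinM lee_fin ler_pdivrMl.
  apply: ge_ereal_sup => _ [r r01 <-]; move: r01; rewrite /= in_itv/= => r01.
  by rewrite (integral_msq hF r01) -EFinM lee_fin ler_pdivrMl// H.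
have E0 : (0 <= E)%E.
  apply: (@le_trans _ _ ((2 * pi)^-1%:E * (msq F 0)%:E)%E).
    rewrite -EFinM lee_fin mulr_ge0 ?invr_ge0 ?(ltW c0)//.
    by apply: Rintegral_ge0 => t _; exact: sqr_ge0.
  apply: ereal_sup_ubound; exists 0; rewrite /= ?in_itv/= ?lexx ?ltr01//.
  by rewrite (integral_msq hF)// lexx ltr01.
have h0 : 0 < 2^-1 :> R by rewrite invr_gt0.
have BE : poweR (B ^+ 2)%:E 2^-1 = B%:E.
  by rewrite poweR_EFin powR12_sqrt ?sqr_ge0// sqrtr_sqr ger0_norm.
rewrite -EB; split => [h|h]; last first.
  rewrite -BE; apply: (gt0_ler_poweR (ltW h0)) => //.
  - by rewrite in_itv/= E0 leey.
  - by rewrite in_itv/= lee_fin sqr_ge0 leey.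
have := h.
have -> : (B ^+ 2)%:E = poweR B%:E 2%:R by rewrite poweR_EFin powR_mulrn.
have -> : E = poweR (poweR E 2^-1) 2%:R.
  by rewrite -poweRrM ?mulVf ?poweRe1//.
move=> h'; apply: gt0_ler_poweR => //.
- by rewrite in_itv/= poweR_ge0 leey.
- by rewrite in_itv/= lee_fin B0 leey.
Qed.

Lemma disc_one_sub_neq0 a z : disc a -> disc z -> 1 - conjc a * z != 0 :> C.
Proof.
rewrite /disc/= => aD zD; rewrite -cabs_gt0; apply: lt_le_trans (cabs_dist _ _).
rewrite cabs1 cabsM cabs_conjc subr_gt0.
have a0 := cabs_ge0 a; have z0 := cabs_ge0 z; nra.
Qed.

Lemma mobius_disc a z : disc a -> disc z -> disc (mobius a z).
Proof.
move=> aD zD; have d0 := disc_one_sub_neq0 aD zD.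
rewrite /disc/= /mobius cabsM cabsV ltr_pdivrMr ?cabs_gt0// mul1r.
rewrite -(@ltr_pXn2r _ 2)// ?nnegrE ?cabs_ge0// -subr_gt0.
have -> : cabs (1 - conjc a * z) ^+ 2 - cabs (a - z) ^+ 2 =
    (1 - cabs a ^+ 2) * (1 - cabs z ^+ 2).
  by case: (a) => a1 a2; case: (z) => z1 z2; rewrite !cabs_sqr/=; ring.
by rewrite mulr_gt0// subr_gt0 expr_lt1 ?cabs_ge0.
Qed.

Lemma mobius0 a : mobius a 0 = a.
Proof. by rewrite /mobius mulr0 !subr0 divr1. Qed.

(** Up to sign, the derivative at 0 is the weight of the Bloch seminorm at [a], which is what links
    [bmoa_norm] to [bloch_norm]. *)
Lemma hol_mobius a : disc a -> exists m : C -> C, hol (mobius a) m /\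
  m 0 = - rc (1 - cabs a ^+ 2).
Proof.
move=> aD.
have h1 := holB (hol_cst a) (@hol_id R).
have h2 := holB (hol_cst 1) (holM (hol_cst (conjc a)) (@hol_id R)).
have h3 := holM h1 (holV (fun z zD => disc_one_sub_neq0 aD zD) h2).
eexists; split; first exact: h3.
have -> : rc (1 - cabs a ^+ 2) = 1 - a * conjc a :> C.
  by rewrite rcB rmorph1 -sqr_normc cabsE -rcX.
rewrite /= (_ : 1 - conjc a * 0 = 1 :> C) ?mulr0 ?subr0// invr1.
ring.
Qed.

(* Since [F 0 = 0], [F ^ 2] has mean value 0 on circles, so that the real and
   imaginary parts of [F] have the same mean square. *)
Lemma msq_Im_bound F F' r (K : R) : hol F F' -> F 0 = 0 -> 0 <= r < 1 ->
  (forall z, disc z -> `|complex.Im (F z)| <= K) -> msq F r <= 2 * pi * (2 * K ^+ 2).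
Proof.
move=> hF F0 r01 FK; have c0 : 0 < 2 * pi :> R by rewrite mulr_gt0// pi_gt0.
have [r0|r0] := eqVneq r 0.
  rewrite /msq r0; have -> : (fun t => cabs (F (polar 0 t)) ^+ 2) = (fun=> 0).
    apply/funext => t; have -> : polar 0 t = 0 by rewrite /polar !mul0r.
    by rewrite F0 cabs0 expr0n.
  by rewrite Rintegral_cst// mul0r mulr_ge0 ?(ltW c0)// mulr_ge0 ?sqr_ge0.
have r01' : 0 < r < 1 by rewrite lt_def r0; case/andP: r01 => ->.
have hc := hol_polar hF r01; have h2c := ccontM hc hc.
have := mean_value (holM hF hF) r01'; rewrite F0 mulr0 mulr0.
move=> /(congr1 (@complex.Re R)) /= h2.
have /ccont_ReIm[rec imc] := hc; have /ccont_ReIm[re2c _] := h2c.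
have i2c : continuous (fun t => 2 * complex.Im (F (polar r t)) ^+ 2).
  move=> t; apply: cvgM; first exact: cvg_cst.
  by rewrite expr2; under eq_fun do rewrite expr2; apply: cvgM; exact: imc.
have -> : msq F r = \int[leb]_(t in J) (2 * complex.Im (F (polar r t)) ^+ 2).
  rewrite -[RHS]add0r -[X in X + _]h2 -RintegralD//; [|exact: continuousR_integrable..].
  apply: eq_Rintegral => t _; rewrite cabs_sqr cReM; ring.
rewrite (le_trans (ler_norm _))// Rint_bound// => t _.
rewrite ger0_norm; last by rewrite mulr_ge0// sqr_ge0.
rewrite ler_wpM2l//.
rewrite -[leLHS]real_normK ?num_real// lerXn2r ?nnegrE//.
  by apply: le_trans (FK (polar r t) _); rewrite ?normr_ge0//; exact: polar_disc.
by apply: FK; exact: polar_disc.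
Qed.

Lemma hol_mobius_sub F F' a : hol F F' -> disc a -> exists G',
  hol (fun z => F (mobius a z) - F a) G' /\ G' 0 = - (F' a * rc (1 - cabs a ^+ 2)).
Proof.
move=> hF aD; have [m [hm m0]] := hol_mobius aD.
have h := holB (hol_comp (fun z => mobius_disc aD) hm hF) (hol_cst (F a)).
eexists; split; first exact: h.
by rewrite /= mobius0 m0 subr0 mulrN.
Qed.

(** [F1] and [F2] are meant to be the transforms of two real densities. For the constant 6:
    subtracting the value at [a] doubles [K], [msq_Im_bound] gives mean squares [8 K^2], and
    [|x + i y|^2 <= 2 |x|^2 + 2 |y|^2] leads to [32 K^2 <= (6 K)^2]. *)
Lemma bmoa_norm_le F F1 F2 F1' F2' (K : R) : hol F1 F1' -> hol F2 F2' -> 0 <= K ->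
  (forall z, disc z -> F z = F1 z + iC * F2 z) ->
  (forall z, disc z -> `|complex.Im (F1 z)| <= K) ->
  (forall z, disc z -> `|complex.Im (F2 z)| <= K) ->
  (bmoa_norm F <= (cabs (F 0) + 6 * K)%:E)%E.
Proof.
move=> h1 h2 K0 FE F1K F2K; rewrite /bmoa_norm EFinD leeD2l//.
have hF : hol F (fun z => F1' z + iC * F2' z).
  apply: (@hol_ext _ (fun z => F1 z + iC * F2 z)) => [z zD|]; first by rewrite FE.
  have := holD h1 (holM (hol_cst iC) h2).
  have -> : (fun z => F1' z + (0 * F2 z + iC * F2' z)) = (fun z => F1' z + iC * F2' z).
    by apply/funext => z; rewrite mul0r add0r.
  by apply.
apply: ge_ereal_sup => _ [a aD <-].
have [G [hG _]] := hol_mobius_sub hF aD.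
have [G1 [hG1 _]] := hol_mobius_sub h1 aD.
have [G2 [hG2 _]] := hol_mobius_sub h2 aD.
have c0 : 0 < 2 * pi :> R by rewrite mulr_gt0// pi_gt0.
apply/(hardy2_normP hG); first by rewrite mulr_ge0.
move=> r r01.
have Hk F0 F0' : hol F0 F0' -> (forall z, disc z -> `|complex.Im (F0 z)| <= K) ->
    msq (fun z => F0 (mobius a z) - F0 a) r <= 2 * pi * (2 * (2 * K) ^+ 2).
  move=> h0 F0K; have [G0 [hG0 _]] := hol_mobius_sub h0 aD.
  apply: (msq_Im_bound hG0) => //; first by rewrite mobius0 subrr.
  move=> z zD; rewrite cImD cImN (le_trans (ler_normB _ _))//.
  by rewrite mulr_natl mulr2n lerD//; apply: F0K => //; exact: mobius_disc.
have m1 := Hk F1 F1' h1 F1K; have m2 := Hk F2 F2' h2 F2K.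
have c1 := continuous_cabs_sqr (hol_polar hG1 r01).
have c2 := continuous_cabs_sqr (hol_polar hG2 r01).
have c := continuous_cabs_sqr (hol_polar hG r01).
have i12 : leb.-integrable J (EFin \o (fun t => cabs (F1 (mobius a (polar r t)) - F1 a) ^+ 2 +
    cabs (F2 (mobius a (polar r t)) - F2 a) ^+ 2)).
  by apply: continuousR_integrable => t; apply: cvgD; [exact: c1|exact: c2].
apply: (@le_trans _ _ (2 * (msq (fun z => F1 (mobius a z) - F1 a) r +
    msq (fun z => F2 (mobius a z) - F2 a) r))).
  rewrite /msq -RintegralD//; [|exact: continuousR_integrable..].
  rewrite -RintegralZl//; apply: le_Rintegral => //.
  - exact: continuousR_integrable.
  - by apply: continuousR_integrable => t; apply: cvgM; [exact: cvg_cst|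
      apply: cvgD; [exact: c1|exact: c2]].
  move=> t _; have pD := polar_disc t r01; have mD := mobius_disc aD pD.
  rewrite (FE _ mD) (FE _ aD).
  set x := F1 _; set y := F2 _; set x' := F1 a; set y' := F2 a.
  have -> : x + iC * y - (x' + iC * y') = (x - x') + iC * (y - y') by ring.
  move: (x - x') (y - y') => {x y x' y'} [x1 x2] [y1 y2].
  rewrite !cabs_sqr/=; have := sqr_ge0 (x1 + y2); have := sqr_ge0 (x2 - y1); nra.
have -> : 2 * pi * (6 * K) ^+ 2 = 2 * (2 * pi * (2 * (2 * K) ^+ 2) + 2 * pi * (2 * (2 * K) ^+ 2))
  + 2 * pi * (4 * K ^+ 2) by ring.
have : 0 <= 2 * pi * (4 * K ^+ 2) by rewrite !mulr_ge0 ?sqr_ge0// pi_ge0.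
move: m1 m2; lra.
Qed.

Lemma bloch_le_bmoa F (B : R) : analytic_on_disc F -> (bmoa_norm F <= B%:E)%E ->
  (bloch_norm 1 F <= B%:E)%E.
Proof.
move=> aF FB; have hF := analytic_hol aF.
have lb a : disc a -> (hardy2_norm (fun z => (F (mobius a z) - F a)%R) <= (B - cabs (F 0))%:E)%E.
  move=> aD; rewrite EFinB leeBrDl//; apply: le_trans FB; rewrite leeD2l//.
  by apply: ereal_sup_ubound; exists a.
apply/bloch_normP; exists (B - cabs (F 0)); split; first by rewrite addrC subrK.
move=> a aD; have a1 : 0 < 1 - cabs a ^+ 2 by rewrite subr_gt0 expr_lt1 ?cabs_ge0.
rewrite powRr1 ?(ltW a1)//.
have [G [hG G0]] := hol_mobius_sub hF aD.
have B0 : 0 <= B - cabs (F 0).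
  rewrite -lee_fin; apply: le_trans (lb a aD); exact: poweR_ge0.
have /(hardy2_normP hG B0) H := lb a aD.
have [b gb Gb] := hol_psum hG.
have b1 : cabs (b 1%N) = cabs (derive1 F a) * (1 - cabs a ^+ 2).
  have D0 : disc (0 : C) by rewrite /disc/= cabs0.
  have := (hG 0 D0).1; rewrite G0 => d1.
  have hb := hol_ext Gb (hG).
  have := cderiv_unique (hb 0 D0).1 (psum_deriv gb D0); rewrite G0 => e.
  have e0 : psum (dcoef b) 0 = b 1%N.
    apply: psum_eq; apply/cvgCP => e' e'0; exists 1%N => // -[//|n] _ /=.
    rewrite /series/= big_nat_recl//= big1 => [|i _]; last by rewrite exprS mul0r mulr0.
    by rewrite addr0 expr0 mulr1 /dcoef mul1r subrr cabs0.
  by rewrite -e0 -e cabsN cabsM cabs_rc (gtr0_norm a1).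
rewrite -b1; apply/ler_addgt0Pr => e e0.
have c0 : 0 < 2 * pi :> R by rewrite mulr_gt0// pi_gt0.
(* Bessel with the terms of index 0 and 1, the first being dropped. *)
have key r : 0 < r < 1 -> cabs (b 1%N) * r <= B - cabs (F 0).
  move=> r01; have /andP[r0 r1] := r01.
  have r01' : 0 <= r < 1 by rewrite (ltW r0).
  have := le_trans (Bessel 2 gb r01) _; move=> /(_ (2 * pi * (B - cabs (F 0)) ^+ 2)).
  have -> : \int[leb]_(t in J) cabs (psum b (polar r t)) ^+ 2 =
      msq (fun z => F (mobius a z) - F a) r.
    by apply: eq_Rintegral => t _; rewrite -Gb//; exact: polar_disc.
  move=> /(_ (H r r01')); rewrite ler_pM2l// big_nat_recl// big_nat1 => h.
  rewrite -(@ler_pXn2r _ 2)// ?nnegrE ?mulr_ge0 ?cabs_ge0 ?(ltW r0)// exprMn.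
  by apply: le_trans h; rewrite muln1 lerDr mulr_ge0 ?sqr_ge0// exprn_ge0// ltW.
have [b0|b0] := eqVneq (cabs (b 1%N)) 0; first by rewrite b0 addr_ge0// ltW.
have bp : 0 < cabs (b 1%N) by rewrite lt_def b0 cabs_ge0.
(* Close enough to 1 that [cabs (b 1) * r >= cabs (b 1) - e]; the floor 1/2 keeps it positive. *)
pose r := Num.max (2^-1) (1 - e / cabs (b 1%N)).
have r01 : 0 < r < 1.
  rewrite lt_max invr_gt0 ltr0n/= gt_max; apply/andP; split; first by lra.
  by rewrite gtrBl divr_gt0.
rewrite -lerBlDr; apply: le_trans (key r r01).
rewrite -{1}[cabs (b 1%N)]mulr1 -[e](divfK b0) [_ / _ * _]mulrC -mulrBr ler_wpM2l ?cabs_ge0//.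
by rewrite le_max lexx orbT.
Qed.

End Bmoa.

(** * The Hankel operator as a Cauchy transform *)

Section CauchyTransform.
Context {R : realType}.
Variable mu : {finite_measure set (measurableTypeR R) -> \bar R}.
Local Notation C := (Cpx R).
Local Notation rc := (real_complex R).
Local Notation seg s := ([set` `[s%R, 1%R[%R] : set (measurableTypeR R)).
Local Notation D := (seg 0).
Implicit Types (z w : C) (F : C -> C) (s t : R) (u f g : R -> R) (n N k : nat).

Let mD : measurable D.
Proof. exact: measurable_itv. Qed.

Lemma D01 t : D t -> 0 <= t < 1.
Proof. by rewrite /= in_itv. Qed.

Lemma dominated_Rcvg (f_ : nat -> R -> R) f g :
  (forall n, measurable_fun D (f_ n : measurableTypeR R -> R)) ->
  (forall t, D t -> (fun n => f_ n t) @ \oo --> f t) ->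
  mu.-integrable D (EFin \o g) -> (forall n t, D t -> `|f_ n t| <= g t) ->
  mu.-integrable D (EFin \o f) /\
  (fun n => \int[mu]_(t in D) f_ n t) @ \oo --> \int[mu]_(t in D) f t.
Proof.
move=> mf_ ff ig fg.
have mf : measurable_fun D (f : measurableTypeR R -> R) by exact: measurable_fun_cvg mf_ ff.
have h1 n : measurable_fun D (EFin \o f_ n : measurableTypeR R -> \bar R) by exact/measurable_EFinP.
have h2 : measurable_fun D (EFin \o f : measurableTypeR R -> \bar R) by exact/measurable_EFinP.
have h3 : {ae mu, forall t, D t -> (fun n => (f_ n t)%:E) @ \oo --> (f t)%:E}.
  apply: aeW => t Dt; apply: cvg_EFin; first exact: nearW.
  exact: ff.
have h4 : {ae mu, forall t n, D t -> (`|(f_ n t)%:E| <= (g t)%:E)%E}.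
  by apply: aeW => t n Dt; rewrite /= lee_fin fg.
have [i1 _ i3] := dominated_convergence mD h1 h2 h3 ig h4.
split => //; have fin : (\int[mu]_(x in D) (EFin \o f) x)%E \is a fin_num.
  exact: integrable_fin_num.
move: i3; rewrite -(fineK fin) => /fine_cvg; apply: cvg_trans.
exact: cvg_refl.
Qed.

Lemma measurable_exprn n : measurable_fun D (fun t : measurableTypeR R => t ^+ n).
Proof. exact: measurable_funX. Qed.

Lemma integrable_exprM u n : mu.-integrable D (EFin \o u) ->
  mu.-integrable D (EFin \o (fun t => t ^+ n * u t)).
Proof.
move=> iu; have mu_ : measurable_fun D (u : measurableTypeR R -> R).
  by apply/measurable_EFinP; exact: measurable_int iu.
apply: le_integrable iu => //.
  by apply/measurable_EFinP; apply: measurable_funM => //; exact: measurable_exprn.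
move=> t /D01/andP[t0 t1]; rewrite /= lee_fin normrM ler_piMl//.
by rewrite ger0_norm ?exprn_ge0// exprn_ile1// ltW.
Qed.

Lemma integrable_exprn n : mu.-integrable D (EFin \o (fun t : R => t ^+ n)).
Proof.
have i1 : mu.-integrable D (EFin \o (cst 1 : R -> R)).
  exact: finite_measure_integrable_cst.
have := integrable_exprM n i1.
by have -> : (fun t : R => t ^+ n * cst 1 t) = (fun t => t ^+ n);
  [apply/funext => t; rewrite mulr1|].
Qed.

Lemma moment_ge0 n : 0 <= moment mu n.
Proof. by apply: Rintegral_ge0 => t /D01/andP[t0 _]; exact: exprn_ge0. Qed.

Lemma Rintegral_sum (m : nat) (h : nat -> R -> R) :
  (forall i, mu.-integrable D (EFin \o h i)) ->
  mu.-integrable D (EFin \o (fun t => \sum_(0 <= i < m) h i t)) /\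
  \int[mu]_(t in D) (\sum_(0 <= i < m) h i t) = \sum_(0 <= i < m) \int[mu]_(t in D) h i t.
Proof.
move=> hi; elim: m => [|m [IH1 IH2]].
  have -> : (fun t => \sum_(0 <= i < 0) h i t) = cst 0 by apply/funext => t; rewrite big_nil.
  split; first exact: finite_measure_integrable_cst.
  by rewrite Rintegral_cst// mul0r big_nil.
have -> : (fun t => \sum_(0 <= i < m.+1) h i t) = (fun t => \sum_(0 <= i < m) h i t + h m t).
  by apply/funext => t; rewrite big_nat_recr.
rewrite big_nat_recr//= -IH2 RintegralD//; split => //.
exact: (@integrableD _ _ _ mu D mD _ _ IH1 (hi m)).
Qed.

(** Taylor coefficient of the integral of [u(t) / (1 - t z)]. The transform is only ever handled as
    the power series with these coefficients. *)
Definition mcoef u n : R := \int[mu]_(t in D) (t ^+ n * u t).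

Lemma mcoef_bound u n : mu.-integrable D (EFin \o u) ->
  `|mcoef u n| <= \int[mu]_(t in D) `|u t|.
Proof.
move=> iu; have iun := integrable_exprM n iu.
rewrite (le_trans (le_normr_Rintegral mD iun))//; apply: le_Rintegral => //.
- exact: integrable_norm.
- exact: integrable_norm.
move=> t /D01/andP[t0 t1]; rewrite normrM ler_piMl//.
by rewrite ger0_norm ?exprn_ge0// exprn_ile1// ltW.
Qed.

Lemma mcoef_geo u : mu.-integrable D (EFin \o u) -> geo (fun n => rc (mcoef u n) : C).
Proof.
by move=> iu; apply: bounded_geo => n; rewrite cabs_rc; exact: mcoef_bound.
Qed.

Lemma measurable_imkerT z : disc z -> measurable_fun D (imker z : measurableTypeR R -> R).
Proof.
move=> zD; have [z0|z0] := eqVneq (complex.Im z) 0; last exact: measurable_imker.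
have -> : imker z = cst 0 by apply/funext => t; rewrite /imker z0 normr0 mul0r.
exact: measurable_cst.
Qed.

(** The sum is [1 / (1 - t z)] minus a remainder: the first gives the kernel, the second is small
    for large [N], uniformly in [t]. *)
Lemma Im_geometric_le z t N : disc z -> 0 <= t < 1 ->
  `|complex.Im (\sum_(0 <= n < N) (rc t * z) ^+ n)| <=
  imker z t + cabs z ^+ N / (1 - cabs z).
Proof.
move=> zD t01; have c0 := cabs_one_sub_gt0 t01 zD; have /andP[t0 t1] := t01.
have x0 : 1 - rc t * z != 0 by rewrite -cabs_gt0.
have z1 : 0 < 1 - cabs z by rewrite subr_gt0.
have -> : \sum_(0 <= n < N) (rc t * z) ^+ n =
    (1 - rc t * z)^-1 - (rc t * z) ^+ N / (1 - rc t * z).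
  apply: (mulfI x0); rewrite mulrBr divff// mulrCA divff// mulr1.
  elim: N => [|N IH]; first by rewrite big_nil mulr0 expr0 subrr.
  by rewrite big_nat_recr//= mulrDr IH exprS; ring.
rewrite cImD cImN (le_trans (ler_normB _ _))// lerD//.
  have -> : complex.Im (1 - rc t * z)^-1 = t * complex.Im z / cabs (1 - rc t * z) ^+ 2.
    have wE : t * complex.Im z = - complex.Im (1 - rc t * z).
      by rewrite cImD cImN Im_rcM sub0r opprK.
    by rewrite wE cabs_sqr; case: (1 - rc t * z) => a b /=; rewrite mulNr.
  rewrite !normrM (ger0_norm t0) [X in _ * X](ger0_norm _) ?invr_ge0 ?sqr_ge0//.
  by rewrite /imker ler_wpM2r ?invr_ge0 ?sqr_ge0// ler_piMl// ltW.
rewrite (le_trans (Im_le_cabs _))// cabsM cabsV cabsX cabsM cabs_rc (ger0_norm t0).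
apply: ler_pM; rewrite ?exprn_ge0 ?invr_ge0 ?mulr_ge0 ?cabs_ge0//.
  by rewrite lerXn2r ?nnegrE ?mulr_ge0 ?cabs_ge0// ler_piMl ?cabs_ge0// ltW.
rewrite lef_pV2 ?posrE//; apply: le_trans (cabs_dist _ _).
by rewrite cabs1 cabsM cabs_rc (ger0_norm t0) lerD2l lerN2 ler_piMl ?cabs_ge0// ltW.
Qed.

(** Partial sums of the series are integrals of [u] against geometric sums. [Im_geometric_le] bounds
    them up to a vanishing error, and the limit in [N] is taken last, so the transform never has to
    be written as an integral. *)
Lemma Im_psum_mcoef_le u z (K : R) : mu.-integrable D (EFin \o u) -> disc z ->
  (\int[mu]_(t in D) (`|u t| * imker z t)%:E <= K%:E)%E ->
  `|complex.Im (psum (fun n => rc (mcoef u n)) z)| <= K.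
Proof.
move=> iu zD uK; have gu := mcoef_geo iu; have z1 : 0 < 1 - cabs z by rewrite subr_gt0.
have mu_ : measurable_fun D (u : measurableTypeR R -> R).
  by apply/measurable_EFinP; exact: measurable_int iu.
pose B := \int[mu]_(t in D) `|u t|.
have B0 : 0 <= B by apply: Rintegral_ge0 => t _.
have part N : `|complex.Im (series (fun n => rc (mcoef u n) * z ^+ n) N)| <=
    K + cabs z ^+ N / (1 - cabs z) * B.
  pose p t := complex.Im (\sum_(0 <= n < N) (rc t * z) ^+ n).
  have ih n : mu.-integrable D (EFin \o (fun t => complex.Im (z ^+ n) * (t ^+ n * u t))).
    exact: (@integrableZl _ _ _ mu D mD (complex.Im (z ^+ n)) _ (integrable_exprM n iu)).
  have [i1 i2] := Rintegral_sum N ih.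
  have pE t : \sum_(0 <= n < N) complex.Im (z ^+ n) * (t ^+ n * u t) = u t * p t.
    rewrite /p Im_sum mulr_sumr; apply: eq_bigr => n _.
    by rewrite exprMn -rcX Im_rcM; ring.
  have -> : complex.Im (series (fun n => rc (mcoef u n) * z ^+ n) N) =
      \int[mu]_(t in D) (u t * p t).
    transitivity (\int[mu]_(t in D) \sum_(0 <= n < N) complex.Im (z ^+ n) * (t ^+ n * u t));
      last by apply: eq_Rintegral => t _; rewrite pE.
    rewrite i2 /series/= Im_sum; apply: eq_bigr => n _.
    rewrite Im_rcM RintegralZl//; first by rewrite mulrC.
    exact: integrable_exprM.
  have iup : mu.-integrable D (EFin \o (fun t => u t * p t)).
    by move: i1; congr (_.-integrable _ (_ \o _)); apply/funext => t; rewrite pE.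
  rewrite (le_trans (le_normr_Rintegral mD iup))//.
  have c0 : 0 <= cabs z ^+ N / (1 - cabs z).
    by rewrite divr_ge0 ?exprn_ge0 ?cabs_ge0// ltW.
  have m1 : measurable_fun D (fun t : measurableTypeR R => `|u t| * imker z t).
    by apply: measurable_funM; [exact: measurableT_comp|exact: measurable_imkerT].
  have i0 := integrable_norm iup.
  rewrite -lee_fin /Rintegral fineK; last exact: integrable_fin_num.
  apply: (@le_trans _ _ (\int[mu]_(t in D) ((`|u t| * imker z t)%:E +
      (cabs z ^+ N / (1 - cabs z))%:E * `|u t|%:E))%E).
    apply: ge0_le_integral => //.
    - exact: measurable_int i0.
    - apply: emeasurable_funD; first exact/measurable_EFinP.
      by apply: measurable_funeM; apply/measurable_EFinP; exact: measurableT_comp.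
    - move=> t /D01 t01; rewrite -EFinM -EFinD lee_fin normrM (mulrC _ `|u t|) -mulrDr.
      by rewrite ler_wpM2l//; exact: Im_geometric_le.
  rewrite ge0_integralD//; last 4 first.
  - by move=> t _; rewrite lee_fin mulr_ge0// imker_ge0.
  - exact/measurable_EFinP.
  - by move=> t _; rewrite mule_ge0// lee_fin.
  - by apply: measurable_funeM; apply/measurable_EFinP; exact: measurableT_comp.
  rewrite EFinD leeD// ge0_integralZl_EFin//; last first.
    by apply/measurable_EFinP; exact: measurableT_comp.
  rewrite (EFinM _ B) /B /Rintegral fineK//; apply: integrable_fin_num => //; exact: integrable_norm.
have l1 : (fun N => `|complex.Im (series (fun n => rc (mcoef u n) * z ^+ n) N)|) @ \oo -->
    `|complex.Im (psum (fun n => rc (mcoef u n)) z)|.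
  by apply: cvg_norm; have /cvgC_ReIm[] := psum_cvg gu zD.
have l2 : (fun N => K + cabs z ^+ N / (1 - cabs z) * B) @ \oo --> K.
  have -> : (fun N => K + cabs z ^+ N / (1 - cabs z) * B) =
      (fun N => K + B / (1 - cabs z) * cabs z ^+ N) by apply/funext => N; ring.
  rewrite -[X in _ --> X]addr0; apply: cvgD; first exact: cvg_cst.
  apply: (@cvg_geometric R (B / (1 - cabs z)) (cabs z)).
  by rewrite ger0_norm ?cabs_ge0.
by apply: (ler_cvg_to l1 l2); apply: nearW => N; exact: part.
Qed.

End CauchyTransform.

(** * BMOA bounds for the transform of a density *)

Section HankelBound.
Context {R : realType}.
Variable mu : {finite_measure set (measurableTypeR R) -> \bar R}.
Variable alpha : R.
Hypothesis alpha1 : 1 < alpha.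
Local Notation C := (Cpx R).
Local Notation rc := (real_complex R).
Local Notation seg s := ([set` `[s%R, 1%R[%R] : set (measurableTypeR R)).
Local Notation D := (seg 0).
Implicit Types (z w : C) (F G : C -> C) (s t d e L : R) (u v : R -> R) (n N k : nat).

Definition carleson_from s A := forall x, s <= x < 1 -> mass mu x <= A * (1 - x) `^ alpha.

(** Serves twice: with [w = 1] for the coefficients and with [w = imker z] for the imaginary part.
    [Q] stands for the integral near 1, where the weight is not bounded by [W]. *)
Lemma integral_split_le u (w : R -> R) s d L W Q : 0 <= s < 1 -> 0 <= d -> 0 <= L -> 0 <= W ->
  measurable_fun D (u : measurableTypeR R -> R) ->
  measurable_fun D (w : measurableTypeR R -> R) ->
  (forall t, D t -> 0 <= w t) ->
  (forall t, 0 <= t < s -> `|u t| <= d /\ w t <= W) ->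
  (forall t, s <= t < 1 -> `|u t| <= L * (1 - t) `^ (1 - alpha)) ->
  (\int[mu]_(t in seg s) ((1 - t) `^ (1 - alpha) * w t)%:E <= Q%:E)%E ->
  (\int[mu]_(t in D) (`|u t| * w t)%:E <= (d * W * mass mu 0 + L * Q)%:E)%E.
Proof.
move=> /andP[s0 s1] d0 L0 W0 mu_ mw w0 uW uL wQ.
pose A : set (measurableTypeR R) := [set` `[0, s[%R].
have mA : measurable A by exact: measurable_itv.
have mB : measurable (seg s) by exact: measurable_itv.
have DE : D = A `|` seg s.
  rewrite eqEsubset; split=> t; rewrite /A /= !in_itv/=.
    by move=> /andP[t0 t1]; case: (ltP t s) => ts; [left|right]; rewrite ?t0 ?ts.
  by case=> /andP[h1 h2]; rewrite ?h1 ?h2 ?(lt_trans h2 s1) ?(le_trans s0 h1).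
have AB : [disjoint A & seg s].
  rewrite disj_set2E; apply/eqP; rewrite -subset0 => t [] /=.
  by rewrite !in_itv/= => /andP[_ ts] /andP[/(lt_le_trans ts)]; rewrite ltxx.
have AD : A `<=` D by rewrite DE; exact: subsetUl.
have BD : seg s `<=` D by rewrite DE; exact: subsetUr.
have muw : measurable_fun D (fun t : measurableTypeR R => `|u t| * w t).
  by apply: measurable_funM => //; exact: measurableT_comp.
have mD : measurable D by exact: measurable_itv.
have mE := (measurable_EFinP _ _).2 muw.
rewrite {1}DE ge0_integral_setU//; first last.
- by move=> t; rewrite -DE => Dt; rewrite lee_fin mulr_ge0// w0.
- by rewrite -DE.
rewrite EFinD leeD//.
  apply: (@le_trans _ _ (\int[mu]_(t in A) (cst (d * W)%:E t))%E).
    apply: ge0_le_integral => //.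
    - by move=> t At; rewrite lee_fin mulr_ge0// w0//; exact: AD.
    - exact: measurable_funS mE.
    - move=> t At; have /uW[h1 h2] : 0 <= t < s by move: At; rewrite /A /= in_itv.
      by rewrite lee_fin ler_pM// w0//; exact: AD.
  rewrite integral_cst// (EFinM (d * W)) -massE lee_wpmul2l ?lee_fin ?mulr_ge0//.
  by apply: le_measure; rewrite ?inE.
apply: (@le_trans _ _ (\int[mu]_(t in seg s) (L%:E * ((1 - t) `^ (1 - alpha) * w t)%:E))%E).
  have m2 : measurable_fun (seg s) (fun t : measurableTypeR R => (1 - t) `^ (1 - alpha) * w t).
    apply: measurable_funM; first exact: measurable_powR_one_sub.
    exact: measurable_funS mw.
  apply: ge0_le_integral => //.
  - by move=> t Bt; rewrite lee_fin mulr_ge0// w0//; exact: BD.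
  - exact: measurable_funS mE.
  - by apply: measurable_funeM; exact/measurable_EFinP.
  - move=> t Bt; have st : s <= t < 1 by move: Bt; rewrite /= in_itv.
    rewrite -EFinM lee_fin mulrA ler_wpM2r ?uL// w0//; exact: BD.
rewrite ge0_integralZl_EFin//.
- by rewrite EFinM lee_wpmul2l.
- by move=> t Bt; rewrite lee_fin mulr_ge0 ?powR_ge0// w0//; exact: BD.
- apply/measurable_EFinP; apply: measurable_funM; first exact: measurable_powR_one_sub.
  exact: measurable_funS mw.
Qed.

(* [u] stands for the real or imaginary part on [0, 1) of a function of the
   Bloch type space. Splitting at [s] separates the part where [u] is uniformly
   small from the part where the Carleson constant is small. *)
Lemma Hankel_bound : exists K : R, 0 <= K /\ forall s d L A u,
  0 <= s < 1 -> 0 <= d -> 0 <= L -> 0 <= A ->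
  measurable_fun D (u : measurableTypeR R -> R) ->
  (forall t, 0 <= t < s -> `|u t| <= d) ->
  (forall t, s <= t < 1 -> `|u t| <= L * (1 - t) `^ (1 - alpha)) ->
  carleson_from s A ->
  [/\ mu.-integrable D (EFin \o u),
      \int[mu]_(t in D) `|u t| <= d / (1 - s) ^+ 2 * mass mu 0 + L * A * K &
      forall z, disc z -> `|complex.Im (psum (fun n => rc (mcoef mu u n)) z)| <=
        d / (1 - s) ^+ 2 * mass mu 0 + L * A * K].
Proof.
have [K1 [K10 HK1]] := integral_imker_le mu alpha1.
have a1 : 0 <= alpha - 1 by rewrite subr_ge0 ltW.
have aa : alpha - 1 < alpha by rewrite gtrBl.
have [K2 HK2] := integral_powR_le mu a1 aa.
exists (Num.max K1 K2); split; first by rewrite le_max K10.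
move=> s d L A u s01 d0 L0 A0 mu_ ud uL cA; have /andP[s0 s1] := s01.
have mD : measurable D by exact: measurable_itv.
have s2 : 0 < 1 - s by rewrite subr_gt0.
(* The same [W = (1 - s)^-2] serves for both weights: it is at least 1, and it bounds [imker z] on
   [[0, s)] because [|1 - t z| >= 1 - s] there. *)
have s2V : 1 <= (1 - s) ^- 2 by rewrite invf_ge1 ?exprn_gt0// exprn_ile1 ?gerBl// ltW.
have LA0 : 0 <= L * A by rewrite mulr_ge0.
have b1 : (\int[mu]_(t in D) `|u t|%:E <=
    (d / (1 - s) ^+ 2 * mass mu 0 + L * A * Num.max K1 K2)%:E)%E.
  have := @integral_split_le u (cst 1) s d L ((1 - s) ^- 2) (A * K2) s01 d0 L0 _ mu_ _ _ _ uL _.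
  have -> : (fun t : R => (`|u t| * cst 1 t)%:E) = (fun t => `|u t|%:E).
    by apply/funext => t; rewrite mulr1.
  move=> h; apply: le_trans (h _ _ _ _ _) _ => //.
  - by rewrite invr_ge0 exprn_ge0// ltW.
  - by move=> t ts; rewrite ud.
  - under eq_integral do rewrite mulr1 -(opprB alpha 1).
    by apply: HK2.
  - by rewrite lee_fin lerD2l -mulrA ler_wpM2l// ler_wpM2l// le_max lexx orbT.
have iu : mu.-integrable D (EFin \o u).
  apply/integrableP; split; first exact/measurable_EFinP.
  by apply: le_lt_trans b1 _; rewrite ltry.
split => //.
  rewrite -lee_fin /Rintegral fineK//; apply: integrable_fin_num => //.
  exact: integrable_norm.
move=> z zD; apply: Im_psum_mcoef_le => //.
have := @integral_split_le u (imker z) s d L ((1 - s) ^- 2) (A * K1) s01 d0 L0 _ mu_ _ _ _ uL _.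
move=> h; apply: le_trans (h _ _ _ _ _) _ => //.
- by rewrite invr_ge0 exprn_ge0// ltW.
- exact: measurable_imkerT.
- by move=> t _; exact: imker_ge0.
- move=> t /andP[t0 ts]; rewrite ud ?t0//; split => //.
  have t01 : 0 <= t < 1 by rewrite t0 (lt_trans ts).
  have c0 := cabs_one_sub_gt0 t01 zD.
  rewrite /imker -[leRHS]mul1r ler_pM ?invr_ge0 ?sqr_ge0//.
    by rewrite ltW//; exact: le_lt_trans (Im_le_cabs _) zD.
  rewrite lef_pV2 ?posrE ?exprn_gt0// lerXn2r ?nnegrE ?(ltW s2) ?(ltW c0)//.
  by apply: le_trans (cabs_one_sub_ge t01 zD); rewrite lerD2l lerN2 ltW.
- exact: HK1.
- by rewrite lee_fin lerD2l -mulrA ler_wpM2l// ler_wpM2l// le_max lexx.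
Qed.

Definition ccmcoef u v n : C := Complex (mcoef mu u n) (mcoef mu v n).

(** For the constant, 8 = 6 + 2: the seminorm costs [6 Q] by [bmoa_norm_le] and the value at 0 costs
    [2 Q], as the coefficients of [u] and of [v] are each at most [Q]. *)
Lemma Hankel_bmoa_bound : exists K : R, 0 <= K /\ forall s d L A u v G,
  0 <= s < 1 -> 0 <= d -> 0 <= L -> 0 <= A -> carleson_from s A ->
  measurable_fun D (u : measurableTypeR R -> R) ->
  measurable_fun D (v : measurableTypeR R -> R) ->
  (forall t, 0 <= t < s -> `|u t| <= d /\ `|v t| <= d) ->
  (forall t, s <= t < 1 -> `|u t| <= L * (1 - t) `^ (1 - alpha) /\
                           `|v t| <= L * (1 - t) `^ (1 - alpha)) ->
  (forall z, disc z -> G z = psum (ccmcoef u v) z) ->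
  [/\ geo (ccmcoef u v), analytic_on_disc G &
   (bmoa_norm G <= (8 * (d / (1 - s) ^+ 2 * mass mu 0 + L * A * K))%:E)%E].
Proof.
have [K [K0 HK]] := Hankel_bound; exists K; split => //.
move=> s d L A u v G s01 d0 L0 A0 cA mu_ mv ud uL GE.
have [iu Iu ImU] := HK s d L A u s01 d0 L0 A0 mu_ (fun t h => (ud t h).1) (fun t h => (uL t h).1) cA.
have [iv Iv ImV] := HK s d L A v s01 d0 L0 A0 mv (fun t h => (ud t h).2) (fun t h => (uL t h).2) cA.
set Q := _ + L * A * K in Iu ImU Iv ImV *.
have Q0 : 0 <= Q by apply: le_trans Iu; apply: Rintegral_ge0.
have gu := mcoef_geo iu; have gv := mcoef_geo iv.
have ccE n : ccmcoef u v n = rc (mcoef mu u n) + iC * rc (mcoef mu v n).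
  by apply/eqP; rewrite eq_complex/=; apply/andP; split; apply/eqP; ring.
have guv : geo (ccmcoef u v).
  apply: (@bounded_geo _ _ (Q + Q)) => n.
  rewrite (le_trans (cabs_le_ReIm _))//= lerD//.
    exact: le_trans (mcoef_bound n iu) Iu.
  exact: le_trans (mcoef_bound n iv) Iv.
have psumE z : disc z -> psum (ccmcoef u v) z =
    psum (fun n => rc (mcoef mu u n)) z + iC * psum (fun n => rc (mcoef mu v n)) z.
  move=> zD; apply: psum_eq.
  have := cvgCD (psum_cvg gu zD) (cvgCM (@cvgC_cst _ _ \oo _ iC) (psum_cvg gv zD)).
  set X := (fun N => _ + _) => h.
  suff <- : X = series (fun n => ccmcoef u v n * z ^+ n) by exact: h.
  apply/funext => N; rewrite /X /series/= mulr_sumr -big_split/=; apply: eq_bigr => n _.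
  by rewrite ccE mulrDl mulrA.
split => //.
  apply: (@hol_analytic _ _ (psum (dcoef (ccmcoef u v)))).
  by apply: hol_ext (psum_hol guv) => z zD; rewrite GE.
have D0 : disc (0 : C) by rewrite /disc/= cabs0.
have Im1 z : disc z -> `|complex.Im (psum (fun n => rc (mcoef mu u n)) z)| <= Q by exact: ImU.
apply: (@le_trans _ _ (cabs (G 0) + 6 * Q)%:E).
  apply: (bmoa_norm_le (psum_hol gu) (psum_hol gv) Q0) => //.
  by move=> z zD; rewrite GE// psumE.
rewrite lee_fin; suff : cabs (G 0) <= Q + Q by lra.
have -> : G 0 = ccmcoef u v 0.
  rewrite GE//; apply: psum_eq; apply/cvgCP => e' e'0; exists 1%N => // -[//|n] _ /=.
  rewrite /series/= big_nat_recl//= big1 => [|i _]; last by rewrite exprS mul0r mulr0.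
  by rewrite addr0 expr0 mulr1 subrr cabs0.
rewrite (le_trans (cabs_le_ReIm _))//= lerD//.
  exact: le_trans (mcoef_bound 0 iu) Iu.
exact: le_trans (mcoef_bound 0 iv) Iv.
Qed.

End HankelBound.

(** * The Hankel matrix on Taylor coefficients *)

Section HankelCoefficients.
Context {R : realType}.
Variable mu : {finite_measure set (measurableTypeR R) -> \bar R}.
Variable alpha : R.
Hypothesis alpha1 : 1 < alpha.
Local Notation C := (Cpx R).
Local Notation rc := (real_complex R).
Local Notation seg s := ([set` `[s%R, 1%R[%R] : set (measurableTypeR R)).
Local Notation D := (seg 0).
Implicit Types (z w : C) (F G : C -> C) (s t d e L A M : R) (u v : R -> R) (n N k : nat)
  (a : nat -> C).

Lemma power_series_geo a F : power_series_on_disc a F ->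
  geo a /\ forall z, disc z -> F z = psum a z.
Proof.
move=> aF; split; first by apply: cvg_geo => z zD; exists (F z); exact: aF.
by move=> z zD; rewrite (psum_eq (aF z zD)).
Qed.

Lemma disc_rc t : 0 <= t < 1 -> disc (rc t : C).
Proof. by move=> /andP[t0 t1]; rewrite /disc/= cabs_rc ger0_norm. Qed.

Lemma measurable_trace F F' : hol F F' ->
  measurable_fun D (fun t : measurableTypeR R => complex.Re (F (rc t))) /\
  measurable_fun D (fun t : measurableTypeR R => complex.Im (F (rc t))).
Proof.
move=> hF; have mD : measurable D by exact: measurable_itv.
have cF (t : R) : D t -> (fun s : R => F (rc s)) @ t --> F (rc t).
  move=> /D01 t01; have /continuousCP Fc := hol_continuous hF (disc_rc t01).
  apply/cvgCP_le => e /Fc[d d0 H]; apply/nbhs_ballP; exists d => // s.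
  rewrite /ball/= => ts; apply: H; by rewrite -rcB cabs_rc distrC.
split; apply: subspace_continuous_measurable_fun => //;
  apply: continuous_in_subspaceT => t; rewrite inE => /cF /cvgC_ReIm[]; by [].
Qed.

Lemma integrable_powR_half A : 0 <= A -> carleson_from mu alpha 0 A ->
  mu.-integrable D (EFin \o (fun t : R => (1 - t) `^ (- (alpha - 2^-1)))).
Proof.
move=> A0 cA.
have mD : measurable D by exact: measurable_itv.
have h0 : 0 <= alpha - 2^-1.
  by rewrite subr_ge0 (le_trans _ (ltW alpha1))// invf_le1// ler1n.
have h1 : alpha - 2^-1 < alpha by rewrite gtrBl invr_gt0.
have [K HK] := integral_powR_le mu h0 h1.
have mp : measurable_fun D (fun t : measurableTypeR R => (1 - t) `^ (- (alpha - 2^-1))).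
  exact: measurable_powR_one_sub.
apply/integrableP; split; first exact/measurable_EFinP.
apply: (@le_lt_trans _ _ (A * K)%:E); last by rewrite ltry.
have := HK 0 A; rewrite lexx ltr01 => /(_ isT A0 cA); apply: le_trans.
rewrite le_eqVlt; apply/orP; left; apply/eqP; apply: eq_integral => t _.
by rewrite /= ger0_norm// powR_ge0.
Qed.

(** Dominated convergence. The majorant bounds the sums of absolute values, because a bound on [u]
    alone does not control its partial sums. *)
Lemma series_moment_cvg (b : nat -> R) u K A n : 0 <= A -> carleson_from mu alpha 0 A ->
  (forall t, D t -> series (fun k => b k * t ^+ k) @ \oo --> u t) ->
  (forall t N, D t -> \sum_(0 <= k < N) `|b k| * t ^+ k <= K * (1 - t) `^ (- (alpha - 2^-1))) ->
  series (fun k => moment mu (n + k) * b k) @ \oo --> mcoef mu u n.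
Proof.
move=> A0 cA bu bK; have mD : measurable D by exact: measurable_itv.
have ip := integrable_powR_half A0 cA.
pose g t := K * (1 - t) `^ (- (alpha - 2^-1)).
have ig : mu.-integrable D (EFin \o g) by exact: (integrableZl mD K ip).
pose f_ N t := \sum_(0 <= k < N) b k * t ^+ (n + k).
have fE N t : f_ N t = t ^+ n * series (fun k => b k * t ^+ k) N.
  by rewrite /series/= mulr_sumr; apply: eq_bigr => k _; rewrite exprD mulrCA.
have mf N : measurable_fun D (f_ N : measurableTypeR R -> R).
  apply: measurable_sum => k; apply: measurable_funM; first exact: measurable_cst.
  exact: measurable_exprn.
have ff t : D t -> (fun N => f_ N t) @ \oo --> t ^+ n * u t.
  move=> Dt; have -> : (fun N => f_ N t) = (fun N => t ^+ n * series (fun k => b k * t ^+ k) N).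
    by apply/funext => N; rewrite fE.
  by apply: cvgM; [exact: cvg_cst|exact: bu].
have fg N t : D t -> `|f_ N t| <= g t.
  move=> Dt; have /andP[t0 t1] := D01 Dt; rewrite fE normrM ger0_norm ?exprn_ge0//.
  apply: (@le_trans _ _ `|series (fun k => b k * t ^+ k) N|).
    by rewrite ler_piMl// exprn_ile1// ltW.
  apply: le_trans (bK t N Dt); rewrite (le_trans (ler_norm_sum _ _ _))//.
  by apply: ler_sum => k _; rewrite normrM [X in _ * X]ger0_norm ?exprn_ge0.
have [_ H] := dominated_Rcvg mf ff ig fg.
suff -> : series (fun k => moment mu (n + k) * b k) = (fun N => \int[mu]_(t in D) f_ N t) by [].
apply/funext => N.
have ih k : mu.-integrable D (EFin \o (fun t => b k * t ^+ (n + k))).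
  exact: (integrableZl mD (b k) (integrable_exprn mu (n + k))).
have [_ ->] := Rintegral_sum N ih; rewrite /series/=; apply: eq_bigr => k _.
by rewrite mulrC (@RintegralZl _ _ _ mu D _ (b k) mD (integrable_exprn mu (n + k))).
Qed.

Lemma bloch_trace F M t : analytic_on_disc F -> (bloch_norm alpha F <= M%:E)%E -> D t ->
  cabs (F (rc t)) <= M * (1 + 2 / (alpha - 1)) * (1 - t) `^ (1 - alpha).
Proof.
move=> aF FM Dt; have t01 := D01 Dt.
have := bloch_growth alpha1 aF FM (disc_rc t01).
by rewrite cabs_rc ger0_norm//; case/andP: t01.
Qed.

Lemma hankel_coef a F M A n : 0 <= A -> carleson_from mu alpha 0 A ->
  (bloch_norm alpha F <= M%:E)%E -> power_series_on_disc a F ->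
  series (fun k => rc (moment mu (n + k)) * a k) @ \oo -->
    ccmcoef mu (fun t => complex.Re (F (rc t))) (fun t => complex.Im (F (rc t))) n.
Proof.
move=> A0 cA FM aF; have [ga Fa] := power_series_geo aF.
have [K HK] := bloch_abs_sum alpha1 FM ga Fa.
have aK t N : D t -> \sum_(0 <= k < N) cabs (a k) * t ^+ k <=
    Num.max K (cabs (a 0%N)) * (1 - t) `^ (- (alpha - 2^-1)).
  (* [bloch_abs_sum] asks for [t > 0]; at 0 the sum is at most [cabs (a 0)], whence the maximum. *)
  move=> /D01/andP[t0 t1]; have [->|tn0] := eqVneq t 0.
    rewrite subr0 powR1 mulr1 le_max; apply/orP; right.
    case: N => [|N]; first by rewrite big_nil cabs_ge0.
    rewrite big_nat_recl//= big1 ?addr0 ?mulr1// => i _; by rewrite exprS mul0r mulr0.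
  have t01 : 0 < t < 1 by rewrite lt_def tn0 t0.
  by rewrite (le_trans (HK t N t01))// ler_wpM2r ?powR_ge0// le_max lexx.
have part (b : nat -> R) : (forall k, `|b k| <= cabs (a k)) ->
    forall t N, D t -> \sum_(0 <= k < N) `|b k| * t ^+ k <=
    Num.max K (cabs (a 0%N)) * (1 - t) `^ (- (alpha - 2^-1)).
  move=> ba t N Dt; apply: le_trans (aK t N Dt); apply: ler_sum => k _.
  by rewrite ler_wpM2r// exprn_ge0//; case/andP: (D01 Dt).
have sD t : D t -> series (fun k => a k * rc t ^+ k) @ \oo --> F (rc t).
  by move=> Dt; apply: aF; apply: disc_rc; exact: D01.
apply/cvgC_ReIm; split => /=.
  have -> : (fun N => complex.Re (series (fun k => rc (moment mu (n + k)) * a k) N)) =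
      series (fun k => moment mu (n + k) * complex.Re (a k)).
    by apply/funext => N; rewrite /series/= Re_sum; apply: eq_bigr => k _; rewrite Re_rcM.
  apply: (@series_moment_cvg (fun k => complex.Re (a k)) (fun t => complex.Re (F (rc t)))
    _ A n A0 cA _ (part _ (fun k => Re_le_cabs (a k)))) => t Dt.
  have /cvgC_ReIm[+ _] := sD t Dt.
  have -> : (fun N => complex.Re (series (fun k => a k * rc t ^+ k) N)) =
      series (fun k => complex.Re (a k) * t ^+ k); last by [].
  apply/funext => N; rewrite /series/= Re_sum; apply: eq_bigr => k _.
  by rewrite mulrC -rcX Re_rcM mulrC.
have -> : (fun N => complex.Im (series (fun k => rc (moment mu (n + k)) * a k) N)) =
    series (fun k => moment mu (n + k) * complex.Im (a k)).
  by apply/funext => N; rewrite /series/= Im_sum; apply: eq_bigr => k _; rewrite Im_rcM.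
apply: (@series_moment_cvg (fun k => complex.Im (a k)) (fun t => complex.Im (F (rc t)))
    _ A n A0 cA _ (part _ (fun k => Im_le_cabs (a k)))) => t Dt.
have /cvgC_ReIm[_ +] := sD t Dt.
have -> : (fun N => complex.Im (series (fun k => a k * rc t ^+ k) N)) =
    series (fun k => complex.Im (a k) * t ^+ k); last by [].
apply/funext => N; rewrite /series/= Im_sum; apply: eq_bigr => k _.
by rewrite mulrC -rcX Im_rcM mulrC.
Qed.

Lemma hankel_image F G M A : 0 <= A -> carleson_from mu alpha 0 A ->
  (bloch_norm alpha F <= M%:E)%E -> hankel mu F G ->
  forall z, disc z -> G z = psum (ccmcoef mu (fun t => complex.Re (F (rc t)))
                                     (fun t => complex.Im (F (rc t)))) z.
Proof.
move=> A0 cA FM [a [b [aF ab bG]]] z zD.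
have -> : ccmcoef mu (fun t => complex.Re (F (rc t))) (fun t => complex.Im (F (rc t))) = b.
  apply/funext => n; have h := @hankel_coef a F M A n A0 cA FM aF.
  exact: (cvgC_unique h (ab n)).
by rewrite (psum_eq (bG z zD)).
Qed.

Lemma vanishing_carleson_small e : vanishing_carleson alpha mu -> 0 < e ->
  exists s, 0 <= s < 1 /\ carleson_from mu alpha s e.
Proof.
move=> /cvgrPdist_le/(_ e) + e0; move=> /(_ e0)[d /= d0 H].
pose s := Num.max 0 (1 - d / 2); exists s; split.
  by rewrite le_max lexx/= gt_max ltr01 gtrBl divr_gt0.
move=> x /andP[sx x1]; have x0 : 0 < 1 - x by rewrite subr_gt0.
have dx : ball_ [eta Num.Def.normr] 1 d x.
  rewrite /ball_/= gtr0_norm//; move: sx; rewrite ge_max => /andP[_ sx]; lra.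
have := H x dx x1; rewrite sub0r normrN ger0_norm; last first.
  by rewrite divr_ge0 ?powR_ge0//; exact: mass_ge0.
by rewrite ler_pdivrMr ?powR_gt0.
Qed.

(** To the left of [s] the mass is at most the total mass, and the power of [1 - x] is at least that
    of [1 - s]. *)
Lemma carleson_from_0 s A : 0 <= s < 1 -> carleson_from mu alpha s A -> exists B,
  0 <= B /\ carleson_from mu alpha 0 B.
Proof.
move=> /andP[s0 s1] cA; have sp : 0 < (1 - s) `^ alpha by rewrite powR_gt0// subr_gt0.
exists (Num.max A (mass mu 0 / (1 - s) `^ alpha)); split.
  by rewrite le_max divr_ge0 ?orbT ?mass_ge0// ltW.
move=> x /andP[x0 x1]; have [sx|sx] := leP s x.
  by rewrite (le_trans (cA x _)) ?sx// ler_wpM2r ?powR_ge0// le_max lexx.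
apply: (@le_trans _ _ (mass mu 0)).
  rewrite -lee_fin -!massE; apply: le_measure; rewrite ?inE; try exact: measurable_itv.
  by move=> t; rewrite /= !in_itv/= => /andP[h ->]; rewrite (le_trans x0 h).
apply: (@le_trans _ _ (mass mu 0 / (1 - s) `^ alpha * (1 - x) `^ alpha)).
  rewrite mulrAC ler_pdivlMr// ler_wpM2l ?mass_ge0//.
  rewrite ge0_ler_powR ?nnegrE ?subr_ge0 ?(ltW s1) ?(ltW x1)//.
    exact: le_trans (ltW alpha1).
  by rewrite lerD2l lerN2 ltW.
by rewrite ler_wpM2r ?powR_ge0// le_max lexx orbT.
Qed.

End HankelCoefficients.

(** * Locally uniformly convergent subsequences on [0, 1) *)

Section Selection.
Context {R : realType}.
Local Notation C := (Cpx R).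
Implicit Types (s t e : R).

Lemma ultra_cvgR (G : set_system nat) (x : nat -> R) (B : R) : UltraFilter G ->
  (forall n, `|x n| <= B) -> exists l : R, x @ G --> l.
Proof.
move=> UG xB; have cB : compact (`[- B, B]%classic : set R) by exact: segment_compact.
have xA : G (x @^-1` `[- B, B]%classic).
  by apply: filterE => n; rewrite /= in_itv/= -ler_norml xB.
have [l [_ xl]] := cB (x @ G) _ xA.
exists l; apply/cvgrPdist_lt => e e0.
have [//|GC] := in_ultra_setVsetC [set n | `|l - x n| < e] UG.
have xC : (x @ G) [set y | ~ (`|l - y| < e)] by exact: GC.
have bl : nbhs l (ball l e) by exact: nbhsx_ballx.
by have [y [/= h1 h2]] := xl _ _ xC bl.
Qed.

(** An ultrafilter provides limits at all [t] at once, in place of a diagonal extraction over a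
    dense set. The Lipschitz bounds pass to the limit and upgrade pointwise to uniform closeness on
    each [[0, s]]. The indices that are good for [s] and [e] belong to the ultrafilter, hence meet
    every tail, and [phi] picks among them. *)
Lemma uniform_selection (c : nat -> R -> C) (B : R -> R) (Lip : R -> R) :
  (forall n t, 0 <= t < 1 -> cabs (c n t) <= B t) ->
  (forall n s t t', 0 <= s < 1 -> 0 <= t <= s -> 0 <= t' <= s ->
     cabs (c n t - c n t') <= Lip s * `|t - t'|) ->
  exists (phi : nat -> nat) (l : R -> C), {homo phi : m n / (m < n)%N} /\
    forall j t, 0 <= t <= 1 - j.+1%:R^-1 -> cabs (c (phi j) t - l t) <= j.+1%:R^-1.
Proof.
move=> cB cL; have [G [UG ooG]] := ultraFilterLemma (@eventually_filter).
have PG : ProperFilter G := @ultra_proper _ _ UG.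
have lim t : exists l : C, 0 <= t < 1 -> forall e : R, 0 < e -> G [set n | cabs (c n t - l) < e].
  have [t01|] := boolP (0 <= t < 1); last by exists 0.
  have [a xa] := @ultra_cvgR G (fun n => complex.Re (c n t)) (B t) UG
    (fun n => le_trans (Re_le_cabs _) (cB n t t01)).
  have [b xb] := @ultra_cvgR G (fun n => complex.Im (c n t)) (B t) UG
    (fun n => le_trans (Im_le_cabs _) (cB n t t01)).
  exists (Complex a b) => _ e e0.
  have : (fun n => c n t) @ G --> (Complex a b : C) by apply/cvgC_ReIm.
  by move=> /cvgCP/(_ e e0).
have [l Hl] := choice lim.
have unif s e : 0 <= s < 1 -> 0 < e ->
    G [set n | forall t, 0 <= t <= s -> cabs (c n t - l t) <= e].
  move=> s01 e0; have /andP[s0 s1] := s01.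
  have lL t t' : 0 <= t <= s -> 0 <= t' <= s -> cabs (l t - l t') <= Lip s * `|t - t'|.
    move=> ts ts'; apply/ler_addgt0Pr => h h0; have h20 : 0 < h / 2 by rewrite divr_gt0.
    have t01 : 0 <= t < 1 by case/andP: ts => -> /le_lt_trans->.
    have t01' : 0 <= t' < 1 by case/andP: ts' => -> /le_lt_trans->.
    have [n [/= h1 h2]] := filter_ex (filterI (Hl t t01 _ h20) (Hl t' t01' _ h20)).
    have -> : l t - l t' = (c n t - c n t') - (c n t - l t) + (c n t' - l t') by ring.
    rewrite (le_trans (cabsD _ _))// (splitr h) addrA lerD ?(ltW h2)//.
    by rewrite (le_trans (cabsB _ _))// lerD ?(ltW h1)// (cL n s).
  pose L := `|Lip s| + 1; have L0 : 0 < L by rewrite ltr_wpDl.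
  have LL : Lip s <= L by rewrite (le_trans (ler_norm _))// lerDl.
  (* Grid of mesh [del], on which a Lipschitz step costs at most [e / 3]; [m] points reach 1. The
     three thirds are [c n] from [t] to a grid point, [c n] against [l] there, and [l] back to
     [t]. *)
  pose del := e / 3 / L; have del0 : 0 < del by rewrite !divr_gt0.
  pose m := (Num.truncn del^-1).+1.
  have mdel : 1 <= del * m%:R.
    by rewrite -ler_pdivrMl// mulr1 ltW// truncnS_gt.
  have : G [set n | forall i : 'I_m, del * i%:R <= s ->
      cabs (c n (del * i%:R) - l (del * i%:R)) <= e / 3].
    apply: filter_forall => i.
    have [di|] := boolP (del * i%:R <= s); last by move=> _; exact: filterE.
    have di01 : 0 <= del * i%:R < 1 by rewrite mulr_ge0 ?(ltW del0)//= (le_lt_trans di).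
    have e30 : 0 < e / 3 by rewrite divr_gt0.
    by apply: filterS (Hl _ di01 _ e30) => n /= /ltW.
  apply: filterS => n /= H t /andP[t0 ts].
  have t1 : t < 1 by rewrite (le_lt_trans ts).
  pose i := Num.truncn (t / del).
  have td0 : 0 <= t / del by rewrite divr_ge0// ltW.
  have /andP[i1 i2] := truncn_itv td0; rewrite -/i in i1 i2.
  have di : del * i%:R <= t by rewrite mulrC -ler_pdivlMr.
  have di2 : t - del * i%:R <= del.
    by rewrite lerBlDr -[X in X + _]mulr1 -mulrDr nat1r mulrC -ler_pdivrMr// ltW.
  have im : (i < m)%N.
    rewrite -(ltr_nat R) -(ltr_pM2l del0) (lt_le_trans _ mdel)//.
    exact: le_lt_trans di t1.
  have dis := le_trans di ts.
  have di0 : 0 <= del * i%:R by rewrite mulr_ge0// ltW.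
  have -> : c n t - l t = (c n t - c n (del * i%:R)) +
    (c n (del * i%:R) - l (del * i%:R)) + (l (del * i%:R) - l t) by ring.
  have Ldel : Lip s * `|t - del * i%:R| <= e / 3.
    rewrite ger0_norm ?subr_ge0//.
    apply: (@le_trans _ _ (L * (t - del * i%:R))); first by rewrite ler_wpM2r ?subr_ge0.
    by rewrite mulrC -ler_pdivlMr.
  have -> : e = e / 3 + e / 3 + e / 3 by field.
  rewrite (le_trans (cabsD _ _))// lerD//.
    rewrite (le_trans (cabsD _ _))// lerD//; last exact: (H (Ordinal im)).
    by rewrite (le_trans _ Ldel)// (cL n s)// ?t0 ?di0.
  by rewrite (le_trans (lL _ _ _ _))// ?t0 ?di0// distrC.
have next j m : exists n, (m < n)%N /\
    forall t, 0 <= t <= 1 - j.+1%:R^-1 -> cabs (c n t - l t) <= j.+1%:R^-1.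
  have j01 : 0 <= (1 - j.+1%:R^-1 : R) < 1.
    by rewrite subr_ge0 invf_le1 ?ler1n// gtrBl invr_gt0 ltr0n.
  have j0 : 0 < (j.+1%:R^-1 : R) by rewrite invr_gt0 ltr0n.
  have Gm : G [set n | (m < n)%N] by apply: ooG; exists m.+1.
  by have [n [h1 h2]] := filter_ex (filterI Gm (unif _ _ j01 j0)); exists n.
have [h Hh] := choice (fun p : nat * nat => next p.1 p.2).
pose phi := fix phi j := if j is j'.+1 then h (j, phi j') else h (0%N, 0%N).
exists phi, l; split.
  by apply: homo_ltn => [|j]; [exact: ltn_trans|exact: (Hh (j.+1, phi j)).1].
by case=> [|j]; [exact: (Hh (0%N, 0%N)).2|exact: (Hh (j.+1, phi j)).2].
Qed.

End Selection.

(** * Compactness under the vanishing Carleson condition *)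

Section Compactness.
Context {R : realType}.
Variable mu : {finite_measure set (measurableTypeR R) -> \bar R}.
Variable alpha : R.
Hypothesis alpha1 : 1 < alpha.
Local Notation C := (Cpx R).
Local Notation rc := (real_complex R).
Local Notation seg s := ([set` `[s%R, 1%R[%R] : set (measurableTypeR R)).
Local Notation D := (seg 0).
Implicit Types (z w : C) (F G : C -> C) (s t d e L A M : R) (u v : R -> R) (n N k : nat)
  (a : nat -> C).

Lemma cvge0P (x : nat -> \bar R) : (forall n, (0 <= x n)%E) ->
  x @ \oo --> 0%E <-> forall e : R, 0 < e -> \forall n \near \oo, (x n <= e%:E)%E.
Proof.
move=> x0; split=> [/fine_cvgP[xf /cvgrPdist_le xc] e e0|xe].
  near=> n; have xn : x n \is a fin_num by near: n.
  rewrite -(fineK xn) lee_fin.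
  have : `|0 - (fine \o x) n| <= e by near: n; exact: xc.
  by rewrite sub0r normrN; apply: le_trans; exact: ler_norm.
apply/fine_cvgP; split.
  by apply: filterS (xe 1 ltr01) => n xn; rewrite ge0_fin_numE// (le_lt_trans xn)// ltry.
apply/cvgrPdist_le => e e0; apply: filterS (xe e e0) => n xn.
have xf : x n \is a fin_num by rewrite ge0_fin_numE// (le_lt_trans xn)// ltry.
rewrite sub0r normrN ger0_norm ?fine_ge0//=.
by rewrite -lee_fin fineK.
Unshelve. all: by end_near. Qed.

Lemma bloch_norm_ge0' beta F : (0 <= bloch_norm beta F)%E.
Proof.
rewrite /bloch_norm adde_ge0 ?lee_fin ?cabs_ge0//.
apply: (@le_trans _ _ (cabs (derive1 F 0) * (1 - cabs (0 : C) ^+ 2) `^ beta)%:E).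
  by rewrite lee_fin mulr_ge0 ?cabs_ge0 ?powR_ge0.
by apply: ereal_sup_ubound; exists 0 => //; rewrite /disc/= cabs0.
Qed.

Lemma bmoa_norm_ge0 F : (0 <= bmoa_norm F)%E.
Proof.
rewrite /bmoa_norm adde_ge0 ?lee_fin ?cabs_ge0//.
apply: (@le_trans _ _ (hardy2_norm (fun z => (F (mobius 0 z) - F 0)%R))).
  exact: poweR_ge0.
by apply: ereal_sup_ubound; exists 0 => //; rewrite /disc/= cabs0.
Qed.

Lemma lty_real (x : \bar R) : (0 <= x)%E -> (x < +oo)%E -> exists M : R, (x <= M%:E)%E.
Proof. by case: x => [r _ _| |] //; exists r. Qed.

Lemma psumB a b z : geo a -> geo b -> disc z ->
  psum (fun n => a n - b n) z = psum a z - psum b z.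
Proof.
move=> ga gb zD; apply: psum_eq; have := cvgCB (psum_cvg ga zD) (psum_cvg gb zD).
set X := (fun N => _ - _) => h.
suff <- : X = series (fun n => (a n - b n) * z ^+ n) by exact: h.
apply/funext => N; rewrite /X /series/= -sumrB; apply: eq_bigr => n _.
by rewrite mulrBl.
Qed.

Lemma mcoefB u v n : mu.-integrable D (EFin \o u) -> mu.-integrable D (EFin \o v) ->
  mcoef mu (fun t => u t - v t) n = mcoef mu u n - mcoef mu v n.
Proof.
move=> iu iv; rewrite /mcoef -RintegralB//; try exact: integrable_exprM.
by apply: eq_Rintegral => t _; rewrite mulrBr.
Qed.

Lemma bloch_lipschitz F M s t t' : analytic_on_disc F -> (bloch_norm alpha F <= M%:E)%E ->
  0 <= s < 1 -> 0 <= t <= s -> 0 <= t' <= s ->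
  cabs (F (rc t) - F (rc t')) <= 2 * (M * (1 - s) `^ (- alpha)) * `|t - t'|.
Proof.
move=> aF FM s01; have /andP[s0 s1] := s01.
have [M0 _] := bloch_norm_ge0 FM.
wlog tt : t t' / t' <= t => [H h1 h2|].
  have [tt|/ltW tt] := leP t' t; first exact: H.
  by rewrite cabs_distC distrC; exact: H.
move=> /andP[t0 ts] /andP[t'0 t's].
have -> : 2 * (M * (1 - s) `^ (- alpha)) * `|t - t'| =
    2 * (M * (1 - s) `^ (- alpha) * t - M * (1 - s) `^ (- alpha) * t').
  by rewrite ger0_norm ?subr_ge0//; ring.
apply: (@increment_le _ (fun x => F (rc x)) (fun x => derive1 F (rc x) * 1)
  (fun x => M * (1 - s) `^ (- alpha) * x) (fun=> M * (1 - s) `^ (- alpha)) t' t tt)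
  => x /andP[xt' xt].
- have xD : disc (rc x : C).
    by apply: disc_rc; rewrite (le_trans t'0)//= (le_lt_trans xt)// (le_lt_trans ts).
  apply: (@cderivR_comp _ F (fun x => rc x) x 1 (derive1 F (rc x))).
    have := @cderivR_affine R 0 1 x.
    have -> : (fun y => 0 + rc y * 1) = (fun y => rc y) by apply/funext => y; rewrite add0r mulr1.
    by apply.
  exact: (analytic_hol aF xD).1.
- by apply: is_derive_eq; rewrite /GRing.scale/= mulr1.
- have x0 : 0 <= x by rewrite (le_trans t'0).
  have xs : x <= s by rewrite (le_trans xt).
  have xD : disc (rc x : C) by apply: disc_rc; rewrite x0 (le_lt_trans xs).
  rewrite mulr1; apply: le_trans (bloch_deriv alpha1 FM xD) _.
  rewrite cabs_rc (ger0_norm x0) ler_wpM2l//; apply: powRN_le.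
  + by rewrite subr_gt0.
  + by rewrite lerD2l lerN2.
  + exact: (le_trans ler01 (ltW alpha1)).
Qed.

Let Lconst M := M * (1 + 2 / (alpha - 1)).

Lemma Lconst_ge0 M : 0 <= M -> 0 <= Lconst M.
Proof.
by move=> M0; rewrite /Lconst mulr_ge0// addr_ge0// divr_ge0// subr_ge0 ltW.
Qed.

Lemma vanishing_compact_bmoa : vanishing_carleson alpha mu ->
  compact_operator (hankel mu) (bloch_norm alpha) (@bmoa_norm R).
Proof.
move=> vc; have [s [s01 cs]] := vanishing_carleson_small vc ltr01.
have [A [A0 cA]] := carleson_from_0 alpha1 s01 cs.
have [K [K0 HK]] := Hankel_bmoa_bound mu alpha1.
have z01 : 0 <= (0 : R) < 1 by rewrite lexx ltr01.
have bmoaK L u v G : 0 <= L -> measurable_fun D (u : measurableTypeR R -> R) ->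
    measurable_fun D (v : measurableTypeR R -> R) ->
    (forall t, D t -> `|u t| <= L * (1 - t) `^ (1 - alpha) /\
                      `|v t| <= L * (1 - t) `^ (1 - alpha)) ->
    (forall z, disc z -> G z = psum (ccmcoef mu u v) z) ->
    [/\ geo (ccmcoef mu u v), disc_space (@bmoa_norm R) G &
      mu.-integrable D (EFin \o u) /\ mu.-integrable D (EFin \o v)].
  move=> L0 mu_ mv uL GE.
  have uL' t : 0 <= t < 1 -> `|u t| <= L * (1 - t) `^ (1 - alpha) /\
      `|v t| <= L * (1 - t) `^ (1 - alpha).
    by move=> t01; apply: uL; rewrite /= in_itv.
  (* Boundedness is the case [s = 0], [d = 0] of the split bound: the interval [[0, s)] is empty. *)
  have vac t : 0 <= t < 0 -> `|u t| <= 0 /\ `|v t| <= 0.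
    by move=> /andP[h1 /(le_lt_trans h1)]; rewrite ltxx.
  have [h1 h2 h3] := HK 0 0 L A u v G z01 (lexx 0) L0 A0 cA mu_ mv vac uL' GE.
  have [K' [_ HK']] := Hankel_bound mu alpha1.
  split => //; first by split => //; apply: le_lt_trans h3 _; rewrite ltry.
  have [iu _ _] := HK' 0 0 L A u z01 (lexx 0) L0 A0 mu_ (fun t h => (vac t h).1)
    (fun t h => (uL' t h).1) cA.
  by have [iv _ _] := HK' 0 0 L A v z01 (lexx 0) L0 A0 mv (fun t h => (vac t h).2)
    (fun t h => (uL' t h).2) cA.
have traceL F M : analytic_on_disc F -> (bloch_norm alpha F <= M%:E)%E -> forall t, D t ->
    `|complex.Re (F (rc t))| <= Lconst M * (1 - t) `^ (1 - alpha) /\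
    `|complex.Im (F (rc t))| <= Lconst M * (1 - t) `^ (1 - alpha).
  move=> aF FM t Dt; have h := bloch_trace alpha1 aF FM Dt.
  by split; [apply: le_trans (Re_le_cabs _) h|apply: le_trans (Im_le_cabs _) h].
split=> [F [aF FB]|F G FB [M FM] FG].
  have [M FM] := lty_real (bloch_norm_ge0' alpha F) FB.
  have [M0 _] := bloch_norm_ge0 FM.
  have [a ga aFc] := hol_power_series (analytic_hol aF).
  have [mr mi] := measurable_trace (analytic_hol aF).
  set u := (fun t => complex.Re (F (rc t))); set v := (fun t => complex.Im (F (rc t))).
  have [gb hg _] := bmoaK (Lconst M) u v (psum (ccmcoef mu u v)) (Lconst_ge0 M0) mr mi
    (traceL F M aF FM) (fun z _ => erefl).
  exists (psum (ccmcoef mu u v)) => //.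
  exists a, (ccmcoef mu u v); split; first exact: aFc.
    by move=> n; exact: (@hankel_coef _ mu alpha alpha1 a F M A n A0 cA FM aFc).
  by move=> z zD; exact: (psum_cvg gb zD).
have aF n : analytic_on_disc (F n) by have [] := FB n.
have [M0 _] := bloch_norm_ge0 (FM 0%N).
have L0 := Lconst_ge0 M0; set L := Lconst M in L0.
have FL n t : 0 <= t < 1 -> cabs (F n (rc t)) <= L * (1 - t) `^ (1 - alpha).
  by move=> t01; apply: (bloch_trace alpha1 (aF n) (FM n)); rewrite /= in_itv.
have [phi [l [phi_incr Hl]]] := @uniform_selection R (fun n t => F n (rc t))
  (fun t => L * (1 - t) `^ (1 - alpha)) (fun s => 2 * (M * (1 - s) `^ (- alpha)))
  FL (fun n s t t' => @bloch_lipschitz (F n) M s t t' (aF n) (FM n)).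
have cvl t : D t -> (fun j => F (phi j) (rc t)) @ \oo --> l t.
  move=> /D01 /andP[t0 t1]; apply/cvgCP_le => e e0.
  have m0 : 0 < Num.min e (1 - t) by rewrite lt_min e0 subr_gt0.
  near=> j; have jm : j.+1%:R^-1 <= Num.min e (1 - t).
    by apply: ltW; near: j; exact: near_infty_natSinv_lt (PosNum m0).
  move: jm; rewrite le_min => /andP[je jt].
  by apply: le_trans (Hl j t _) je; rewrite t0 lerBrDr addrC -lerBrDr.
(* The limit [l] enters only as two measurable functions with the common growth bound; no element of
   the Bloch type space with trace [l] is produced. *)
pose u t := complex.Re (l t); pose v t := complex.Im (l t).
have cu t : D t -> (fun j => complex.Re (F (phi j) (rc t))) @ \oo --> u t.
  by move=> /cvl /cvgC_ReIm[].
have cv t : D t -> (fun j => complex.Im (F (phi j) (rc t))) @ \oo --> v t.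
  by move=> /cvl /cvgC_ReIm[].
have mD : measurable D by exact: measurable_itv.
have mr j : measurable_fun D (fun t : measurableTypeR R => complex.Re (F (phi j) (rc t))).
  by have [] := measurable_trace (analytic_hol (aF (phi j))).
have mi j : measurable_fun D (fun t : measurableTypeR R => complex.Im (F (phi j) (rc t))).
  by have [] := measurable_trace (analytic_hol (aF (phi j))).
have mu_ : measurable_fun D (u : measurableTypeR R -> R) by exact: measurable_fun_cvg mr cu.
have mv : measurable_fun D (v : measurableTypeR R -> R) by exact: measurable_fun_cvg mi cv.
have uvL t : D t -> `|u t| <= L * (1 - t) `^ (1 - alpha) /\
                    `|v t| <= L * (1 - t) `^ (1 - alpha).
  move=> Dt; split.
    apply: (cvgr_to_le (cvg_norm (cu t Dt))); apply: nearW => j.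
    exact: (traceL (F (phi j)) M (aF _) (FM _) t Dt).1.
  apply: (cvgr_to_le (cvg_norm (cv t Dt))); apply: nearW => j.
  exact: (traceL (F (phi j)) M (aF _) (FM _) t Dt).2.
pose g := psum (ccmcoef mu u v).
have [gg hg [iu iv]] := bmoaK L u v g L0 mu_ mv uvL (fun z _ => erefl).
exists phi, g; split => //.
apply/cvge0P => [n|e e0]; first exact: bmoa_norm_ge0.
pose uj j t := complex.Re (F (phi j) (rc t)) - u t.
pose vj j t := complex.Im (F (phi j) (rc t)) - v t.
have GE j z : disc z -> G (phi j) z - g z = psum (ccmcoef mu (uj j) (vj j)) z.
  move=> zD; rewrite (hankel_image alpha1 A0 cA (FM (phi j)) (FG (phi j)) zD) /g.
  have [gF _ [iF1 iF2]] := bmoaK L _ _ _ L0 (mr j) (mi j)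
    (traceL (F (phi j)) M (aF _) (FM _)) (fun z _ => erefl).
  rewrite -(psumB gF gg zD); congr psum; apply/funext => n.
  rewrite /ccmcoef (mcoefB n iF1 iu) (mcoefB n iF2 iv).
  by apply/eqP; rewrite eq_complex/= !eqxx.
(* Order of choices: [e1] fixes [s1] through the vanishing condition, [s1] fixes [e2], and both fix
   how large [j] must be. Near 1 the difference is only bounded by twice the growth bound, hence
   [2 * L]. Each contribution is at most [e / 16], and [8 (e / 16 + e / 16) = e]. *)
pose e1 := e / (16 * (2 * L * K + 1)).
have LK0 : 0 <= 2 * L * K by apply: mulr_ge0 => //; exact: mulr_ge0.
have P0 : 0 < 2 * L * K + 1 by rewrite ltr_wpDl.
have e10 : 0 < e1 by rewrite divr_gt0// mulr_gt0.
have [s1 [s101 cs1]] := vanishing_carleson_small vc e10.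
have /andP[s10 s11] := s101.
have s12 : 0 < (1 - s1) ^+ 2 by rewrite exprn_gt0// subr_gt0.
pose e2 := e / (16 * ((1 - s1) ^- 2 * mass mu 0 + 1)).
have Q0 : 0 < (1 - s1) ^- 2 * mass mu 0 + 1.
  by rewrite ltr_wpDl// mulr_ge0 ?mass_ge0// invr_ge0 ltW.
have e20 : 0 < e2 by rewrite divr_gt0// mulr_gt0.
have m0 : 0 < Num.min e2 (1 - s1) by rewrite lt_min e20 subr_gt0.
near=> j; have jm : j.+1%:R^-1 <= Num.min e2 (1 - s1).
  by apply: ltW; near: j; exact: near_infty_natSinv_lt (PosNum m0).
move: jm; rewrite le_min => /andP[je js].
have small t : 0 <= t < s1 -> `|uj j t| <= e2 /\ `|vj j t| <= e2.
  move=> /andP[t0 ts]; have h : cabs (F (phi j) (rc t) - l t) <= e2.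
    by apply: le_trans (Hl j t _) je; rewrite t0 lerBrDr addrC -lerBrDr (le_trans js)//
      lerD2l lerN2 ltW.
  split; apply: le_trans h; rewrite /uj /vj /u /v.
    by rewrite -cReN -cReD; exact: Re_le_cabs.
  by rewrite -cImN -cImD; exact: Im_le_cabs.
have large t : s1 <= t < 1 -> `|uj j t| <= 2 * L * (1 - t) `^ (1 - alpha) /\
    `|vj j t| <= 2 * L * (1 - t) `^ (1 - alpha).
  move=> /andP[st t1]; have Dt : D t by rewrite /= in_itv/= t1 (le_trans s10).
  have [h1 h2] := uvL t Dt; have [h3 h4] := traceL (F (phi j)) M (aF _) (FM _) t Dt.
  have -> : 2 * L * (1 - t) `^ (1 - alpha) =
    L * (1 - t) `^ (1 - alpha) + L * (1 - t) `^ (1 - alpha) by ring.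
  by split; apply: (le_trans (ler_normB _ _)); exact: lerD.
have m1 : measurable_fun D (uj j : measurableTypeR R -> R) by exact: measurable_funB.
have m2 : measurable_fun D (vj j : measurableTypeR R -> R) by exact: measurable_funB.
have L20 : 0 <= 2 * L by rewrite mulr_ge0.
have [_ _] := HK s1 e2 (2 * L) e1 (uj j) (vj j) (fun z => G (phi j) z - g z)
  s101 (ltW e20) L20 (ltW e10) cs1 m1 m2 small large (GE j).
move=> /le_trans; apply; rewrite lee_fin.
have h1 : e1 * (2 * L * K + 1) = e / 16 by rewrite /e1; field; rewrite gt_eqF.
have h2 : e2 * ((1 - s1) ^- 2 * mass mu 0 + 1) = e / 16.
  by rewrite /e2 -mulrA; congr (_ * _); rewrite invfM -mulrA mulVf ?mulr1// gt_eqF.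
have -> : e2 / (1 - s1) ^+ 2 * mass mu 0 + 2 * L * e1 * K =
  e2 * ((1 - s1) ^- 2 * mass mu 0) + e1 * (2 * L * K) by ring.
move: h1 h2; rewrite !mulrDr !mulr1; lra.
Unshelve. all: by end_near. Qed.

Lemma compact_bmoa_bloch : compact_operator (hankel mu) (bloch_norm alpha) (@bmoa_norm R) ->
  compact_operator (hankel mu) (bloch_norm alpha) (bloch_norm 1).
Proof.
have sub F : disc_space (@bmoa_norm R) F -> disc_space (bloch_norm 1) F.
  move=> [aF FB]; split => //; have [M FM] := lty_real (bmoa_norm_ge0 F) FB.
  by apply: le_lt_trans (bloch_le_bmoa aF FM) _; rewrite ltry.
move=> [c1 c2]; split=> [F /c1[G GB FG]|F G FB FM FG].
  by exists G => //; exact: sub.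
have [phi [g [phi_incr gB cvg]]] := c2 F G FB FM FG.
exists phi, g; split => //; first exact: sub.
move/cvge0P : cvg => /(_ (fun n => bmoa_norm_ge0 _)) cvg.
apply/cvge0P => [n|e e0]; first exact: bloch_norm_ge0'.
apply: filterS (cvg e e0) => n; apply: bloch_le_bmoa.
(* [G n] is an arbitrary representative of the image; its analyticity is read off the relation
   [hankel]. *)
have aG : analytic_on_disc (G (phi n)).
  have [a [b [_ _ bG]]] := FG (phi n); have [gb Gb] := power_series_geo bG.
  apply: (@hol_analytic _ _ (psum (dcoef b))).
  by apply: hol_ext (psum_hol gb) => z /Gb.
have [ag _] := gB; exact: (hol_analytic (holB (analytic_hol aG) (analytic_hol ag))).
Qed.

End Compactness.

(** * Test functions and necessity *)

Section TestFunctions.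
Context {R : realType}.
Local Notation C := (Cpx R).
Local Notation rc := (real_complex R).
Implicit Types (z w x : C) (F G : C -> C) (b s t d e L A M : R) (n N k p : nat).

Lemma gt0_powRD (x a b : R) : 0 < x -> x `^ (a + b) = x `^ a * x `^ b.
Proof. by move=> x0; rewrite powRD// (gt_eqF x0) implybT. Qed.

(** Past some index the perturbation is below [e / 2 * (1 - q)], whose accumulated effect under the
    contraction stays below [e / 2]. *)
Lemma contraction_cvg0 (r dl : nat -> R) (q : R) : 0 <= q < 1 -> (forall n, 0 <= r n) ->
  (forall n, r n.+1 <= q * r n + dl n) -> dl @ \oo --> 0 -> r @ \oo --> 0.
Proof.
move=> /andP[q0 q1] r0 rS d0; apply/cvgrPdist_le => e e0.
have q10 : 0 < 1 - q by rewrite subr_gt0.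
have /cvgrPdist_le/(_ (e / 2 * (1 - q))) := d0.
rewrite mulr_gt0 ?divr_gt0// => /(_ isT)[N _ HN].
have rN k : r (N + k)%N <= q ^+ k * r N + e / 2.
  elim: k => [|k IH]; first by rewrite addn0 expr0 mul1r lerDl ltW// divr_gt0.
  rewrite addnS (le_trans (rS _))//.
  have : dl (N + k)%N <= e / 2 * (1 - q).
    by have := HN (N + k)%N (leq_addr _ _); rewrite /= sub0r normrN; apply: le_trans; exact: ler_norm.
  have := ler_wpM2l q0 IH; rewrite mulrDr mulrA -exprS; lra.
have qn1 : `|q| < 1 by rewrite ger0_norm.
have /cvgrPdist_le/(_ (e / 2)) := @cvg_geometric R (r N) q qn1.
rewrite divr_gt0// => /(_ isT)[N' _ HN'].
exists (N + N')%N => // n /= nN.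
rewrite sub0r normrN ger0_norm//.
have nE : n = (N + (n - N))%N by rewrite subnKC// (leq_trans _ nN)// leq_addr.
rewrite nE (le_trans (rN _))// [leRHS]splitr lerD2r.
have nN' : (N' <= n - N)%N by rewrite leq_subRL ?(leq_trans _ nN) ?leq_addr.
have := HN' _ nN'.
by rewrite /= sub0r normrN (mulrC (r N)); apply: le_trans; exact: ler_norm.
Qed.

Lemma affine_rec_cvg (D E : nat -> C) x (l : C) : cabs x < 1 ->
  (forall n, D n.+1 = E n + x * D n) -> E @ \oo --> l -> D @ \oo --> l / (1 - x).
Proof.
move=> x1 DS El; have x10 : 1 - x != 0.
  by rewrite -cabs_gt0 (lt_le_trans _ (cabs_dist _ _))// cabs1 subr_gt0.
have H : (fun n => cabs (D n - l / (1 - x))) @ \oo --> 0.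
  apply: (@contraction_cvg0 _ (fun n => cabs (E n - l)) (cabs x)).
  - by rewrite cabs_ge0.
  - by move=> n; exact: cabs_ge0.
  - move=> n; have -> : D n.+1 - l / (1 - x) = x * (D n - l / (1 - x)) + (E n - l).
      by rewrite DS; field.
    by rewrite (le_trans (cabsD _ _))// cabsM.
  - apply/cvgrPdist_le => e e0; move/cvgCP_le : El => /(_ e e0).
    by apply: filterS => n; rewrite sub0r normrN ger0_norm ?cabs_ge0.
apply/cvgCP_le => e e0; move/cvgrPdist_le : H => /(_ e e0).
by apply: filterS => n; rewrite sub0r normrN ger0_norm ?cabs_ge0.
Qed.

(** Induction on [p]: by Pascal's rule the partial sums [D] for [p.+1] and [E] for [p] satisfy
    [D n.+1 = E n.+1 + x * D n], and [affine_rec_cvg] divides the limit by [1 - x]. *)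
Lemma binomial_series p x : cabs x < 1 ->
  series (fun k => 'C(k + p, p)%:R * x ^+ k) @ \oo --> ((1 - x)^-1) ^+ p.+1.
Proof.
move=> x1; elim: p => [|p IH].
  have -> : (1 - x)^-1 ^+ 1 = 1 / (1 - x) by rewrite expr1 div1r.
  apply: (@affine_rec_cvg _ (fun=> 1)) => //; last exact: cvgC_cst.
  move=> n; rewrite /series/= big_nat_recl//= addn0 bin0 mul1r expr0 mulr_sumr; congr (_ + _).
  by apply: eq_bigr => k _; rewrite !addn0 !bin0 !mul1r exprS.
rewrite exprSr; apply: (@affine_rec_cvg _
  (fun n => series (fun k => 'C(k + p, p)%:R * x ^+ k) n.+1)) => //; last first.
  by have := IH; rewrite -cvg_shiftS.
move=> n; rewrite /series/= !(big_nat_recl n)//= !add0n !binn -addrA; congr (_ + _).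
rewrite mulr_sumr -big_split/=; apply: eq_bigr => k _.
rewrite [(k.+1 + p.+1)%N]addSn binS natrD mulrDl [RHS]addrC exprS; congr (_ + _).
  by rewrite mulrCA.
by rewrite addSnnS.
Qed.

Lemma cderivX F z (d : C) n : is_derive z (1 : C) F d ->
  is_derive z (1 : C) (fun w => F w ^+ n.+1) (n.+1%:R * F z ^+ n * d).
Proof.
move=> dF; elim: n => [|n IH].
  by rewrite expr0 mulr1 mul1r.
have := cderivM dF IH.
have -> : (fun w => F w * F w ^+ n.+1) = (fun w => F w ^+ n.+2).
  by apply/funext => w; rewrite [RHS]exprS.
have -> : d * F z ^+ n.+1 + F z * (n.+1%:R * F z ^+ n * d) = n.+2%:R * F z ^+ n.+1 * d.
  by rewrite exprS -[n.+2%:R]natr1; ring.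
by apply.
Qed.

Variables (alpha : R) (p : nat).
Hypothesis alpha1 : 1 < alpha.
Hypothesis alphap : alpha <= p.+1%:R.

(* Normalizes the test function [tfun b] to have bounded norm in the Bloch type
   space while [tfun b b] is of order [(1 - b) ^ (1 - alpha)]. *)
Definition tconst b : R := (1 - b) `^ (p.+2%:R - alpha).

Definition tfun b z : C := rc (tconst b) * ((1 - rc b * z)^-1) ^+ p.+1.

Definition tcoef b k : R := tconst b * ('C(k + p, p)%:R * b ^+ k).

Lemma tconst_ge0 b : 0 <= tconst b. Proof. exact: powR_ge0. Qed.

Lemma tcoef_ge0 b k : 0 <= b -> 0 <= tcoef b k.
Proof. by move=> b0; rewrite mulr_ge0 ?tconst_ge0// mulr_ge0// exprn_ge0. Qed.

Lemma tfun_series b : 0 <= b < 1 -> power_series_on_disc (fun k => rc (tcoef b k)) (tfun b).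
Proof.
move=> /andP[b0 b1] z zD; have x1 : cabs (rc b * z) < 1.
  by rewrite cabsM cabs_rc ger0_norm// (le_lt_trans _ zD)// ler_piMl ?cabs_ge0// ltW.
have := cvgCM (@cvgC_cst _ _ \oo _ (rc (tconst b))) (@binomial_series p _ x1).
set X := (fun N => _ * _) => h.
suff <- : X = series (fun k => rc (tcoef b k) * z ^+ k) by exact: h.
apply/funext => N; rewrite /X /series/= mulr_sumr; apply: eq_bigr => k _.
by rewrite /tcoef !rcM rcX exprMn rmorph_nat !mulrA.
Qed.

Lemma tfun_real_series b t : 0 <= b < 1 -> 0 <= t < 1 ->
  series (fun k => tcoef b k * t ^+ k) @ \oo --> tconst b / (1 - b * t) ^+ p.+1.
Proof.
move=> b01 t01; have /cvgC_ReIm[+ _] := tfun_series b01 (disc_rc t01).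
have -> : tfun b (rc t) = rc (tconst b / (1 - b * t) ^+ p.+1).
  by rewrite /tfun rcM -rcM -(rmorph1 rc) -rcB exprVn -rcX fmorphV.
have -> : (fun N => complex.Re (series (fun k => rc (tcoef b k) * rc t ^+ k) N)) =
    series (fun k => tcoef b k * t ^+ k); last by [].
by apply/funext => N; rewrite /series/= Re_sum; apply: eq_bigr => k _; rewrite -rcX -rcM.
Qed.

Lemma tfun_analytic b : 0 <= b < 1 -> analytic_on_disc (tfun b).
Proof.
move=> /tfun_series/power_series_geo[ga fa].
apply: (@hol_analytic _ _ (psum (dcoef (fun k => rc (tcoef b k))))).
by apply: hol_ext (psum_hol ga) => z /fa.
Qed.

(** [X = |1 - b z|] dominates both [1 - b] and [1 - |z|], so splitting [X^(p + 2)] with the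
    exponents [p + 2 - alpha] and [alpha] cancels the denominator of the derivative. The summand 1
    bounds the value at 0, and [2^alpha] comes from [1 - |z|^2 <= 2 (1 - |z|)]. *)
Lemma tfun_bloch b : 0 <= b < 1 ->
  (bloch_norm alpha (tfun b) <= (1 + p.+1%:R * 2 `^ alpha)%:E)%E.
Proof.
move=> /andP[b0 b1]; have c1 : 0 < 1 - b by rewrite subr_gt0.
have al0 : 0 <= alpha by exact: le_trans ler01 (ltW alpha1).
have pal : 0 <= p.+2%:R - alpha by rewrite subr_ge0 (le_trans alphap)// ler_nat.
apply/bloch_normP; exists (p.+1%:R * 2 `^ alpha); split.
  rewrite lerD2r /tfun mulr0 subr0 invr1 expr1n mulr1 cabs_rc ger0_norm ?tconst_ge0//.
  rewrite -[leRHS](powRr0 (1 - b)); apply: ger_powR => //.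
  by rewrite c1 gerBl.
move=> z zD; have z1 : 0 < 1 - cabs z by rewrite subr_gt0.
set X := cabs (1 - rc b * z).
have Xb : 1 - b <= X.
  apply: le_trans (cabs_dist _ _); rewrite cabs1 cabsM cabs_rc ger0_norm// lerD2l lerN2.
  by rewrite ler_piMr// ltW.
have Xz : 1 - cabs z <= X.
  apply: le_trans (cabs_dist _ _); rewrite cabs1 cabsM cabs_rc ger0_norm// lerD2l lerN2.
  by rewrite ler_piMl ?cabs_ge0// ltW.
have X0 : 0 < X := lt_le_trans c1 Xb.
have h0 : 1 - rc b * z != 0 by rewrite -cabs_gt0.
have dh : is_derive z (1 : C) (fun w : C => (1 - rc b * w : C)) (- rc b).
  by have := cderivB (cderiv_cst 1 z) (cderivZ (rc b) (cderiv_id z)); rewrite mulr1 sub0r.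
have dV := @cderivV R (fun w : C => (1 - rc b * w : C)) z (- rc b) h0 dh.
have := cderivZ (rc (tconst b)) (@cderivX _ z _ p dV).
move=> /is_cderive1 ->; rewrite opprK !cabsM cabs_natr !cabs_rc !cabsX !cabsV cabsX -/X.
rewrite (ger0_norm b0) (ger0_norm (tconst_ge0 b)).
have -> : tconst b * (p.+1%:R * (X^-1) ^+ p * (b / X ^+ 2)) =
    p.+1%:R * (b * (tconst b / X ^+ p.+2)).
  by rewrite exprVn !exprS; field; rewrite expf_neq0 ?gt_eqF.
rewrite -!mulrA ler_wpM2l//.
have e1 : (1 - cabs z ^+ 2) `^ alpha <= 2 `^ alpha * (1 - cabs z) `^ alpha.
  rewrite -powRM ?(ltW z1)// ge0_ler_powR ?nnegrE ?mulr_ge0 ?(ltW z1)//.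
    by rewrite (le_trans (ltW z1))// one_sub_sqr_ge// cabs_ge0.
  have := cabs_ge0 z; nra.
have e2 : tconst b * (1 - cabs z) `^ alpha <= X ^+ p.+2.
  have -> : X ^+ p.+2 = X `^ (p.+2%:R - alpha) * X `^ alpha.
    by rewrite -gt0_powRD// subrK powR_mulrn// ltW.
  by rewrite ler_pM ?powR_ge0// ge0_ler_powR ?nnegrE// ltW.
apply: (@le_trans _ _ (1 * (tconst b * (X ^- p.+2 * (2 `^ alpha * (1 - cabs z) `^ alpha))))).
  apply: ler_pM => //; [|by rewrite ltW|].
    by rewrite !mulr_ge0 ?tconst_ge0 ?powR_ge0 ?invr_ge0 ?exprn_ge0// ltW.
  by rewrite ler_wpM2l ?tconst_ge0// ler_wpM2l// invr_ge0 exprn_ge0// ltW.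
rewrite mul1r (_ : _ * _ = 2 `^ alpha * ((tconst b * (1 - cabs z) `^ alpha) / X ^+ p.+2)); last by ring.
by rewrite ler_piMr ?powR_ge0// ler_pdivrMr ?exprn_gt0// mul1r.
Qed.

(** From [1 - b^2 <= 2 (1 - b)], which costs the factor [2 ^+ p.+1]. *)
Lemma tfun_at_b b : 0 <= b < 1 -> (1 - b) `^ (1 - alpha) <=
  2 ^+ p.+1 * (tconst b / (1 - b * b) ^+ p.+1).
Proof.
move=> /andP[b0 b1]; have c1 : 0 < 1 - b by rewrite subr_gt0.
have bb : 1 - b * b = (1 - b) * (1 + b) by ring.
have b2 : 0 < 1 + b by rewrite ltr_wpDr.
have -> : tconst b = (1 - b) `^ (1 - alpha) * (1 - b) ^+ p.+1.
  rewrite -powR_mulrn ?(ltW c1)// -gt0_powRD//; congr (_ `^ _).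
  by rewrite -[p.+2%:R]natr1; ring.
rewrite (_ : 2 ^+ p.+1 * _ = (1 - b) `^ (1 - alpha) * (2 / (1 + b)) ^+ p.+1); last first.
  rewrite bb !exprMn exprVn; field.
  by rewrite !expf_neq0 ?gt_eqF.
rewrite ler_peMr ?powR_ge0//.
by rewrite exprn_ege1// ler_pdivlMr// mul1r; lra.
Qed.

(** Half a power of [1 - t] is given up for half a power of [1 - b]. The remaining weight in [t] is
    still integrable under a Carleson condition, so integrals of the test functions vanish as [b]
    tends to 1. *)
Lemma tfun_small b t : 0 <= b < 1 -> 0 <= t < 1 ->
  tconst b / (1 - b * t) ^+ p.+1 <= (1 - b) `^ 2^-1 * (1 - t) `^ (- (alpha - 2^-1)).
Proof.
move=> /andP[b0 b1] /andP[t0 t1]; have c1 : 0 < 1 - b by rewrite subr_gt0.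
have c2 : 0 < 1 - t by rewrite subr_gt0.
set X := 1 - b * t.
have Xb : 1 - b <= X by rewrite lerD2l lerN2 ler_piMr// ltW.
have Xt : 1 - t <= X by rewrite lerD2l lerN2 ler_piMl// ltW.
have X0 : 0 < X := lt_le_trans c1 Xb.
have q0 : 0 <= p.+1%:R + 2^-1 - alpha.
  by rewrite subr_ge0 (le_trans alphap)// lerDl invr_ge0.
have -> : tconst b = (1 - b) `^ 2^-1 * (1 - b) `^ (p.+1%:R + 2^-1 - alpha).
  rewrite -gt0_powRD//; congr (_ `^ _).
  by rewrite -[p.+2%:R]natr1; field.
rewrite -mulrA ler_wpM2l ?powR_ge0//.
apply: (@le_trans _ _ (X `^ (- (alpha - 2^-1)))); last first.
  apply: powRN_le => //; by rewrite subr_ge0 (le_trans _ (ltW alpha1))// invf_le1// ler1n.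
rewrite ler_pdivrMr ?exprn_gt0//.
have -> : X `^ (- (alpha - 2^-1)) * X ^+ p.+1 = X `^ (p.+1%:R + 2^-1 - alpha).
  rewrite -powR_mulrn ?(ltW X0)// -gt0_powRD//; congr (_ `^ _); ring.
by rewrite ge0_ler_powR ?nnegrE// ltW.
Qed.

End TestFunctions.

(** * Images of the test functions *)

Section Necessity.
Context {R : realType}.
Variable mu : {finite_measure set (measurableTypeR R) -> \bar R}.
Variables (alpha : R) (p : nat).
Hypothesis alpha1 : 1 < alpha.
Hypothesis alphap : alpha <= p.+1%:R.
Local Notation C := (Cpx R).
Local Notation rc := (real_complex R).
Local Notation seg s := ([set` `[s%R, 1%R[%R] : set (measurableTypeR R)).
Local Notation D := (seg 0).
Local Notation tfun := (tfun alpha p).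
Local Notation tcoef := (tcoef alpha p).
Local Notation tconst := (tconst alpha p).
Implicit Types (z w : C) (F G g : C -> C) (b s t d e L A M : R) (n N k : nat).

Lemma series_rc (x : nat -> R) : series (fun k => rc (x k) : C) = (fun N => rc (series x N)).
Proof. by apply/funext => N; rewrite /series/= rmorph_sum. Qed.

Lemma cvgC_rc (x : nat -> R) (l : C) : (fun n => rc (x n) : C) @ \oo --> l ->
  x @ \oo --> complex.Re l /\ l = rc (complex.Re l).
Proof.
move=> /cvgC_ReIm[h1 h2]; split; first exact: h1.
have h0 : (fun n => complex.Im (rc (x n))) @ \oo --> (0 : R) by exact: cvg_cst.
by apply/eqP; rewrite eq_complex/= eqxx/=; apply/eqP; exact: (cvg_unique _ h2 h0).
Qed.

Lemma moment_ge b j : 0 <= b < 1 -> b ^+ j * mass mu b <= moment mu j.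
Proof.
move=> /andP[b0 b1].
have mD : measurable D by exact: measurable_itv.
have mb : measurable (seg b) by exact: measurable_itv.
have ij := integrable_exprn mu j.
have mj : measurable_fun D (fun t : measurableTypeR R => (t ^+ j)%:E).
  by apply/measurable_EFinP; exact: measurable_exprn.
have sub : seg b `<=` D by move=> t; rewrite /= !in_itv/= => /andP[/(le_trans b0) -> ->].
rewrite -lee_fin /moment fineK; last exact: integrable_fin_num.
apply: (@le_trans _ _ (\int[mu]_(t in seg b) (t ^+ j)%:E)%E); last first.
  apply: ge0_subset_integral => // t /D01/andP[t0 _].
  by rewrite lee_fin exprn_ge0.
apply: (@le_trans _ _ (\int[mu]_(t in seg b) (cst (b ^+ j)%:E t))%E).
  by rewrite integral_cst// EFinM -massE.
apply: ge0_le_integral => //.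
- by move=> t _; rewrite lee_fin exprn_ge0.
- exact: measurable_funS mj.
- by move=> t; rewrite /= in_itv/= => /andP[bt _]; rewrite lee_fin lerXn2r// nnegrE (le_trans b0).
Qed.

(** [hankel] only asserts that some coefficient sequence exists; uniqueness of Taylor coefficients
    identifies it with [tcoef b], so the image has real coefficients. *)
Lemma tfun_image b g : 0 <= b < 1 -> hankel mu (tfun b) g -> exists c : nat -> R,
  [/\ geo (fun n => rc (c n) : C),
      forall n, series (fun k => moment mu (n + k) * tcoef b k) @ \oo --> c n &
      forall z, disc z -> g z = psum (fun n => rc (c n)) z].
Proof.
move=> b01 [a [bn [aF abn /power_series_geo[gbn gE]]]].
have [ga aE] := power_series_geo aF.
have [gt tE] := power_series_geo (@tfun_series R alpha p b b01).
have E : a = (fun k => rc (tcoef b k)).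
  by apply: psum_coef_unique => // z zD; rewrite -aE// -tE.
have H n : series (fun k => moment mu (n + k) * tcoef b k) @ \oo --> complex.Re (bn n) /\
    bn n = rc (complex.Re (bn n)).
  apply: cvgC_rc; rewrite -series_rc; have := abn n; rewrite E.
  set X := series _; suff <- : X = series (fun k => rc (moment mu (n + k) * tcoef b k)) by [].
  by congr series; apply/funext => k; rewrite rcM.
have bE : bn = (fun n => rc (complex.Re (bn n))) by apply/funext => n; exact: (H n).2.
exists (fun n => complex.Re (bn n)); split.
- by rewrite -bE.
- by move=> n; exact: (H n).1.
- by rewrite -bE.
Qed.

Lemma psum_ext_deriv a g : geo a -> (forall z, disc z -> g z = psum a z) ->
  forall z, disc z -> derive1 g z = psum (dcoef a) z.
Proof.
move=> ga gE z zD; apply: is_cderive1.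
exact: (@hol_ext _ (psum a) g _ (fun z h => esym (gE z h)) (psum_hol ga) z zD).1.
Qed.

Lemma series_natS (x : R) : 0 <= x < 1 ->
  series (fun n => n.+1%:R * x ^+ n) @ \oo --> (1 - x) ^- 2.
Proof.
move=> x01; have x1 : cabs (rc x : C) < 1 by exact: disc_rc.
have := @binomial_series R 1 (rc x) x1.
have -> : series (fun k => 'C(k + 1, 1)%:R * rc x ^+ k) =
    (fun N => rc (series (fun n => n.+1%:R * x ^+ n) N)).
  rewrite -series_rc; congr series; apply/funext => k.
  by rewrite bin1 addn1 rcM rcX rmorph_nat.
have -> : (1 - rc x)^-1 ^+ 2 = rc ((1 - x) ^- 2) :> C.
  by rewrite -(rmorph1 rc) -rcB -exprVn rcX fmorphV.
by move=> /cvgC_rc[].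
Qed.

(** Keeping only the mass of [[b, 1)] in each moment gives [c n >= mass * f * b^n], with [f] the
    value of the test function at [b]; summing [(n + 1) c (n + 1) b^n] yields
    [mass * f * b / (1 - b^2)^2]. The constant is [2 ^+ p.+1] from [tfun_at_b] times 4 from
    [1 - b^2 <= 4 b (1 - b)], where [b >= 1/2] enters. *)
Lemma tfun_image_lower b g : 2^-1 <= b < 1 -> hankel mu (tfun b) g ->
  mass mu b <= 2 ^+ p.+3 * (cabs (derive1 g (rc b)) * (1 - cabs (rc b : C) ^+ 2)) *
    (1 - b) `^ alpha.
Proof.
move=> /andP[b2 b1] Hg; have b0 : 0 < b by rewrite (lt_le_trans _ b2)// invr_gt0.
have b01 : 0 <= b < 1 by rewrite ltW.
have c1 : 0 < 1 - b by rewrite subr_gt0.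
have bb01 : 0 <= b * b < 1.
  by rewrite mulr_ge0 ?(ltW b0)//= (le_lt_trans _ b1)// ler_piMr// ltW.
have bb1 : 0 < 1 - b * b by rewrite subr_gt0; case/andP: bb01.
have [c [gc cE gE]] := tfun_image b01 Hg.
rewrite (psum_ext_deriv gc gE (disc_rc b01)) cabs_rc (ger0_norm (ltW b0)).
pose f := tconst b / (1 - b * b) ^+ p.+1.
have f0 : 0 <= f by rewrite divr_ge0 ?tconst_ge0// exprn_ge0// ltW.
have m0 := mass_ge0 mu b.
have cn n : mass mu b * f * b ^+ n <= c n.
  have h : (fun N => b ^+ n * mass mu b * series (fun k => tcoef b k * b ^+ k) N) @ \oo -->
      b ^+ n * mass mu b * f.
    by apply: cvgM; [exact: cvg_cst|exact: (@tfun_real_series R alpha p b b b01 b01)].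
  rewrite (_ : mass mu b * f * b ^+ n = b ^+ n * mass mu b * f); last by ring.
  apply: (ler_cvg_to h (cE n)); apply: nearW => N.
  rewrite /series/= mulr_sumr; apply: ler_sum => k _.
  rewrite (_ : _ * _ = b ^+ (n + k) * mass mu b * tcoef b k); last by rewrite exprD; ring.
  by rewrite ler_wpM2r ?tcoef_ge0 ?(ltW b0)//; exact: moment_ge.
have gd : geo (dcoef (fun n => rc (c n) : C)) by exact: geo_deriv.
have /cvgC_ReIm[hr _] := psum_cvg gd (disc_rc b01).
have low : mass mu b * f * b * (1 - b * b) ^- 2 <=
    complex.Re (psum (dcoef (fun n => rc (c n))) (rc b)).
  have h : (fun N => mass mu b * f * b * series (fun n => n.+1%:R * (b * b) ^+ n) N) @ \oo -->
      mass mu b * f * b * (1 - b * b) ^- 2.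
    by apply: cvgM; [exact: cvg_cst|exact: series_natS].
  apply: (ler_cvg_to h hr).
  apply: nearW => N; rewrite /series/= mulr_sumr Re_sum; apply: ler_sum => k _.
  have -> : complex.Re (dcoef (fun n => rc (c n)) k * rc b ^+ k) = k.+1%:R * c k.+1 * b ^+ k.
    by rewrite /dcoef -rcX -(rmorph_nat rc) -!rcM.
  have := cn k.+1; have k0 : 0 <= k.+1%:R * b ^+ k by rewrite mulr_ge0// exprn_ge0// ltW.
  move=> /(ler_wpM2l k0); rewrite exprMn exprS.
  rewrite (_ : _ * (mass mu b * f * (b * b ^+ k)) =
    mass mu b * f * b * (k.+1%:R * (b ^+ k * b ^+ k))); last by ring.
  by rewrite (_ : k.+1%:R * b ^+ k * c k.+1 = k.+1%:R * c k.+1 * b ^+ k); last by ring.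
have low' : mass mu b * f * b / (1 - b * b) <=
    cabs (psum (dcoef (fun n => rc (c n))) (rc b)) * (1 - b ^+ 2).
  rewrite expr2; apply: le_trans (ler_wpM2r (ltW bb1) (le_trans (ler_norm _) (Re_le_cabs _))).
  apply: le_trans (ler_wpM2r (ltW bb1) low).
  by rewrite le_eqVlt; apply/orP; left; apply/eqP; field; rewrite gt_eqF.
have fb := tfun_at_b alpha p b01.
apply: (@le_trans _ _ (2 ^+ p.+3 * (mass mu b * f * b / (1 - b * b)) * (1 - b) `^ alpha)); last first.
  by rewrite ler_wpM2r ?powR_ge0// ler_wpM2l// exprn_ge0.
have aE : (1 - b) `^ (1 - alpha) * (1 - b) `^ alpha = 1 - b.
  by rewrite -gt0_powRD// subrK powRr1// ltW.
have := ler_wpM2r (powR_ge0 (1 - b) alpha) fb; rewrite aE -/f => fb'.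
rewrite (_ : 2 ^+ p.+3 * _ * _ = mass mu b * (4 * b / (1 - b * b)) *
  (2 ^+ p.+1 * f * (1 - b) `^ alpha)); last by rewrite !exprS; field; rewrite gt_eqF.
apply: (@le_trans _ _ (mass mu b * (4 * b / (1 - b * b)) * (1 - b))); last first.
  by rewrite ler_wpM2l// !mulr_ge0// ?(ltW b0)// invr_ge0 ltW.
rewrite -mulrA ler_peMr// mulrAC ler_pdivlMr// mul1r.
have : 1 <= 2 * b by have := ler_wpM2l (ler0n R 2) b2; rewrite divff.
have : 0 <= (2 * b - 1) * (1 - b) -> 1 <= 2 * b -> 1 - b * b <= 4 * b * (1 - b) by nra.
by move=> h h1; apply: h => //; apply: mulr_ge0; rewrite ?subr_ge0 ?(ltW b1).
Qed.

(** By nonnegativity every coefficient of the image is at most the integral of [tfun b] over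
    [[0, 1)], which [tfun_small] bounds; the sum of [(n + 1) |z|^n] supplies the last factor. *)
Lemma tfun_image_upper A : 0 <= A -> carleson_from mu alpha 0 A -> exists Q : R, 0 <= Q /\
  forall b g z, 0 <= b < 1 -> hankel mu (tfun b) g -> disc z ->
    cabs (derive1 g z) <= Q * (1 - b) `^ 2^-1 * (1 - cabs z) ^- 2.
Proof.
move=> A0 cA; have mD : measurable D by exact: measurable_itv.
have iw := integrable_powR_half alpha1 A0 cA.
set w := (fun t : R => _) in iw; pose Q := \int[mu]_(t in D) w t.
have Q0 : 0 <= Q by apply: Rintegral_ge0 => t _; exact: powR_ge0.
exists Q; split => // b g z b01 Hg zD; have /andP[b0 b1] := b01.
have [c [gc cE gE]] := tfun_image b01 Hg.
have c0 n : 0 <= c n.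
  apply: (cvgr_to_ge (cE n)); apply: nearW => N; rewrite /series/=; apply: sumr_ge0 => k _.
  by rewrite mulr_ge0 ?moment_ge0 ?tcoef_ge0.
set P := (1 - b) `^ 2^-1; have P0 : 0 <= P by exact: powR_ge0.
have iPw : mu.-integrable D (EFin \o (fun t => P * w t)) by exact: (integrableZl mD P iw).
have cQ n : c n <= Q * P.
  apply: (cvgr_to_le (cE n)); apply: nearW => N; rewrite /series/=.
  have ih k : mu.-integrable D (EFin \o (fun t => tcoef b k * t ^+ (n + k))).
    exact: (integrableZl mD (tcoef b k) (integrable_exprn mu (n + k))).
  have [ih' ihE] := Rintegral_sum N ih.
  rewrite (_ : \sum_(0 <= k < N) _ =
      \int[mu]_(t in D) \sum_(0 <= k < N) tcoef b k * t ^+ (n + k)); last first.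
    rewrite ihE; apply: eq_bigr => k _.
    by rewrite mulrC (@RintegralZl _ _ _ mu D _ (tcoef b k) mD (integrable_exprn mu (n + k))).
  rewrite mulrC /Q -(@RintegralZl _ _ _ mu D _ P mD iw); apply: le_Rintegral => // t Dt.
  have t01 := D01 Dt; have /andP[t0 t1] := t01.
  apply: le_trans (tfun_small alpha1 alphap b01 t01).
  have h := @tfun_real_series R alpha p b t b01 t01.
  apply: (@le_trans _ _ (series (fun k => tcoef b k * t ^+ k) N)).
    rewrite /series/=; apply: ler_sum => k _; rewrite ler_wpM2l ?tcoef_ge0//.
    by rewrite exprD ler_piMl ?exprn_ge0// exprn_ile1// ltW.
  rewrite -(cvg_lim _ h)//; apply: nondecreasing_cvgn_le; last by apply/cvg_ex; eexists; exact: h.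
  apply: nondecreasing_series => k _ _; by rewrite mulr_ge0 ?tcoef_ge0// exprn_ge0.
rewrite (psum_ext_deriv gc gE zD).
have gd : geo (dcoef (fun n => rc (c n) : C)) by exact: geo_deriv.
have z01 : 0 <= cabs z < 1 by rewrite cabs_ge0.
have hs := series_natS z01.
have part N : cabs (series (fun n => dcoef (fun n => rc (c n)) n * z ^+ n) N) <=
    Q * P * (1 - cabs z) ^- 2.
  apply: (@le_trans _ _ (Q * P * series (fun n => n.+1%:R * cabs z ^+ n) N)).
    rewrite /series/= mulr_sumr; apply: (le_trans (cabs_sum _ _ _)); apply: ler_sum => k _.
    rewrite /dcoef !cabsM cabs_natr cabs_rc cabsX (ger0_norm (c0 _)).
    rewrite [leLHS](_ : _ = c k.+1 * (k.+1%:R * cabs z ^+ k)); last by ring.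
    apply: ler_wpM2r; last exact: cQ.
    by rewrite mulr_ge0// exprn_ge0// cabs_ge0.
  rewrite ler_wpM2l ?mulr_ge0// -(cvg_lim _ hs)//.
  apply: nondecreasing_cvgn_le; last by apply/cvg_ex; eexists; exact: hs.
  by apply: nondecreasing_series => k _ _; rewrite mulr_ge0// exprn_ge0// cabs_ge0.
apply/ler_addgt0Pr => e e0.
have /cvgCP_le/(_ e e0)[N _ /(_ N (leqnn N)) HN] := psum_cvg gd zD.
rewrite -(subrK (series (fun n => dcoef (fun n => rc (c n)) n * z ^+ n) N) (psum _ z)) addrC.
by apply: (le_trans (cabsD _ _)); rewrite lerD// cabs_distC.
Qed.

End Necessity.

(** * From compactness to the vanishing Carleson condition *)

Section CompactnessNecessity.
Context {R : realType}.
Variable mu : {finite_measure set (measurableTypeR R) -> \bar R}.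
Variable alpha : R.
Hypothesis alpha1 : 1 < alpha.
Local Notation C := (Cpx R).
Local Notation rc := (real_complex R).
Implicit Types (z w : C) (F G g : C -> C) (b s t d e L A M : R) (n N k : nat).

Lemma one_sub_sqr_gt0 z : disc z -> 0 < 1 - cabs z ^+ 2.
Proof.
move=> zD; have z1 : 0 < 1 - cabs z by rewrite subr_gt0.
by rewrite (lt_le_trans z1)// one_sub_sqr_ge// cabs_ge0.
Qed.

Lemma not_carleson_seq (A : nat -> R) :
  (forall j s, 0 <= s < 1 -> ~ carleson_from mu alpha s (A j)) ->
  exists b : nat -> R, forall j, [/\ 2^-1 <= b j < 1, 1 - b j <= j.+1%:R^-1 &
    A j * (1 - b j) `^ alpha < mass mu (b j)].
Proof.
move=> nA; have H j : exists b : R, [/\ 2^-1 <= b < 1, 1 - b <= j.+1%:R^-1 &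
    A j * (1 - b) `^ alpha < mass mu b].
  have j2 : (j.+2%:R^-1 : R) <= 2^-1 by rewrite lef_pV2 ?posrE// ler_nat.
  have j0 : 0 < (j.+2%:R^-1 : R) by rewrite invr_gt0.
  (* The index is shifted by 2 so that [b j >= 1/2] already at [j = 0]. *)
  pose s : R := 1 - j.+2%:R^-1.
  have s01 : 0 <= s < 1.
    by rewrite /s subr_ge0 gtrBl j0 andbT (le_trans j2)// invf_le1// ler1n.
  have /existsNP[x /not_implyP[/andP[sx x1] /negP]] := nA j s s01.
  rewrite -ltNge => mx; exists x; split => //.
    rewrite x1 andbT; apply: le_trans sx; rewrite /s lerBrDr -lerBrDl.
    by rewrite (_ : 1 - 2^-1 = 2^-1 :> R)//; field.
  apply: (@le_trans _ _ j.+2%:R^-1); first by rewrite lerBlDr -lerBlDl.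
  by rewrite lef_pV2 ?posrE// ler_nat.
have /choice[b Hb] := H; by exists b.
Qed.

Lemma bloch_sub_deriv G g M z : analytic_on_disc G -> analytic_on_disc g ->
  (bloch_norm 1 (fun w => (G w - g w)%R) <= M%:E)%E -> disc z ->
  cabs (derive1 G z - derive1 g z) * (1 - cabs z ^+ 2) <= M.
Proof.
move=> /analytic_hol hG /analytic_hol hg H zD; have /bloch_normP[M1 [M1M /(_ z zD)]] := H.
rewrite (is_cderive1 (holB hG hg zD).1) powRr1; last exact: ltW (one_sub_sqr_gt0 zD).
by move=> /le_trans; apply; rewrite (le_trans _ M1M)// lerDr cabs_ge0.
Qed.

Lemma homo_ltn_ge_id (phi : nat -> nat) : {homo phi : m n / (m < n)%N} ->
  forall n, (n <= phi n)%N.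
Proof. by move=> phi_incr; elim=> [//|n IH]; exact: leq_ltn_trans IH (phi_incr _ _ _). Qed.

Variable p : nat.
Hypothesis alphap : alpha <= p.+1%:R.

(** What both rounds take from compactness: the limit survives only through its derivative [h], and
    norm convergence becomes weighted convergence of derivatives, uniform in [z] and hence usable at
    the moving point [b (phi n)]. *)
Lemma tfun_selection (b : nat -> R) : (forall j, 0 <= b j < 1) ->
  compact_operator (hankel mu) (bloch_norm alpha) (bloch_norm 1) ->
  exists (G : nat -> C -> C) (phi : nat -> nat) (h : C -> C) (B : R),
  [/\ forall j, hankel mu (tfun alpha p (b j)) (G j),
      forall n, (n <= phi n)%N,
      forall z, disc z -> cabs (h z) * (1 - cabs z ^+ 2) <= B &
      forall e, 0 < e -> \forall n \near \oo, forall z, disc z ->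
        cabs (derive1 (G (phi n)) z - h z) * (1 - cabs z ^+ 2) <= e].
Proof.
move=> b01 [c1 c2].
have Fj j : disc_space (bloch_norm alpha) (tfun alpha p (b j)).
  split; first exact: tfun_analytic.
  by apply: le_lt_trans (tfun_bloch alpha1 alphap (b01 j)) _; rewrite ltry.
have /choice[G HG] : forall j, exists g, disc_space (bloch_norm 1) g /\
    hankel mu (tfun alpha p (b j)) g.
  by move=> j; have [g gB gH] := c1 _ (Fj j); exists g.
have bd : exists M : R, forall n, (bloch_norm alpha (tfun alpha p (b n)) <= M%:E)%E.
  by eexists => n; exact: (tfun_bloch alpha1 alphap (b01 n)).
have [phi [g [phi_incr [ag gB] cvg]]] := c2 (fun j => tfun alpha p (b j)) G Fj bd
  (fun j => (HG j).2).
have [B HB] := lty_real (bloch_norm_ge0' 1 g) gB.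
exists G, phi, (derive1 g), B; split.
- by move=> j; exact: (HG j).2.
- exact: homo_ltn_ge_id.
- move=> z zD; have /bloch_normP[M1 [M1B /(_ z zD)]] := HB.
  rewrite powRr1; last exact: ltW (one_sub_sqr_gt0 zD).
  by move=> /le_trans; apply; rewrite (le_trans _ M1B)// lerDr cabs_ge0.
- move=> e e0; have /cvge0P := cvg; move=> /(_ (fun n => bloch_norm_ge0' _ _))/(_ e e0).
  apply: filterS => n hn z zD; have [[aG _] _] := HG (phi n).
  exact: (@bloch_sub_deriv (G (phi n)) g e z aG ag hn zD).
Qed.

(** Boundedness is recovered from a convergent subsequence. With thresholds [A j = j] the ratio at
    [b (phi n)] exceeds [phi n], yet the image is within 1 of a limit of seminorm at most [B], so
    [tfun_image_lower] caps the ratio. *)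
Lemma compact_bloch_carleson :
  compact_operator (hankel mu) (bloch_norm alpha) (bloch_norm 1) ->
  exists s A, 0 <= s < 1 /\ carleson_from mu alpha s A.
Proof.
move=> cH; apply: contrapT => nA.
have [b Hb] := @not_carleson_seq (fun j => j%:R)
  (fun j s s01 c => nA (ex_intro _ s (ex_intro _ j%:R (conj s01 c)))).
have b2 j : 2^-1 <= b j < 1 by case: (Hb j).
have b01 j : 0 <= b j < 1.
  by have /andP[h ->] := b2 j; rewrite (le_trans _ h)// invr_ge0.
have [G [phi [h [B [HG phin hB near_h]]]]] := tfun_selection b01 cH.
have [N _ HN] := near_h 1 ltr01.
pose Q : R := 2 ^+ p.+3 * (1 + B).
pose n := maxn N (Num.truncn Q).+1; have nN : (N <= n)%N by rewrite leq_maxl.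
have [/andP[_ b1] _ mb] := Hb (phi n).
have bD := @disc_rc R _ (b01 (phi n)).
have := HN n nN _ bD; have := hB _ bD.
have := tfun_image_lower (b2 (phi n)) (HG (phi n)).
set z := rc _; set d := derive1 _ _ => m1 hz dz.
have zq : 0 <= 1 - cabs z ^+ 2 by exact: ltW (one_sub_sqr_gt0 bD).
have dQ : cabs d * (1 - cabs z ^+ 2) <= 1 + B.
  rewrite (le_trans (ler_wpM2r zq (_ : _ <= cabs (d - h z) + cabs (h z))))//.
    by rewrite -[in leLHS](subrK (h z) d) cabsD.
  by rewrite mulrDl lerD.
have sp : 0 < (1 - b (phi n)) `^ alpha by rewrite powR_gt0// subr_gt0.
have : (phi n)%:R < Q.
  rewrite -(ltr_pM2r sp) (lt_le_trans mb)// (le_trans m1)// ler_wpM2r ?powR_ge0//.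
  by rewrite ler_wpM2l// exprn_ge0.
apply/negP; rewrite -leNgt.
have Q0 : 0 <= Q.
  by rewrite mulr_ge0 ?exprn_ge0// (le_trans _ dQ)// mulr_ge0// cabs_ge0.
have /andP[_ /ltW Qn] := truncn_itv Q0.
rewrite (le_trans Qn)// ler_nat (leq_trans _ (phin n))//; exact: leq_maxr.
Qed.

Lemma compact_bloch_small e : compact_operator (hankel mu) (bloch_norm alpha) (bloch_norm 1) ->
  0 < e -> exists s, 0 <= s < 1 /\ carleson_from mu alpha s e.
Proof.
move=> cH e0; apply: contrapT => ne.
have [s [A' [s01 cA']]] := compact_bloch_carleson cH.
have [A [A0 cA]] := carleson_from_0 alpha1 s01 cA'.
have [b Hb] := @not_carleson_seq (fun=> e) (fun _ s s01 c => ne (ex_intro _ s (conj s01 c))).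
have b2 j : 2^-1 <= b j < 1 by case: (Hb j).
have b01 j : 0 <= b j < 1.
  by have /andP[h ->] := b2 j; rewrite (le_trans _ h)// invr_ge0.
have [G [phi [h [B [HG phin _ near_h]]]]] := tfun_selection b01 cH.
have [Q [Q0 HQ]] := tfun_image_upper alpha1 alphap A0 cA.
have h0 z : disc z -> h z = 0.
  move=> zD; apply/eqP; rewrite -cabs_eq0; apply/eqP.
  have z1 : 0 < 1 - cabs z by rewrite subr_gt0.
  have zq := one_sub_sqr_gt0 zD.
  suff : cabs (h z) * (1 - cabs z ^+ 2) <= 0.
    rewrite pmulr_lle0// => hz; apply/eqP; by rewrite eq_le hz cabs_ge0.
  apply/ler_addgt0Pr => d d0; rewrite add0r.
  pose S := Q * (1 - cabs z) ^- 2 * (1 - cabs z ^+ 2).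
  have S0 : 0 <= S by rewrite !mulr_ge0 ?(ltW zq)// invr_ge0 exprn_ge0// ltW.
  (* As soon as [1 - b <= r], the square root in [tfun_image_upper] is at most [d / 2 / (S + 1)],
     and the image contributes at most [d / 2]. *)
  pose r := (d / 2 / (S + 1)) ^+ 2.
  have S1 : 0 < S + 1 by rewrite ltr_wpDl.
  have d1 : 0 < d / 2 / (S + 1) by rewrite !divr_gt0.
  have r0 : 0 < r by rewrite exprn_gt0.
  have d20 : 0 < d / 2 by rewrite divr_gt0.
  have [N1 _ HN1] := near_h (d / 2) d20.
  have [N2 _ HN2] := near_infty_natSinv_lt (PosNum r0).
  pose n := maxn N1 N2.
  have := HN1 n (leq_maxl _ _) z zD.
  have := HQ _ _ z (b01 (phi n)) (HG (phi n)) zD.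
  set P := (_ `^ _); set g := derive1 _ _ => gP gh.
  have P0 : 0 <= P by exact: powR_ge0.
  have Pd : P <= d / 2 / (S + 1).
    have -> : d / 2 / (S + 1) = r `^ 2^-1.
      by rewrite /r -powR_mulrn ?(ltW d1)// -powRrM divff// powRr1// ltW.
    have [_ hb _] := Hb (phi n); have /andP[_ bn1] := b01 (phi n).
    rewrite ge0_ler_powR ?nnegrE ?invr_ge0 ?subr_ge0 ?(ltW bn1) ?(ltW r0)//.
    rewrite (le_trans hb)// ltW// (le_lt_trans _ (HN2 n (leq_maxr _ _)))//.
    by rewrite lef_pV2 ?posrE// ler_nat ltnS.
  have : cabs g * (1 - cabs z ^+ 2) <= d / 2.
    apply: (@le_trans _ _ (P * S)).
      apply: le_trans (ler_wpM2r (ltW zq) gP) _.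
      by rewrite le_eqVlt; apply/orP; left; apply/eqP; rewrite /S; ring.
    apply: le_trans (ler_wpM2r S0 Pd) _.
    by rewrite mulrAC ler_pdivrMr// ler_wpM2l ?(ltW d20)// lerDl.
  have : cabs (h z) * (1 - cabs z ^+ 2) <=
      (cabs (g - h z) + cabs g) * (1 - cabs z ^+ 2).
    apply: ler_wpM2r; first exact: ltW.
    rewrite -[in leLHS](subKr g (h z)) (le_trans (cabsD _ _))// cabsN; lra.
  rewrite mulrDl => q1 q2; apply: le_trans q1 _.
  by rewrite [leRHS]splitr lerD.
(* The constant [2 ^+ p.+3] of [tfun_image_lower] turns this into [e / 2], against a ratio that
   exceeds [e] at [b (phi N)]. *)
have e1 : 0 < e / 2 ^+ p.+4 by rewrite divr_gt0// exprn_gt0.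
have [N _ /(_ N (leqnn N)) HN] := near_h _ e1.
have [/andP[_ b1] _ mb] := Hb (phi N).
have bD := @disc_rc R _ (b01 (phi N)).
have := HN _ bD; rewrite (h0 _ bD) subr0 => dz.
have := tfun_image_lower (b2 (phi N)) (HG (phi N)).
have sp : 0 < (1 - b (phi N)) `^ alpha by rewrite powR_gt0// subr_gt0.
move=> /(lt_le_trans mb); rewrite (ltr_pM2r sp); apply/negP; rewrite -leNgt.
have q0 : 0 <= (2 : R) ^+ p.+3 by rewrite exprn_ge0.
apply: le_trans (ler_wpM2l q0 dz) _.
rewrite [leLHS](_ : _ = e / 2); last first.
  rewrite (exprS 2 p.+3); set X := 2 ^+ p.+3; field.
  by rewrite expf_neq0.
by rewrite ler_pdivrMr// ler_peMr ?(ltW e0)// ler1n.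
Qed.

End CompactnessNecessity.

Lemma compact_bloch_vanishing {R : realType}
    (mu : {finite_measure set (measurableTypeR R) -> \bar R}) (alpha : R) : 1 < alpha ->
  compact_operator (hankel mu) (bloch_norm alpha) (bloch_norm 1) -> vanishing_carleson alpha mu.
Proof.
move=> alpha1 cH; have al0 : 0 <= alpha by rewrite (le_trans ler01)// ltW.
(* This fixes [p] as the integer part of [alpha]. *)
have /andP[_ /ltW alphap] := truncn_itv al0.
apply/cvgrPdist_le => e e0.
have [s [/andP[s0 s1] cs]] := compact_bloch_small alpha1 alphap cH e0.
exists (1 - s) => /=; first by rewrite subr_gt0.
move=> t /=; rewrite /ball_/= => ts t1.
have t0 : 0 < (1 - t) `^ alpha by rewrite powR_gt0// subr_gt0.
rewrite sub0r normrN ger0_norm; last by rewrite divr_ge0 ?(ltW t0)//; exact: mass_ge0.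
rewrite ler_pdivrMr//; apply: cs; rewrite t1 andbT.
by move: ts; rewrite gtr0_norm ?subr_gt0// ltrD2l ltrN2 => /ltW.
Qed.

Unset Implicit Arguments.

Theorem theorem3p6 (R : realType)
    (mu : {finite_measure set (measurableTypeR R) -> \bar R})
    (hmu : mu (~` [set` `[0%R, 1%R[]) = 0%E)
    (alpha : R) (halpha : 1 < alpha) :
  (vanishing_carleson alpha mu <->
     compact_operator (hankel mu) (bloch_norm alpha) (bloch_norm 1)) /\
  (vanishing_carleson alpha mu <->
     compact_operator (hankel mu) (bloch_norm alpha) (@bmoa_norm R)).
Proof.
have c23 := @compact_bmoa_bloch R mu alpha.
have c31 := @vanishing_compact_bmoa R mu alpha halpha.
have c12 := @compact_bloch_vanishing R mu alpha halpha.
by split; split; [move=> /c31/c23|exact: c12|exact: c31|move=> /c23/c12].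
Qed.
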